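(* For every field $\mathbb{K}$ and all parameters $X=(x_1,\dots,x_{N-1})$, $Y=(y_1,\dots,y_{N-2})$ in $\mathbb{K}$, the Okada algebra $\mathbf{O}_N(X,Y)$ is cellular with the following cell datum: (1) the cell poset is $(\Lambda,\le)=(\mathbb{YFS}_N,\preceq)$, the Fibonacci sets of rank $N$ with the dominance order; (2) the involution is the linear map $i:E_D\mapsto E_{D^\star}$; (3) for $S\in\mathbb{YFS}_N$, $\mathfrak{M}(S)$ is the set of Okada half arc-diagrams $H$ of rank $N$ with $\mathrm{PropLab}(H)=S$; (4) for $L,R\in\mathfrak{M}(S)$ the cell element is $C^S_{LR}=E_{L\bowtie R}$.
   Context: Cellular algebra: a cell datum for a $\mathbb{K}$-algebra $A$ is a tuple $(\Lambda,i,\mathfrak{M},C)$ with $(\Lambda,\le)$ a finite poset, $i:A\to A$ a $\mathbb{K}$-linear anti-automorphism with $i^2=\mathrm{id}$, for each $\lambda\in\Lambda$ a non-empty finite set $\mathfrak{M}(\lambda)$, and an injective map $C:\bigsqcup_\lambda\mathfrak{M}(\lambda)\times\mathfrak{M}(\lambda)\to A$, $(\mathfrak{s},\mathfrak{t})\mapsto C^\lambda_{\mathfrak{st}}$, such that: the image of $C$ is a basis of $A$; $i(C^\lambda_{\mathfrak{st}})=C^\lambda_{\mathfrak{ts}}$; and for all $\lambda$, $\mathfrak{s},\mathfrak{t}\in\mathfrak{M}(\lambda)$, $a\in A$: $aC^\lambda_{\mathfrak{st}}\equiv\sum_{\mathfrak{u}\in\mathfrak{M}(\lambda)}r_a(\mathfrak{u},\mathfrak{s})C^\lambda_{\mathfrak{ut}}$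 modulo $A(<\lambda)$, the span of all $C^\mu_{\mathfrak{vw}}$ with $\mu<\lambda$, where $r_a(\mathfrak{u},\mathfrak{s})\in\mathbb{K}$ does not depend on $\mathfrak{t}$. Okada algebra: $\mathbf{O}_N(X,Y)$ is the unital associative algebra generated by $E_1,\dots,E_{N-1}$ with relations $E_i^2=x_iE_i$, $E_iE_j=E_jE_i$ ($|i-j|\ge2$), $E_{i+1}E_iE_{i+1}=y_iE_{i+1}$ ($1\le i\le N-2$). Okada arc-diagrams. Let $[N]=\{1,\dots,N\}$, $\overline{[N]}=\{\bar1,\dots,\bar N\}$, $|i|=|\bar i|=i$, ordered by $1<\dots<N<\bar N<\dots<\bar1$. A non-crossing arc-diagram of rank $N$ is a perfect matching of $[N]\cup\overline{[N]}$ (pairs are arcs) with no arcs $\{a,b\},\{c,d\}$ with $a<c<b<d$. Arc $\{a<b\}$ is nested in $\{c<d\}$ if $c<a<b<d$. An Okada arc-diagram is a non-crossing arc-diagram with integer labels on arcs such that the label of $\{a,b\}$ is at least $1$, at most $\min(|a|,|b|)$ and of the same parity as $\min(|a|,|b|)$, and an arc nested in another has a strictly larger label. Product: identify each node $\bar i$ of the left factor with node $i$ of the right factor, concatenate arcs, discard closed loops, label each resulting arc by the minimum of the labels of the arcs composing it. The mirror $D^\star$ exchanges $i$ and $\bar i$ for all $i$, keeping labels. $A_i$ ($1\le i<N$) has arcs $\{a,\bar a\}$ labelled $a$ for $a\ne i,i+1$ and arcs $\{i,i+1\}$, $\{\bar i,\overline{i+1}\}$ labelled $i$. For $\sigma\in\mathfrak{S}_N$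 let $c_i=\#\{k<i:\sigma^{-1}(k)>\sigma^{-1}(i)\}$; for $g_i=A_i$ or $g_i=E_i$ set $g_\sigma=\prod_{i=1}^N(g_{i-1}g_{i-2}\cdots g_{i-c_i})$, factors ordered with $i$ increasing. Then $\sigma\mapsto A_\sigma$ is a bijection from $\mathfrak{S}_N$ to rank $N$ Okada arc-diagrams, and $E_D:=E_\sigma$ where $A_\sigma=D$. Half diagrams: the left half of an Okada arc-diagram $D$ keeps the labelled arcs joining two nodes of $[N]$ and replaces each arc joining $i\in[N]$ to $\overline{[N]}$ by a propagating half arc at $i$ with the same label; the right half of $D$ is the left half of $D^\star$. Okada half arc-diagrams of rank $N$ are exactly the left halves of rank $N$ Okada arc-diagrams; $\mathrm{PropLab}(H)$ is the set of labels of the propagating half arcs of $H$. If $\mathrm{PropLab}(L)=\mathrm{PropLab}(R)$, $L\bowtie R$ is the unique Okada arc-diagram with left half $L$ and right half $R$. Fibonacci sets: a Fibonacci set of rank $N$ is a subset $S=\{s_1<\dots<s_k\}$ of $[N]$ with $k\equiv N\pmod2$ and $s_i\equiv i\pmod2$ for all $i$; $\mathbb{YFS}_N$ is the set of these. Dominance order: $S=\{s_1<\dots<s_k\}\preceq T=\{t_1<\dots<t_l\}$ if $k\le l$ and $s_{k-i}\le t_{l-i}$ for all $0\le i<k$. *)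

(* Defs.v *)
From HB Require Import structures.
From mathcomp Require Import all_boot all_order all_algebra all_fingroup.
From mathcomp Require Import generic_quotient boolp.

Set Implicit Arguments.
Unset Strict Implicit.
Unset Printing Implicit Defensive.

Import Order.TTheory GRing.Theory.

Local Open Scope ring_scope.

Section Cellular.
Variables (K : fieldType) (A : algType K).

Definition lin_indep (I : finType) (b : I -> A) : Prop :=
  forall f : I -> K, \sum_i f i *: b i = 0 -> forall i, f i = 0.

Definition in_span (I : finType) (P : pred I) (b : I -> A) (x : A) : Prop :=
  exists f : I -> K, x = \sum_(i | P i) f i *: b i.

Variables (d : Order.disp_t) (L : finPOrderType d) (M : L -> finType).
Variable C : forall l : L, M l -> M l -> A.

Definition cell_index : finType := {l : L & (M l * M l)%type}.
Definition cell_elt (x : cell_index) : A :=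
  C (tagged x).1 (tagged x).2.

Record cell_datum (inv : {linear A -> A}) : Prop := CellDatum {
  cell_inv_anti : forall a b, inv (a * b) = inv b * inv a;
  cell_inv_one : inv 1 = 1;
  cell_inv_invol : forall a, inv (inv a) = a;
  cell_nonempty : forall l : L, (0 < #|M l|)%N;
  cell_inj : injective cell_elt;
  cell_free : lin_indep cell_elt;
  cell_gen : forall a, in_span xpredT cell_elt a;
  cell_inv_elt : forall (l : L) (s t : M l), inv (C s t) = C t s;
  cell_mul : forall l : L, exists r : A -> M l -> M l -> K,
    forall (a : A) (s t : M l),
      in_span (fun x : cell_index => (tag x < l)%O) cell_elt
        (a * C s t - \sum_(u : M l) r a u s *: C u t)
}.

End Cellular.

(* The algebra presented by the generators and relations is built as the
   quotient of the formal expressions by the least congruence that contains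
   the axioms of a K-algebra and the defining relations.  Generators and
   parameters are indexed from 0: [OGen i] is E_{i+1}, [X`_i] is x_{i+1} and
   [Y`_i] is y_{i+1}. *)
Inductive okada_term (K : Type) (n : nat) :=
| OGen of 'I_n
| OScal of K
| OAdd of okada_term K n & okada_term K n
| OMul of okada_term K n & okada_term K n.
Arguments OGen {K n}.
Arguments OScal {K n}.

HB.instance Definition _ (K : Type) (n : nat) :=
  gen_eqMixin (okada_term K n).
HB.instance Definition _ (K : Type) (n : nat) :=
  gen_choiceMixin (okada_term K n).

Section OkadaAlgebra.
Variables (K : fieldType) (N : nat).
Variables (X : (N.-1).-tuple K) (Y : (N.-2).-tuple K).

Local Notation term := (okada_term K N.-1).

Inductive okada_cong : term -> term -> Prop :=
| ocong_refl t : okada_cong t t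
| ocong_sym t u : okada_cong t u -> okada_cong u t
| ocong_trans t u v : okada_cong t u -> okada_cong u v -> okada_cong t v
| ocong_add t t' u u' : okada_cong t t' -> okada_cong u u' ->
    okada_cong (OAdd t u) (OAdd t' u')
| ocong_mul t t' u u' : okada_cong t t' -> okada_cong u u' ->
    okada_cong (OMul t u) (OMul t' u')
| ocong_scalD a b : okada_cong (OScal (a + b)) (OAdd (OScal a) (OScal b))
| ocong_scalM a b : okada_cong (OScal (a * b)) (OMul (OScal a) (OScal b))
| ocong_scalC a t : okada_cong (OMul (OScal a) t) (OMul t (OScal a))
| ocong_addA t u v : okada_cong (OAdd t (OAdd u v)) (OAdd (OAdd t u) v)
| ocong_addC t u : okada_cong (OAdd t u) (OAdd u t)
| ocong_add0 t : okada_cong (OAdd (OScal 0) t) t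
| ocong_mulA t u v : okada_cong (OMul t (OMul u v)) (OMul (OMul t u) v)
| ocong_mul1 t : okada_cong (OMul (OScal 1) t) t
| ocong_mul0 t : okada_cong (OMul (OScal 0) t) (OScal 0)
| ocong_mulDl t u v :
    okada_cong (OMul (OAdd t u) v) (OAdd (OMul t v) (OMul u v))
| ocong_mulDr t u v :
    okada_cong (OMul t (OAdd u v)) (OAdd (OMul t u) (OMul t v))
| ocong_sqr (i : 'I_N.-1) :
    okada_cong (OMul (OGen i) (OGen i)) (OMul (OScal X`_i) (OGen i))
| ocong_comm (i j : 'I_N.-1) : (i.+2 <= j)%N ->
    okada_cong (OMul (OGen i) (OGen j)) (OMul (OGen j) (OGen i))
| ocong_braid (i j : 'I_N.-1) : j = i.+1 :> nat ->
    okada_cong (OMul (OMul (OGen j) (OGen i)) (OGen j))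
               (OMul (OScal Y`_i) (OGen j)).

Definition okada_congb (t u : term) : bool := `[< okada_cong t u >].

Lemma okada_congP t u : reflect (okada_cong t u) (okada_congb t u).
Proof. exact: asboolP. Qed.

Lemma okada_congb_refl : reflexive okada_congb.
Proof. by move=> t; apply/okada_congP; apply: ocong_refl. Qed.

Lemma okada_congb_sym : symmetric okada_congb.
Proof.
by move=> t u; apply/okada_congP/okada_congP; apply: ocong_sym.
Qed.

Lemma okada_congb_trans : transitive okada_congb.
Proof.
move=> u t v /okada_congP tu /okada_congP uv.
by apply/okada_congP; apply: ocong_trans tu uv.
Qed.

Canonical okada_equiv :=
  EquivRel okada_congb okada_congb_refl okada_congb_sym okada_congb_trans.

Definition okada : Type := {eq_quot okada_equiv}%qT.

HB.instance Definition _ := Choice.on okada.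
HB.instance Definition _ := Quotient.on okada.

Local Open Scope quotient_scope.

Definition okada_pi (t : term) : okada := \pi_okada t.

Lemma okada_piP t u : okada_pi t = okada_pi u <-> okada_cong t u.
Proof.
split=> [/eqP|tu].
  by rewrite /okada_pi (@eqquotE term okada_equiv {eq_quot okada_equiv})
    => /okada_congP.
apply/eqP; rewrite /okada_pi (@eqquotE term okada_equiv {eq_quot okada_equiv}).
exact/okada_congP.
Qed.

Lemma okada_pi_repr x : okada_pi (repr x) = x.
Proof. exact: reprK. Qed.

Lemma okada_repr_pi t : okada_cong (repr (okada_pi t)) t.
Proof. by apply/okada_piP; rewrite okada_pi_repr. Qed.

Definition okada_scalar (c : K) : okada := okada_pi (OScal c).
Definition okada_add (x y : okada) : okada := okada_pi (OAdd (repr x) (repr y)).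
Definition okada_mul (x y : okada) : okada := okada_pi (OMul (repr x) (repr y)).
Definition okada_opp (x : okada) : okada := okada_mul (okada_scalar (-1)) x.

Lemma okada_pi_add t u :
  okada_add (okada_pi t) (okada_pi u) = okada_pi (OAdd t u).
Proof. by apply/okada_piP; apply: ocong_add; apply: okada_repr_pi. Qed.

Lemma okada_pi_mul t u :
  okada_mul (okada_pi t) (okada_pi u) = okada_pi (OMul t u).
Proof. by apply/okada_piP; apply: ocong_mul; apply: okada_repr_pi. Qed.

Lemma okada_ind (P : okada -> Prop) :
  (forall t, P (okada_pi t)) -> forall x, P x.
Proof. by move=> Pt x; rewrite -(okada_pi_repr x). Qed.

Lemma okada_addA : associative okada_add.
Proof.
elim/okada_ind=> t; elim/okada_ind=> u; elim/okada_ind=> v.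
by rewrite !okada_pi_add; apply/okada_piP/ocong_addA.
Qed.

Lemma okada_addC : commutative okada_add.
Proof.
elim/okada_ind=> t; elim/okada_ind=> u.
by rewrite !okada_pi_add; apply/okada_piP/ocong_addC.
Qed.

Lemma okada_add0 : left_id (okada_scalar 0) okada_add.
Proof.
by elim/okada_ind=> t; rewrite okada_pi_add; apply/okada_piP/ocong_add0.
Qed.

Lemma okada_mulA : associative okada_mul.
Proof.
elim/okada_ind=> t; elim/okada_ind=> u; elim/okada_ind=> v.
by rewrite !okada_pi_mul; apply/okada_piP/ocong_mulA.
Qed.

Lemma okada_mul1 : left_id (okada_scalar 1) okada_mul.
Proof.
by elim/okada_ind=> t; rewrite okada_pi_mul; apply/okada_piP/ocong_mul1.
Qed.

Lemma okada_scalarC c x :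
  okada_mul (okada_scalar c) x = okada_mul x (okada_scalar c).
Proof.
by elim/okada_ind: x => t; rewrite !okada_pi_mul; apply/okada_piP/ocong_scalC.
Qed.

Lemma okada_mul_1 : right_id (okada_scalar 1) okada_mul.
Proof. by move=> x; rewrite -okada_scalarC okada_mul1. Qed.

Lemma okada_mul0 x : okada_mul (okada_scalar 0) x = okada_scalar 0.
Proof.
by elim/okada_ind: x => t; rewrite okada_pi_mul; apply/okada_piP/ocong_mul0.
Qed.

Lemma okada_mulDl : left_distributive okada_mul okada_add.
Proof.
elim/okada_ind=> t; elim/okada_ind=> u; elim/okada_ind=> v.
rewrite okada_pi_add !okada_pi_mul okada_pi_add.
exact/okada_piP/ocong_mulDl.
Qed.

Lemma okada_mulDr : right_distributive okada_mul okada_add.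
Proof.
elim/okada_ind=> t; elim/okada_ind=> u; elim/okada_ind=> v.
rewrite okada_pi_add !okada_pi_mul okada_pi_add.
exact/okada_piP/ocong_mulDr.
Qed.

Lemma okada_scalarD a b :
  okada_scalar (a + b) = okada_add (okada_scalar a) (okada_scalar b).
Proof. by rewrite okada_pi_add; apply/okada_piP/ocong_scalD. Qed.

Lemma okada_scalarM a b :
  okada_scalar (a * b) = okada_mul (okada_scalar a) (okada_scalar b).
Proof. by rewrite okada_pi_mul; apply/okada_piP/ocong_scalM. Qed.

Lemma okada_addN : left_inverse (okada_scalar 0) okada_opp okada_add.
Proof.
move=> x; rewrite /okada_opp -{2}[x]okada_mul1 -okada_mulDl -okada_scalarD.
by rewrite addNr okada_mul0.
Qed.

Section Eval.
Variables (B : algType K) (f : 'I_N.-1 -> B).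

Fixpoint okada_eval (t : term) : B :=
  match t with
  | OGen i => f i
  | OScal c => c%:A
  | OAdd t u => okada_eval t + okada_eval u
  | OMul t u => okada_eval t * okada_eval u
  end.

Record okada_rels : Prop := OkadaRels {
  okada_rel_sqr : forall i, f i * f i = X`_i *: f i;
  okada_rel_comm : forall i j : 'I_N.-1, (i.+2 <= j)%N ->
    f i * f j = f j * f i;
  okada_rel_braid : forall i j : 'I_N.-1, j = i.+1 :> nat ->
    f j * f i * f j = Y`_i *: f j
}.

Lemma okada_eval_cong t u :
  okada_rels -> okada_cong t u -> okada_eval t = okada_eval u.
Proof.
case=> fsqr fcomm fbraid; elim=> {t u} //=.
- by move=> t u v _ -> _ ->.
- by move=> t t' u u' _ -> _ ->.
- by move=> t t' u u' _ -> _ ->.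
- by move=> a b; rewrite scalerDl.
- by move=> a b; rewrite -scalerAl mul1r scalerA.
- by move=> a t; rewrite -scalerAl -scalerAr mul1r mulr1.
- by move=> t u v; rewrite addrA.
- by move=> t u; rewrite addrC.
- by move=> t; rewrite scale0r add0r.
- by move=> t u v; rewrite mulrA.
- by move=> t; rewrite scale1r mul1r.
- by move=> t; rewrite scale0r mul0r.
- by move=> t u v; rewrite mulrDl.
- by move=> t u v; rewrite mulrDr.
- by move=> i; rewrite fsqr -scalerAl mul1r.
- by move=> i j ij; rewrite (fbraid _ _ ij) -scalerAl mul1r.
Qed.

End Eval.

Lemma okada_one_neq0 : okada_scalar 1 != okada_scalar 0.
Proof.
apply/eqP=> /okada_piP h.
have r : okada_rels (fun _ => 0 : K^o).
  by split=> *; rewrite ?mulr0 ?scaler0.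
by move/eqP: (okada_eval_cong r h); rewrite /= scale0r scale1r oner_eq0.
Qed.

HB.instance Definition _ := GRing.isZmodule.Build okada
  okada_addA okada_addC okada_add0 okada_addN.

HB.instance Definition _ := GRing.Zmodule_isNzRing.Build okada
  okada_mulA okada_mul1 okada_mul_1 okada_mulDl okada_mulDr okada_one_neq0.

Definition okada_scale (c : K) (x : okada) : okada := okada_scalar c * x.

Lemma okada_scaleA a b x :
  okada_scale a (okada_scale b x) = okada_scale (a * b) x.
Proof.
rewrite /okada_scale okada_scalarM; exact: okada_mulA.
Qed.

Lemma okada_scale1 : left_id 1 okada_scale.
Proof. exact: okada_mul1. Qed.

Lemma okada_scaleDr : right_distributive okada_scale +%R.
Proof. by move=> a x y; apply: mulrDr. Qed.

Lemma okada_scaleDl x : {morph okada_scale^~ x : a b / a + b}.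
Proof.
by move=> a b; rewrite /okada_scale okada_scalarD; apply: okada_mulDl.
Qed.

HB.instance Definition _ := GRing.Zmodule_isLmodule.Build K okada
  okada_scaleA okada_scale1 okada_scaleDr okada_scaleDl.

Lemma okada_scaleAl (a : K) (x y : okada) : a *: (x * y) = (a *: x) * y.
Proof. exact: okada_mulA. Qed.

HB.instance Definition _ := GRing.Lmodule_isLalgebra.Build K okada
  okada_scaleAl.

Lemma okada_scaleAr (a : K) (x y : okada) : a *: (x * y) = x * (a *: y).
Proof.
have h z : a *: z = okada_scalar a * z by [].
by rewrite !h mulrA [okada_scalar a * x]okada_scalarC -mulrA.
Qed.

HB.instance Definition _ := GRing.Lalgebra_isAlgebra.Build K okada
  okada_scaleAr.

Definition okada_gen (i : 'I_N.-1) : okada := okada_pi (OGen i).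

Lemma okada_scaleE (c : K) (x : okada) : c *: x = okada_scalar c * x.
Proof. by []. Qed.

Lemma okada_scalarE (c : K) : okada_scalar c = c%:A.
Proof. by rewrite okada_scaleE mulr1. Qed.

Lemma okada_piD t u : okada_pi (OAdd t u) = okada_pi t + okada_pi u.
Proof. by rewrite -okada_pi_add. Qed.

Lemma okada_piM t u : okada_pi (OMul t u) = okada_pi t * okada_pi u.
Proof. by rewrite -okada_pi_mul. Qed.

Lemma okada_gen_rels : okada_rels okada_gen.
Proof.
split=> [i|i j ij|i j ij].
- by rewrite okada_scaleE -!okada_piM; apply/okada_piP/ocong_sqr.
- by rewrite -!okada_piM; apply/okada_piP/ocong_comm.
- rewrite okada_scaleE -[okada_gen j * okada_gen i]okada_piM -!okada_piM.
  exact/okada_piP/ocong_braid.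
Qed.

Section UniversalProperty.
Variables (B : algType K) (f : 'I_N.-1 -> B) (rf : okada_rels f).

Definition okada_lift (x : okada) : B := okada_eval f (repr x).

Lemma okada_lift_pi t : okada_lift (okada_pi t) = okada_eval f t.
Proof. exact: okada_eval_cong rf (okada_repr_pi t). Qed.

Lemma okada_liftD x y : okada_lift (x + y) = okada_lift x + okada_lift y.
Proof.
elim/okada_ind: x => t; elim/okada_ind: y => u.
by rewrite -okada_piD !okada_lift_pi.
Qed.

Lemma okada_liftM x y : okada_lift (x * y) = okada_lift x * okada_lift y.
Proof.
elim/okada_ind: x => t; elim/okada_ind: y => u.
by rewrite -okada_piM !okada_lift_pi.
Qed.

Lemma okada_liftZ (c : K) x : okada_lift (c *: x) = c *: okada_lift x.
Proof.
by rewrite okada_scaleE okada_liftM okada_lift_pi /= -scalerAl mul1r.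
Qed.

Lemma okada_lift1 : okada_lift 1 = 1.
Proof. by rewrite okada_lift_pi /= scale1r. Qed.

Lemma okada_lift_gen i : okada_lift (okada_gen i) = f i.
Proof. exact: okada_lift_pi. Qed.

Lemma okada_lift_unique (g : {lrmorphism okada -> B}) :
  (forall i, g (okada_gen i) = f i) -> g =1 okada_lift.
Proof.
move=> gf; elim/okada_ind=> t; rewrite okada_lift_pi.
elim: t => [i|c|t IHt u IHu|t IHt u IHu] /=.
- exact: gf.
- by rewrite -[okada_pi _]/(okada_scalar c) okada_scalarE linearZ /= rmorph1.
- by rewrite okada_piD rmorphD /= IHt IHu.
- by rewrite okada_piM rmorphM /= IHt IHu.
Qed.

End UniversalProperty.

(* E_j with the usual 1-based index; only 1 <= j < N is meaningful. *)
Definition okada_E (j : nat) : okada := oapp okada_gen 1 (insub j.-1).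

End OkadaAlgebra.

Local Open Scope nat_scope.

(* [(false, i)] is the node i+1 and [(true, i)] is the node bar(i+1). *)
Definition node (N : nat) : finType := (bool * 'I_N)%type.

(* A labelled perfect matching is the function mapping a node to its partner
   together with the label of their arc; the labels of an Okada arc-diagram
   are at most N.  This type contains junk; [is_okada] carves out the
   Okada arc-diagrams. *)
Definition diagram (N : nat) : finType := {ffun node N -> node N * 'I_N.+1}.

Section Diagrams.
Variable N : nat.
Implicit Types (a b c : node N) (D : diagram N).

Definition flip a : node N := (~~ a.1, a.2).
Definition absn a : nat := a.2.+1.
(* Position in the order 1 < ... < N < bar N < ... < bar 1. *)
Definition pos a : nat := if a.1 then N + N - absn a else a.2.

Definition partner D a : node N := (D a).1.
Definition lab D a : 'I_N.+1 := (D a).2.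

Definition is_matching D : bool :=
  [forall a, [&& partner D a != a, partner D (partner D a) == a
               & lab D (partner D a) == lab D a]].

Definition noncrossing D : bool :=
  [forall a, forall c,
    ~~ [&& pos a < pos c, pos c < pos (partner D a)
         & pos (partner D a) < pos (partner D c)]].

Definition well_labelled D : bool :=
  [forall a, let m := minn (absn a) (absn (partner D a)) in
    [&& 1 <= lab D a, lab D a <= m & odd (lab D a) == odd m]].

Definition labels_nested D : bool :=
  [forall a, forall c,
    [&& pos c < pos a, pos a < pos (partner D a)
      & pos (partner D a) < pos (partner D c)] ==> (lab D c < lab D a)].

Definition is_okada D : bool :=
  [&& is_matching D, noncrossing D, well_labelled D & labels_nested D].

Definition diagram_id : diagram N := [ffun a => (flip a, inord (absn a))].

(* The product, through the graph obtained by gluing: its vertices are the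
   outer nodes [inl a] and the middle nodes [inr i], and its edges are the arcs
   of both factors. The component of an outer node is the path that is
   concatenated into one arc; closed loops contain no outer node. *)
Definition glue_left a : node N + 'I_N := if a.1 then inr a.2 else inl a.
Definition glue_right a : node N + 'I_N := if a.1 then inl a else inr a.2.

Definition glue_edge D1 D2 : rel (node N + 'I_N) := fun p q =>
  [exists a, (p == glue_left a) && (q == glue_left (partner D1 a))]
  || [exists a, (p == glue_right a) && (q == glue_right (partner D2 a))].

Definition glue_conn D1 D2 : rel (node N + 'I_N) :=
  connect (glue_edge D1 D2).

Definition diagram_mul D1 D2 : diagram N :=
  [ffun a =>
    (odflt a [pick b | (b != a) && glue_conn D1 D2 (inl a) (inl b)],
     Order.min
       (\big[Order.min/ord_max]_(c | glue_conn D1 D2 (inl a) (glue_left c))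
          lab D1 c)
       (\big[Order.min/ord_max]_(c | glue_conn D1 D2 (inl a) (glue_right c))
          lab D2 c))].

Definition mirror D : diagram N :=
  [ffun a => (flip (partner D (flip a)), lab D (flip a))].

(* A_i with the usual 1-based index 1 <= i < N. *)
Definition diagram_A (i : nat) : diagram N :=
  [ffun a =>
    if absn a == i then ((a.1, insubd a.2 a.2.+1), inord i)
    else if absn a == i.+1 then ((a.1, insubd a.2 a.2.-1), inord i)
    else (flip a, inord (absn a))].

(* c_i; the count does not depend on numbering from 0 or from 1. *)
Definition perm_code (s : 'S_N) (i : 'I_N) : nat :=
  #|[set k : 'I_N | (k < i) && ((s^-1)%g i < (s^-1)%g k)]|.

(* g_s. The 0-based [i] stands for the 1-based i+1, so its factor is
   g_i g_{i-1} ... g_{i+1-c}, where g itself is 1-based. *)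
Definition perm_prod (T : Type) (mul : T -> T -> T) (one : T) (g : nat -> T)
    (s : 'S_N) : T :=
  \big[mul/one]_(i < N) \big[mul/one]_(j < perm_code s i) g (i - j).

Definition diagram_perm (s : 'S_N) : diagram N :=
  perm_prod diagram_mul diagram_id diagram_A s.

(* A node is mapped to [Some] of its partner, or to [None] if it carries a
   propagating half arc, together with the label of the (half) arc. *)
Definition half_diagram : finType := {ffun 'I_N -> option 'I_N * 'I_N.+1}.

Definition left_half D : half_diagram :=
  [ffun i => let b := partner D (false, i) in
    (if b.1 then None else Some b.2, lab D (false, i))].

Definition right_half D : half_diagram := left_half (mirror D).

Definition is_okada_half (H : half_diagram) : bool :=
  [exists D, is_okada D && (left_half D == H)].

Definition prop_lab (H : half_diagram) : {set 'I_N.+1} :=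
  [set (H i).2 | i : 'I_N & (H i).1 == None].

(* The default is never reached when L and R are Okada half arc-diagrams with
   the same propagating labels. *)
Definition bowtie (L R : half_diagram) : diagram N :=
  odflt diagram_id
    [pick D | [&& is_okada D, left_half D == L & right_half D == R]].

(* The value of [i : 'I_N.+1] is the integer itself, so [N] is the set of
   nonzero elements; [enum] lists the elements of a set increasingly. *)
Definition elts (S : {set 'I_N.+1}) : seq nat := [seq val i | i <- enum S].

Definition is_fib (S : {set 'I_N.+1}) : bool :=
  [&& ord0 \notin S, odd #|S| == odd N
    & [forall i : 'I_#|S|, odd (nth 0 (elts S) i) == odd i.+1]].

Record fib_set : Type := FibSet { fib_val :> {set 'I_N.+1}; _ : is_fib fib_val }.

HB.instance Definition _ := [isSub for fib_val].
HB.instance Definition _ := [Finite of fib_set by <:].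

(* s_{k-i} <= t_{l-i} for 0 <= i < k, with 1-based indices. *)
Definition dominated (S T : fib_set) : bool :=
  (#|S| <= #|T|) &&
  [forall i : 'I_#|S|,
    nth 0 (elts S) (#|S| - i.+1) <= nth 0 (elts T) (#|T| - i.+1)].

Lemma size_elts (S : {set 'I_N.+1}) : size (elts S) = #|S|.
Proof. by rewrite size_map -cardE. Qed.

Lemma mem_elts (S : {set 'I_N.+1}) (i : 'I_N.+1) : (val i \in elts S) = (i \in S).
Proof. by rewrite (mem_map val_inj) mem_enum. Qed.


Lemma dominated_refl : reflexive dominated.
Proof. by move=> S; rewrite /dominated leqnn /=; apply/forallP. Qed.

Lemma dominated_anti : antisymmetric dominated.
Proof.
move=> S T /andP[/andP[leST /forallP hST] /andP[leTS /forallP hTS]].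
have eqc : #|S| = #|T| by apply/eqP; rewrite eqn_leq leST.
apply: val_inj => /=; apply/setP=> x; rewrite -!mem_elts.
suff -> : elts S = elts T by [].
apply: (@eq_from_nth _ 0) => [|i]; rewrite !size_elts // => ltiS.
have lt1 : #|S| - i.+1 < #|S| by rewrite ltn_subrL (leq_ltn_trans _ ltiS).
have lt2 : #|S| - i.+1 < #|T| by rewrite -eqc.
have idx : #|S| - (#|S| - i.+1).+1 = i by rewrite -subSn // subSS subKn // ltnW.
apply/eqP; rewrite eqn_leq.
have := hST (Ordinal lt1); have := hTS (Ordinal lt2).
by rewrite /= -eqc idx => -> ->.
Qed.

Lemma dominated_trans : transitive dominated.
Proof.
move=> T S U /andP[leST /forallP hST] /andP[leTU /forallP hTU].
apply/andP; split; first exact: leq_trans leTU.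
apply/forallP=> i; apply: leq_trans (hST i) _.
exact: (hTU (widen_ord leST i)).
Qed.

Fact fib_display : Order.disp_t. Proof. exact: Order.Disp tt tt. Qed.

HB.instance Definition _ := Order.Le_isPOrder.Build fib_display fib_set
  dominated_refl dominated_anti dominated_trans.

Definition halves (S : fib_set) : finType :=
  {H : half_diagram | is_okada_half H && (prop_lab H == S)}.

End Diagrams.

Section Basis.
Variables (K : fieldType) (N : nat).
Variables (X : (N.-1).-tuple K) (Y : (N.-2).-tuple K).

Definition okada_perm (s : 'S_N) : okada X Y :=
  perm_prod *%R 1%R (okada_E X Y) s.

(* The default 0 is never reached on Okada arc-diagrams, since s |-> A_s is a
   bijection onto them. *)
Definition okada_basis (D : diagram N) : okada X Y :=
  oapp okada_perm 0%R [pick s | diagram_perm s == D].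

Definition okada_cell (S : fib_set N) (L R : halves S) : okada X Y :=
  okada_basis (bowtie (val L) (val R)).

End Basis.

(* Main.v *)
Require Import Defs.
From HB Require Import structures.
From mathcomp Require Import all_boot all_order all_algebra all_fingroup.
From mathcomp Require Import generic_quotient boolp zify.

Set Implicit Arguments.
Unset Strict Implicit.
Unset Printing Implicit Defensive.

Import Order.TTheory GRing.Theory.

(** Words in the generators are rewritten with the defining relations, keeping
    track of the monomial in the parameters that comes out ([reduces]). Pushing
    one more letter into the last block brings every word to the word of a code
    ([normal_form]); codes are the Lehmer codes of permutations ([code_perm]),
    so the elements E_sigma span the algebra.

    The monomial is determined by the word ([reduces_uniq]). Indeed a generator
    acts on labelled matchings by a surgery at two neighbouring nodes, and this
    action is compatible with the relations. The diagram of a word and, for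
    each label, the number of loops closed while the word acts are therefore
    controlled; the loops give the exponents of the x, and the numbers of
    letters then give the exponents of the y. As a consequence the rule
    E_i . sigma = monomial . tau defines a representation for all values of the
    parameters, including 0, and it shows that the E_sigma are linearly
    independent ([okada_perm_free]).

    Draw the 2N nodes on a line. The last block of a word then inserts one small
    arc in a diagram of smaller rank ([code_line_ins]), and the inserted arc can
    be recognised and removed ([ins_inj], [okada_line_split]). This gives the
    bijection between permutations and Okada diagrams. The product of diagrams
    agrees with the action by surgery ([diagram_mul_word]).

    If each arc is drawn so that it reaches down to the level of its label, then
    the word of a diagram contains a letter half as often as arcs cross the
    corresponding level ([level_code_word]). This number is the same for the
    mirror image, so reversing the word of a diagram gives the word of the
    mirror image without any monomial ([reduces_rev]): the anti-automorphism
    that fixes the generators maps E_D to E_D', where D' is the mirror image of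
    D. The number is also a sum of contributions of the two halves of the
    diagram, so the monomial in E_i E_(L |><| R) only depends on L as long as
    the right half is kept ([act_monomial]).

    Finally, left multiplication by a generator changes the left half in a way
    that only depends on the left half ([left_half_act]). Seen from the right
    nodes it can only join two propagating arcs or lower their labels; hence the
    set of propagating labels decreases in the dominance order
    ([act_dominated]), and if the set stays the same then so does the right half
    ([act_right_half]). Two halves with the same propagating labels are joined in
    a unique way since the labels of propagating arcs are distinct and sorted
    ([okada_join], [okada_half_inj]). *)

(** * Surgery on labelled matchings *)

(** Decides one equality between expressions without conditionals, and prunes
    by congruence closure: enough for any finite configuration of nodes. *)
Ltac eqcase := match goal with |- context [?a == ?b] =>
  lazymatch a with context [if _ then _ else _] => fail | _ =>
  lazymatch b with context [if _ then _ else _] => fail | _ =>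
  case: (@eqP _ a b) => ? /=; try congruence end end end.

(** Implications in the context multiply the cases to be refuted, so they are
    dropped where they do not matter. *)
Ltac lin := repeat match goal with H : is_true _ -> _ |- _ => clear H end; lia.

Section Surgery.
Variable T : eqType.
Implicit Types (u v w x : T) (f : T -> T) (l : T -> nat).

(** Stacking a generator on a diagram joins the two nodes u and v by a new arc
    of label z, and joins their former partners f u and f v. The formulas stay
    correct when u and v are already partners. The label z does not enter the
    minimum for the arc from f u to f v, because the label of u never exceeds
    it in the situations where this surgery is used. *)
Definition splice u v f x : T :=
  if x == u then v else if x == v then u else
  if x == f u then f v else if x == f v then f u else f x.

Definition splice_lab u v z f l x : nat :=
  if (x == u) || (x == v) then z else
  if (x == f u) || (x == f v) then minn (l u) (l v) else l x.

Definition matching f l :=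
  forall x, [/\ f x <> x, f (f x) = x & l (f x) = l x].

Lemma matching_inj f l : matching f l -> injective f.
Proof. by move=> m x y /(congr1 f); case: (m x) => _ -> _;
  case: (m y) => _ ->. Qed.

Lemma splice_matching u v z f l : matching f l -> u <> v ->
  matching (splice u v f) (splice_lab u v z f l).
Proof.
move=> m uv x; rewrite /splice /splice_lab.
have [fu ffu lu] := m u; have [fv ffv lv] := m v; have [fx ffx lx] := m x.
have inj := matching_inj m.
split.
- by repeat eqcase.
- by repeat eqcase.
repeat eqcase; subst; rewrite ?ffu ?ffv ?lu ?lv; try lia; try congruence.
all: have : l (f u) = l (f v) by congruence. all: lia.
Qed.

Lemma splice_comm u v z u' v' z' f l : matching f l ->
  u <> v -> u' <> v' -> u <> u' -> u <> v' -> v <> u' -> v <> v' ->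
  splice u v (splice u' v' f) =1 splice u' v' (splice u v f) /\
  splice_lab u v z (splice u' v' f) (splice_lab u' v' z' f l)
    =1 splice_lab u' v' z' (splice u v f) (splice_lab u v z f l).
Proof.
move=> m n1 n2 n3 n4 n5 n6; rewrite /splice /splice_lab.
have [fu ffu lu] := m u; have [fv ffv lv] := m v.
have [fu' ffu' lu'] := m u'; have [fv' ffv' lv'] := m v'.
have inj := matching_inj m.
split=> x; move: (m x) => [fx ffx lx].
- by repeat eqcase.
repeat eqcase; try lia.
all: first [have : l u = l u' by congruence | have : l u = l v' by congruence
  | have : l v = l u' by congruence | have : l v = l v' by congruence].
all: lia.
Qed.

Lemma splice_idem u v z f l : matching f l -> u <> v ->
  splice u v (splice u v f) =1 splice u v f /\
  splice_lab u v z (splice u v f) (splice_lab u v z f l)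
    =1 splice_lab u v z f l.
Proof.
move=> m uv; rewrite /splice /splice_lab.
have [fu ffu lu] := m u; have [fv ffv lv] := m v.
have inj := matching_inj m.
by split=> x; move: (m x) => [fx ffx lx]; repeat eqcase.
Qed.

(** After the surgery at v and w, the surgery at u and v followed by the one at
    v and w leads the strand of u back to its place; it only picks up the
    labels z and z', which are not smaller than its own. *)
Lemma splice_braid u v w z z' f l : matching f l ->
  u <> v -> u <> w -> v <> w -> l u <= z -> z <= z' ->
  let f1 := splice v w f in let l1 := splice_lab v w z' f l in
  let f2 := splice u v f1 in let l2 := splice_lab u v z f1 l1 in
  splice v w f2 =1 f1 /\ splice_lab v w z' f2 l2 =1 l1.
Proof.
move=> m uv uw vw luz zz' /=; rewrite /splice /splice_lab.
have [fu ffu lu] := m u; have [fv ffv lv] := m v; have [fw ffw lw] := m w.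
have inj := matching_inj m.
split=> x; move: (m x) => [fx ffx lx]; repeat eqcase; try lia.
all: try (have : l x = l u by congruence); try lia.
all: try (have : l u = l v by congruence);
  try (have : l u = l w by congruence); try lia.
Qed.

End Surgery.

(** * The action of the generators on diagrams *)

Section Diag.
Variable N : nat.
Implicit Types (D : diagram N) (u v a : node N).

Definition slab D a : nat := lab D a.

Lemma diagram_ext D D' :
  partner D =1 partner D' -> slab D =1 slab D' -> D = D'.
Proof.
move=> e1 e2; apply/ffunP=> a.
have := e1 a; have := e2 a; rewrite /slab /lab /partner => /val_inj.
by case: (D a) => ? ?; case: (D' a) => ? ? /= -> ->.
Qed.

Definition surgery u v (z : nat) D : diagram N :=
  [ffun x => (splice u v (partner D) x, inord
    (splice_lab u v z (partner D) (slab D) x))].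

Lemma partner_surgery u v z D : partner (surgery u v z D)
  =1 splice u v (partner D).
Proof. by move=> x; rewrite /partner ffunE. Qed.

Lemma slab_surgery u v z D : z <= N ->
  slab (surgery u v z D) =1 splice_lab u v z (partner D) (slab D).
Proof.
move=> zN x; rewrite /slab /lab ffunE /= inordK // /splice_lab.
have h a : slab D a <= N by rewrite -ltnS ltn_ord.
by case: ifP => // _; case: ifP => _; have := h u; have := h x; lia.
Qed.

Definition matched D := matching (partner D) (slab D).

Lemma matchedP D : reflect (matched D) (is_matching D).
Proof.
apply: (iffP forallP) => h a.
- by have /and3P[/eqP ? /eqP ? /eqP e] := h a; split=> //; rewrite /slab e.
- by have [? ? /val_inj ?] := h a; apply/and3P; split; apply/eqP.
Qed.

(** The part of being an Okada diagram on which the relations between the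
    generators depend; it is visibly stable under surgery. *)
Definition admissible D := matched D /\ forall a, slab D a <= absn a.

(** Multiplication by A_(h+1), on the left for [b = false] and on the right for
    [b = true]. Letters are numbered from 0, and a letter that is out of range
    acts trivially. *)
Definition gen_act (b : bool) (h : nat) D : diagram N :=
  match insub h : option 'I_N, insub h.+1 : option 'I_N with
  | Some x, Some y => surgery (b, x) (b, y) h.+1 D
  | _, _ => D
  end.

Lemma gen_actE b h (lt : h.+1 < N) D :
  gen_act b h D = surgery (b, Ordinal (ltnW lt)) (b, Ordinal lt) h.+1 D.
Proof. by rewrite /gen_act (insubT (fun i => i < N) (ltnW lt))
  (insubT (fun i => i < N) lt). Qed.

Lemma neq_node b b' h h' (lt : h < N) (lt' : h' < N) : (b, h) <> (b', h') ->
  (b, Ordinal lt) <> (b', Ordinal lt') :> node N.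
Proof. by move=> n [? ?]; apply: n; congr pair. Qed.

Lemma surgery_matched u v z D : u <> v -> z <= N -> matched D ->
  matched (surgery u v z D).
Proof.
move=> uv zN m x; rewrite /partner_surgery !slab_surgery // !partner_surgery.
exact: (splice_matching z m uv).
Qed.

Lemma splice_ext (T : eqType) (u v : T) f g : f =1 g ->
  splice u v f =1 splice u v g.
Proof. by move=> e x; rewrite /splice !e. Qed.

Lemma splice_lab_ext (T : eqType) (u v : T) z f g l l' :
  f =1 g -> l =1 l' -> splice_lab u v z f l =1 splice_lab u v z g l'.
Proof. by move=> e e' x; rewrite /splice_lab !e !e'. Qed.

Definition described D f l := partner D =1 f /\ slab D =1 l.

Lemma described_surgery u v z D f l : z <= N -> described D f l ->
  described (surgery u v z D) (splice u v f) (splice_lab u v z f l).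
Proof.
move=> zN [e1 e2]; split=> x.
  by rewrite partner_surgery; apply: splice_ext.
by rewrite slab_surgery //; apply: splice_lab_ext.
Qed.

Lemma described_ext D D' f f' l l' : described D f l -> described D' f' l' ->
  f =1 f' -> l =1 l' -> D = D'.
Proof.
by move=> [a b] [c d] e e'; apply: diagram_ext => x; rewrite ?a ?b ?c ?d.
Qed.

Lemma gen_act_admissible_valid b h D : h.+1 < N -> admissible D ->
  admissible (gen_act b h D).
Proof.
move=> lt [m le]; rewrite gen_actE; split.
  by apply: surgery_matched => //; [apply: neq_node => -[]; lia | apply: ltnW].
move=> a; rewrite slab_surgery; last exact: ltnW.
rewrite /splice_lab /absn; case: ifP => [/orP[]/eqP-> //=|_].
case: ifP => [/orP[]/eqP->|_]; last exact: le.
- have [_ _ e] := m (b, Ordinal (ltnW lt)).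
  by have := le (partner D (b, Ordinal (ltnW lt))); rewrite e /absn; lia.
- have [_ _ e] := m (b, Ordinal lt).
  by have := le (partner D (b, Ordinal lt)); rewrite e /absn; lia.
Qed.

Lemma gen_act_comm b b' h h' D : matched D -> h.+1 < N -> h'.+1 < N ->
  (b != b') || (h.+1 < h') || (h'.+1 < h) ->
  gen_act b h (gen_act b' h' D) = gen_act b' h' (gen_act b h D).
Proof.
move=> m lt lt' far; rewrite !gen_actE.
have [] := @splice_comm _ (b, Ordinal (ltnW lt)) (b, Ordinal lt) h.+1
   (b', Ordinal (ltnW lt')) (b', Ordinal lt') h'.+1 _ _ m.
all: try by apply: neq_node => -[]; move: far; case: b b' => [] [] //=; lia.
move=> e1 e2; apply: described_ext e1 e2; do !apply: described_surgery;
  by try exact: ltnW.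
Qed.

Lemma gen_act_idem b h D : matched D -> h.+1 < N ->
  gen_act b h (gen_act b h D) = gen_act b h D.
Proof.
move=> m lt; rewrite !gen_actE.
have [] := @splice_idem _ (b, Ordinal (ltnW lt)) (b, Ordinal lt) h.+1 _ _ m.
  by apply: neq_node => -[]; lia.
move=> e1 e2; apply: described_ext e1 e2; do !apply: described_surgery;
  by try exact: ltnW.
Qed.

Lemma gen_act_braid b h D : admissible D -> h.+2 < N ->
  gen_act b h.+1 (gen_act b h (gen_act b h.+1 D)) = gen_act b h.+1 D.
Proof.
move=> [m le] lt; have lt1 := ltnW lt; have lt2 := ltnW lt1.
rewrite (gen_actE b lt) (gen_actE b lt1).
have -> : Ordinal (ltnW lt) = Ordinal lt1 by exact: val_inj.
have -> : Ordinal (ltnW lt1) = Ordinal lt2 by exact: val_inj.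
rewrite !(gen_actE b lt).
have -> : Ordinal (ltnW lt) = Ordinal lt1 by exact: val_inj.
have [] := @splice_braid _ (b, Ordinal lt2) (b, Ordinal lt1) (b, Ordinal lt)
  h.+1 h.+2 _ _ m.
all: try by apply: neq_node => -[]; lia.
- exact: le.
- by [].
move=> e1 e2; apply: described_ext e1 e2; do !apply: described_surgery;
  by try exact: ltnW.
Qed.
End Diag.

(** * Rewriting words in the generators *)

Section Words.
Variable N : nat.

Definition far (h h' : nat) := (h.+1 < h') || (h'.+1 < h).

(** [reduces w m w'] says that w is equal to the monomial m times w' as a
    consequence of the defining relations. In a monomial, [(false, h)] stands
    for the parameter x of the letter h and [(true, h)] for the parameter y of
    the letters h and h+1. *)
Inductive reduces : seq nat -> seq (bool * nat) -> seq nat -> Prop :=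
| reduces_refl w : reduces w [::] w
| reduces_trans w m w' m' w'' : reduces w m w' -> reduces w' m' w'' ->
  reduces w (m ++ m') w''
| reduces_cat u v w m w' : reduces w m w' ->
  reduces (u ++ w ++ v) m (u ++ w' ++ v)
| reduces_sqr h : h.+1 < N -> reduces [:: h; h] [:: (false, h)] [:: h]
| reduces_comm h h' : h.+1 < N -> h'.+1 < N -> far h h' ->
    reduces [:: h; h'] [::] [:: h'; h]
| reduces_braid h : h.+2 < N -> reduces [:: h.+1; h; h.+1] [:: (true, h)]
  [:: h.+1].

Definition valid n (w : seq nat) := all (fun h => h.+1 < n) w.

Lemma valid_cat n u v : valid n (u ++ v) = valid n u && valid n v.
Proof. exact: all_cat. Qed.

Lemma validW n n' w : n <= n' -> valid n w -> valid n' w.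
Proof. by move=> le; apply: sub_all => h lt; apply: leq_trans le. Qed.

Lemma reduces_catl u w m w' : reduces w m w' -> reduces (u ++ w) m (u ++ w').
Proof. by move/(reduces_cat u [::]); rewrite !cats0. Qed.

Lemma reduces_catr v w m w' : reduces w m w' -> reduces (w ++ v) m (w' ++ v).
Proof. exact: (@reduces_cat [::] v). Qed.

Lemma reduces_swap1 h v : h.+1 < N -> valid N v -> all (far h) v ->
  reduces (h :: v) [::] (v ++ [:: h]).
Proof.
move=> lt; elim: v => [|g v IH] /=; first by move=> *; apply: reduces_refl.
move=> /andP[ltg vv] /andP[fg fv].
apply: (@reduces_trans _ [::] (g :: h :: v) [::]).
  exact: (reduces_catr v (reduces_comm lt ltg fg)).
exact: (reduces_catl [:: g] (IH vv fv)).
Qed.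

Lemma reduces_swap u v : valid N u -> valid N v -> allrel far u v ->
  reduces (u ++ v) [::] (v ++ u).
Proof.
elim: u => [|h u IH] /=; first by rewrite cats0 => *; apply: reduces_refl.
move=> /andP[lt vu] vv; rewrite allrel_consl => /andP[fh fu].
apply: (@reduces_trans _ [::] (h :: v ++ u) [::]).
  exact: (reduces_catl [:: h] (IH vu vv fu)).
by rewrite -[h :: u]cat1s catA; apply:
  (reduces_catr u (reduces_swap1 lt vv fh)).
Qed.

(** The word n-1, n-2, ..., n-c, that is the last block of g_sigma when sigma
    belongs to the symmetric group on n+1 letters. *)
Definition run (n c : nat) : seq nat := [seq n - j.+1 | j <- iota 0 c].

Fixpoint code_word (c : nat -> nat) (n : nat) : seq nat :=
  if n is n'.+1 then code_word c n' ++ run n' (c n') else [::].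

Lemma run_cat n a b : run n (a + b) = run n a ++ run (n - a) b.
Proof.
rewrite /run iotaD map_cat add0n -[X in iota X b]addn0 iotaDl -map_comp.
by congr cat; apply: eq_map => j /=; lia.
Qed.

Lemma mem_run n c h : c <= n -> (h \in run n c) = (n - c <= h < n).
Proof.
move=> le; apply/mapP/idP => [[j]|b]; first by rewrite mem_iota; lia.
by exists (n - h.+1); [rewrite mem_iota; lia | lia].
Qed.

Lemma valid_run n c : c <= n -> valid n.+1 (run n c).
Proof. by move=> le; apply/allP=> h; rewrite mem_run //; lia. Qed.

Definition bounded (c : nat -> nat) := forall i, c i <= i.

Lemma valid_code_word c n : bounded c -> valid n (code_word c n).
Proof.
move=> cb; elim: n => //= n IH; rewrite valid_cat valid_run // andbT.
exact: validW IH.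
Qed.

Lemma eq_code_word c c' n : (forall i, i < n -> c i = c' i) ->
  code_word c n = code_word c' n.
Proof.
elim: n => //= n IH e; rewrite e // IH // => i lt; apply: e; exact: ltnW.
Qed.

(** A letter h that meets the run n-1, ..., n-c from the right either crosses
    it, or extends it, or is absorbed into its last letter; otherwise it meets
    the pattern h, h-1 inside the run, h-1 disappears, and what follows it in
    the run can be moved in front. *)
Lemma reduces_run n c h : n < N -> c <= n -> h < n ->
  exists C c' m, [/\ valid n C, c' <= n & reduces (run n c ++ [:: h]) m
    (C ++ run n c')].
Proof.
move=> nN le lt.
have vb a b : b <= a -> a < N -> valid N (run a b).
  by move=> ? ?; apply: validW (valid_run _).
case: (ltngtP h.+1 (n - c)) => [lt1|gt1|e].
- exists [:: h], c, [::]; split=> //; first by rewrite /valid /=; lia.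
  apply: reduces_swap; [exact: vb | by rewrite /valid /= andbT; lia |].
  by apply/allrelP=> x y; rewrite mem_run // inE /far => ? /eqP ->; lia.
- have [e|ne] := eqVneq h (n - c).
    exists [::], c, [:: (false, h)]; split=> //=.
    have -> : c = c.-1 + 1 by lia.
    rewrite run_cat -catA /run /= (_ : n - c.-1 - 1 = h); last by lia.
    by apply: reduces_catl; apply: reduces_sqr; lia.
  (* the run splits as n-1, ..., h+1, then h, h-1, then d further letters *)
  pose d := h.-1 - (n - c).
  exists (run h.-1 d), (n - h), [:: (true, h.-1)]; split; last 1 first.
  + have -> : c = n - h.+1 + (2 + d) by lia.
    rewrite run_cat (_ : n - (n - h.+1) = h.+1) 1?run_cat; last by lia.
    have -> : run h.+1 2 = [:: h.-1.+1; h.-1] by rewrite /run /= !subSS subn0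
      subn1 prednK //; lia.
    rewrite !subSS subn1.
    set P := run n _; set Q := run _ d.
    have -> : run n (n - h) = P ++ [:: h.-1.+1].
      rewrite (_ : n - h = n - h.+1 + 1) ?run_cat; last by lia.
      by congr (_ ++ [:: _]); lia.
    rewrite -!catA.
    have vQ : valid N Q by apply: vb; rewrite /d; lia.
    have vh : valid N [:: h.-1.+1] by rewrite /valid /= andbT; lia.
    apply: (@reduces_trans _ [::] (P ++ [:: h.-1.+1; h.-1] ++ [:: h.-1.+1] ++
      Q) [:: _]).
      rewrite (_ : [:: h] = [:: h.-1.+1]); last by congr cons; lia.
      apply: reduces_catl; apply: reduces_catl; apply: reduces_swap => //.
      apply/allrelP=> x y; rewrite mem_run ?inE /far /d; last by lia.
      by move=> ? /eqP ->; lia.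
    apply: (@reduces_trans _ [:: _] (P ++ [:: h.-1.+1] ++ Q) [::]).
      rewrite [[:: _; _] ++ _](_ : _ = [:: h.-1.+1; h.-1; h.-1.+1] ++ Q) //.
      by apply: reduces_cat; apply: reduces_braid; lia.
    rewrite catA; apply: reduces_swap => //.
      by rewrite valid_cat vh andbT; apply: vb; lia.
    apply/allrelP=> x y; rewrite mem_cat inE !mem_run /far /d; try lia.
  + by apply: validW (valid_run _); rewrite /d; lia.
  + by lia.
exists [::], c.+1, [::]; split=> //; first by lia.
rewrite -[c.+1]addn1 run_cat /run /= (_ : n - c - 1 = h); last by lia.
exact: reduces_refl.
Qed.

(** Right multiplication by a letter changes the last run by the previous lemma,
    and what comes out in front of it only involves smaller letters. *)
Lemma normal_form n w : n <= N -> valid n w ->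
  exists c m, bounded c /\ reduces w m (code_word c n).
Proof.
elim: n w => [|n IHn] w nN.
  case: w => [_|//]; exists (fun=> 0), [::]; split=> //; exact: reduces_refl.
elim/last_ind: w => [_|w h IHw].
  exists (fun=> 0), [::]; split=> //.
  have -> : code_word (fun=> 0) n.+1 = [::] by elim: (n.+1) => //= k ->.
  exact: reduces_refl.
rewrite -cats1 valid_cat /valid /= andbT => /andP[vw lth].
have [c [m [cb rw]]] := IHw vw.
have [C [d [m' [vC dn rh]]]] := reduces_run nN (cb n) lth.
have vC' : valid n (code_word c n ++ C) by rewrite valid_cat vC valid_code_word.
have [c' [m'' [cb' rc]]] := IHn _ (ltnW nN) vC'.
pose e i := if i < n then c' i else if i == n then d else 0.
exists e, ((m ++ m') ++ m''); split.
  by move=> i; rewrite /e; case: ifP => _; [exact: cb' | case: eqP => // ->].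
apply: (@reduces_trans _ _ ((code_word c n ++ C) ++ run n d)).
  apply: reduces_trans; first exact: reduces_catr rw.
  by rewrite /= -!catA; apply: reduces_catl.
rewrite /= {2}/e ltnn eqxx (@eq_code_word e c'); first exact: reduces_catr rc.
by move=> i; rewrite /e => ->.
Qed.
End Words.

(** * Uniqueness of the monomial *)

Section Invariants.
Variable N : nat.
Implicit Types D : diagram N.

Definition word_act (w : seq nat) D : diagram N := foldr (@gen_act N false) D w.

Lemma word_act_cat u v D : word_act (u ++ v) D = word_act u (word_act v D).
Proof. exact: foldr_cat. Qed.

Lemma gen_act_invalid b h D : (h.+1 < N) = false -> gen_act b h D = D.
Proof. by move=> ge; rewrite /gen_act; case: insub => // ?;
  case: insubP => // ?; rewrite ge. Qed.

Lemma gen_act_admissible b h D : admissible D -> admissible (gen_act b h D).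
Proof.
case lt: (h.+1 < N); first exact: gen_act_admissible_valid.
by rewrite gen_act_invalid.
Qed.

Lemma word_act_admissible w D : admissible D -> admissible (word_act w D).
Proof. by move=> g; elim: w => //= h w; apply: gen_act_admissible. Qed.

Lemma partner_id a : partner (diagram_id N) a = flip a.
Proof. by rewrite /partner ffunE. Qed.

Lemma slab_id a : slab (diagram_id N) a = absn a.
Proof. by rewrite /slab /lab ffunE /= inordK //; apply: ltn_ord. Qed.

Lemma admissible_id : admissible (diagram_id N).
Proof.
split=> [a|a]; last by rewrite slab_id.
rewrite !slab_id !partner_id /flip /absn /= negbK; split=> //; last by case: a.
by case: a => -[] ? [].
Qed.

(** Stacking A_(h+1) on D closes a loop exactly when the two nodes that its
    lower arc meets are partners in D. The label of the loop is that of their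
    arc, which is at most h+1. *)
Definition loop h j D : bool :=
  match insub h : option 'I_N, insub h.+1 : option 'I_N with
  | Some x, Some y => (partner D (false, x) == (false, y)) &&
    (slab D (false, x) == j)
  | _, _ => false
  end.

Lemma loopE h (lt : h.+1 < N) j D : loop h j D =
  (partner D (false, Ordinal (ltnW lt)) == (false, Ordinal lt)) &&
  (slab D (false, Ordinal (ltnW lt)) == j).
Proof. by rewrite /loop (insubT (fun i => i < N) (ltnW lt))
  (insubT (fun i => i < N) lt). Qed.

Fixpoint loops j w D : nat :=
  if w is h :: w' then loop h j (word_act w' D) + loops j w' D else 0.

Lemma loops_cat j u v D : loops j (u ++ v) D
  = loops j u (word_act v D) + loops j v D.
Proof. by elim: u => //= h u ->; rewrite word_act_cat addnA. Qed.

Lemma loop_act h j D : h.+1 < N -> loop h j (gen_act false h D) = (j == h.+1).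
Proof.
move=> lt; rewrite loopE gen_actE partner_surgery slab_surgery;
  last exact: ltnW.
by rewrite /splice /splice_lab !eqxx /= eq_sym.
Qed.

(** A loop may be closed by either of two distant letters, depending on their
    order, but its label is the same. *)
Lemma loop_comm h h' j D : matched D -> h.+1 < N -> h'.+1 < N -> far h h' ->
  loop h j (gen_act false h' D) + loop h' j D
    = loop h' j (gen_act false h D) + loop h j D.
Proof.
move=> m lt lt' fr; rewrite !loopE !gen_actE !partner_surgery !slab_surgery;
  try exact: ltnW.
set u := (_, Ordinal (ltnW lt)); set v := (_, Ordinal lt).
set u' := (_, Ordinal (ltnW lt')); set v' := (_, Ordinal lt').
have [n1 n2 n3] : [/\ u <> v, u' <> v' & u <> u'].
  by move: fr; rewrite /far; split; apply: neq_node => -[]; lia.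
have [n4 n5 n6] : [/\ u <> v', v <> u' & v <> v'].
  by move: fr; rewrite /far; split; apply: neq_node => -[]; lia.
move: u v u' v' n1 n2 n3 n4 n5 n6 => u v u' v' n1 n2 n3 n4 n5 n6.
rewrite /splice /splice_lab.
have [fu ffu lu] := m u; have [fv ffv lv] := m v.
have [fu' ffu' lu'] := m u'; have [fv' ffv' lv'] := m v'.
have inj := matching_inj m.
repeat eqcase.
all: try lia.
all: try (have e1 : slab D u = slab D u' by congruence).
all: try (have e2 : slab D v = slab D u' by congruence).
all: try (have e3 : slab D u = slab D v' by congruence).
all: try (have e4 : slab D v = slab D v' by congruence).
all: try (have e5 : slab D v = slab D u by congruence).
all: lia.
Qed.

Lemma loop_braid h j D : matched D -> h.+2 < N ->
  loop h j (gen_act false h.+1 D) = false /\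
  loop h.+1 j (gen_act false h (gen_act false h.+1 D)) = false.
Proof.
move=> m lt; have lt1 := ltnW lt; have lt2 := ltnW lt1.
rewrite (loopE lt1) (loopE lt) (gen_actE _ lt) (gen_actE _ lt1).
have -> : Ordinal (ltnW lt) = Ordinal lt1 by exact: val_inj.
have -> : Ordinal (ltnW lt1) = Ordinal lt2 by exact: val_inj.
have n1 := @neq_node N false false _ _ lt2 lt1.
have n2 := @neq_node N false false _ _ lt2 lt.
have n3 := @neq_node N false false _ _ lt1 lt.
split; apply/negbTE/negP=> /andP[/eqP + _]; rewrite !partner_surgery /splice.
  have [fu ffu lu] := m (false, Ordinal lt2).
  have [] := m (false, Ordinal lt1); have [] := m (false, Ordinal lt).
  have {}n1 := n1 ltac:(by case; lia).
  have {}n2 := n2 ltac:(by case; lia).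
  have {}n3 := n3 ltac:(by case; lia).
  by repeat eqcase.
have {}n1 := n1 ltac:(by case; lia).
have {}n2 := n2 ltac:(by case; lia).
by rewrite eqxx; repeat eqcase.
Qed.

Lemma reduces_word_act w m w' : reduces N w m w' -> forall D, admissible D ->
  word_act w D = word_act w' D.
Proof.
elim=> {w m w'} //.
- by move=> w m w' m' w'' _ IH _ IH' D g; rewrite IH // IH'.
- by move=> u v w m w' _ IH D g; rewrite !word_act_cat IH //;
  apply: word_act_admissible.
- by move=> h lt D [g _]; apply: gen_act_idem.
- by move=> h h' lt lt' fr D [g _]; apply: gen_act_comm => //; rewrite fr.
- by move=> h lt D g; apply: gen_act_braid.
Qed.

Lemma count_mem1 (b b' : bool) (i j : nat) :
  count_mem (b, i) [:: (b', j)] = (b == b') && (i == j).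
Proof. by rewrite /= addn0 xpair_eqE eq_sym; congr (_ && _); exact: eq_sym. Qed.

(** The loops with label j+1 count the exponent of the x of index j: among the
    relations only the one for a square closes a loop, whose label is that of
    the generator. *)
Lemma reduces_loops w m w' : reduces N w m w' -> forall D j, admissible D ->
  loops j.+1 w D = count_mem (false, j) m + loops j.+1 w' D.
Proof.
move=> r; elim: r => {w m w'} //.
- by move=> w m w' m' w'' _ IH _ IH' D j g;
  rewrite count_cat IH // IH' // addnA.
- move=> u v w m w' r IH D j g; have gv := word_act_admissible v g.
  by rewrite !loops_cat !word_act_cat IH // (reduces_word_act r) //; lia.
- by move=> h lt D j [g _]; rewrite count_mem1 /= loop_act //; lia.
- by move=> h h' lt lt' fr D j [g _] /=; have := loop_comm j.+1 g lt lt' fr;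
  lia.
- move=> h lt D j [g _]; rewrite count_mem1 /=.
  by have [-> ->] := loop_braid j.+1 g lt.
Qed.

(** A relation with parameter y of index j removes the letters j and j+1, so
    that the letter j is removed by the parameters of index j and j-1. *)
Definition ydeg (m : seq (bool * nat)) j :=
  count_mem (true, j) m + (if j is j'.+1 then count_mem (true, j') m else 0).

Lemma ydeg_cat m m' j : ydeg (m ++ m') j = ydeg m j + ydeg m' j.
Proof. by rewrite /ydeg; case: j => [|j];
  rewrite !count_cat ?addn0 // addnACA. Qed.

Lemma reduces_count w m w' : reduces N w m w' -> forall j,
  count_mem j w = count_mem (false, j) m + ydeg m j + count_mem j w'.
Proof.
elim=> {w m w'}.
- by move=> w [|?].
- move=> w m w' m' w'' _ IH _ IH' j; rewrite IH IH' ydeg_cat count_cat; lia.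
- by move=> u v w m w' _ IH j; rewrite !count_cat IH; lia.
- by move=> h lt j; rewrite /ydeg; case: j => [|j]; rewrite !count_mem1 /=; lia.
- by move=> h h' lt lt' fr j; rewrite /ydeg; case: j => [|j] /=; lia.
- by move=> h lt j; rewrite /ydeg; case: j => [|j]; rewrite !count_mem1 /=; lia.
Qed.

Lemma monomial_ext (m m' : seq (bool * nat)) :
  (forall j, count_mem (false, j) m = count_mem (false, j) m') ->
  (forall j, ydeg m j = ydeg m' j) -> perm_eq m m'.
Proof.
move=> ex ey; apply/allP=> -[b j] _ /=; apply/eqP; case: b => //.
elim: j => [|j IH]; first by have := ey 0; rewrite /ydeg !addn0.
by have := ey j.+1; rewrite /ydeg IH => /addIn.
Qed.

(** The loops give the exponents of the x, and then the numbers of letters give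
    those of the y, one index after the other. *)
Lemma reduces_uniq w m m' u : reduces N w m u -> reduces N w m' u ->
  perm_eq m m'.
Proof.
move=> r r'; have g := admissible_id.
have e j : count_mem (false, j) m = count_mem (false, j) m'.
  by have := reduces_loops r j g; rewrite (reduces_loops r' j g) => /addIn.
apply: monomial_ext => // j.
by have := reduces_count r j; rewrite (reduces_count r') e; lia.
Qed.
End Invariants.

Section Eval.
Variables (K : fieldType) (N : nat).
Variables (X : (N.-1).-tuple K) (Y : (N.-2).-tuple K).
Local Open Scope ring_scope.

Definition monom (m : seq (bool * nat)) : K :=
  \prod_(z <- m) (if z.1 then Y`_z.2 else X`_z.2).

Definition okada_word (w : seq nat) : okada X Y := \prod_(h <- w) okada_E X Y
  h.+1.

Lemma monom_cat m m' : monom (m ++ m') = monom m * monom m'.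
Proof. exact: big_cat. Qed.

Lemma okada_word_cat u v : okada_word (u ++ v) = okada_word u * okada_word v.
Proof. exact: big_cat. Qed.

Lemma okada_E_gen h (lt : (h < N.-1)%N) : okada_E X Y h.+1
  = okada_gen X Y (Ordinal lt).
Proof. by rewrite /okada_E /= (insubT (fun i => i < N.-1)%N lt). Qed.

Lemma reduces_okada w m w' : reduces N w m w' ->
  okada_word w = monom m *: okada_word w'.
Proof.
have [rs rc rb] := okada_gen_rels X Y.
have ltP h : (h.+1 < N)%N -> (h < N.-1)%N by lia.
elim=> {w m w'}.
- by move=> w; rewrite /monom big_nil scale1r.
- by move=> w m w' m' w'' _ -> _ ->; rewrite scalerA monom_cat.
- by move=> u v w m w' _ IH; rewrite !okada_word_cat IH -scalerAl -scalerAr.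
- move=> h lt; rewrite /okada_word /monom !big_cons !big_nil !mulr1.
  by rewrite (okada_E_gen (ltP _ lt)) rs.
- move=> h h' lt lt' fr; rewrite /okada_word /monom !big_cons !big_nil !mulr1
  scale1r.
  rewrite (okada_E_gen (ltP _ lt)) (okada_E_gen (ltP _ lt')).
  by case/orP: fr => ?; [apply: rc | symmetry; apply: rc].
- move=> h lt; rewrite /okada_word /monom !big_cons !big_nil !mulr1 mulrA.
  by rewrite (okada_E_gen (ltP _ lt)) (okada_E_gen (ltP _ (ltnW lt))) rb.
Qed.
End Eval.

(** * Okada diagrams as matchings of a line *)

Section Line.
Implicit Types (n k p q : nat) (f l : nat -> nat).

(** Node i becomes the position i-1 and node bar i the position 2n-i. On a line
    the smaller absolute value of the ends of an arc {p < q} is the minimum of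
    p+1 and 2n-q, and p+1 and 2n-q have the same parity because the arcs inside
    match up. Hence the conditions on a label can be checked at each end. *)
Definition okada_point n f l p :=
  [/\ f p < n + n, f p <> p, f (f p) = p & l (f p) = l p] /\
  [/\ 0 < l p, l p <= p.+1, l p <= n + n - p,
      p < f p -> odd (l p) = ~~ odd p & f p < p -> odd (l p) = odd p].

(** Crossings and nestings are treated at once; q may be either end of the
    inner arc. *)
Definition okada_line n f l :=
  (forall p, p < n + n -> okada_point n f l p) /\
  (forall p q, p < n + n -> p < q < f p -> p < f q < f p /\ l p < l q).

(** Positions are shifted to make room for a new arc between k and k+1. *)
Definition up k x := if x < k then x else x.+2.
Definition down k x := if x < k then x else x - 2.

Definition ins_partner k f x :=
  if x == k then k.+1 else if x == k.+1 then k else up k (f (down k x)).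
Definition ins_label k z l x :=
  if (x == k) || (x == k.+1) then z else l (down k x).

Lemma upK k : cancel (up k) (down k).
Proof. by move=> x; rewrite /up /down; case: (ltnP x k); case: ifP; lia. Qed.

Lemma downK k x : x <> k -> x <> k.+1 -> up k (down k x) = x.
Proof. by rewrite /up /down; case: (ltnP x k); case: ifP; lia. Qed.

Lemma up_neq k x : up k x <> k /\ up k x <> k.+1.
Proof. by rewrite /up; case: ifP; lia. Qed.

Lemma lt_up k x y : (up k x < up k y) = (x < y).
Proof. by rewrite /up; case: ifP; case: ifP; lia. Qed.

Lemma eq_up k x y : (up k x == up k y) = (x == y).
Proof. exact/inj_eq/(can_inj (@upK k)). Qed.

Lemma ins_partner_up k f x : ins_partner k f (up k x) = up k (f x).
Proof. by rewrite /ins_partner upK; have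
  [/eqP/negbTE -> /eqP/negbTE ->] := up_neq k x. Qed.

Lemma ins_label_up k z l x : ins_label k z l (up k x) = l x.
Proof. by rewrite /ins_label upK; have
  [/eqP/negbTE -> /eqP/negbTE ->] := up_neq k x. Qed.

Lemma ins_partner_fst k f : ins_partner k f k = k.+1.
Proof. by rewrite /ins_partner eqxx. Qed.

Lemma ins_partner_snd k f : ins_partner k f k.+1 = k.
Proof. by rewrite /ins_partner eqxx; case: eqP => //; lia. Qed.

Lemma ins_label_fst k z l : ins_label k z l k = z.
Proof. by rewrite /ins_label eqxx. Qed.

Lemma ins_label_snd k z l : ins_label k z l k.+1 = z.
Proof. by rewrite /ins_label eqxx orbT. Qed.

Variant ins_spec k : nat -> Type :=
| InsFst : ins_spec k k
| InsSnd : ins_spec k k.+1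
| InsUp x : ins_spec k (up k x).

Lemma insP k x : ins_spec k x.
Proof.
have [->|n1] := eqVneq x k; first by constructor.
have [->|n2] := eqVneq x k.+1; first by constructor.
by rewrite -(@downK k x); [constructor | apply/eqP..].
Qed.

Lemma odd_up k x : odd (up k x) = odd x.
Proof. by rewrite /up; case: ifP => //= _; rewrite negbK. Qed.

(** The new arc has the largest label allowed by its right end. An arc around it
    ends further to the right, so that its label is smaller. *)
Lemma ins_okada_line n c f l : c <= n -> okada_line n f l ->
  okada_line n.+1 (ins_partner (n + c) f) (ins_label (n + c) (n.+1 - c) l).
Proof.
move=> le [okl okn]; set k := n + c; split.
  move=> p; case: (insP k p) => [||x] lt.
  - by rewrite /okada_point ins_partner_fst ins_partner_snd ins_label_fst
    ins_label_snd; split; split; lia.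
  - by rewrite /okada_point ins_partner_snd ins_partner_fst ins_label_fst
    ins_label_snd; split; split; lia.
  have ltx : x < n + n by move: lt; rewrite /up; case: ifP; lia.
  rewrite /okada_point !ins_partner_up !ins_label_up !lt_up !odd_up.
  have [[a b c' d] [e g h i j]] := okl _ ltx.
  split; split=> //; try (by rewrite ?c'); try (by move/(can_inj (@upK k)));
    by rewrite /up; case: ifP; lia.
move=> p q; case: (insP k p) => [||x] lt;
  rewrite ?ins_partner_fst ?ins_partner_snd ?ins_partner_up; try lia.
have ltx : x < n + n by move: lt; rewrite /up; case: ifP; lia.
have [[a b c' d] [e g h i j]] := okl _ ltx.
have [_ [_ _ h' _ _]] := okl _ a.
case: (insP k q) => [||y]; rewrite ?ins_partner_fst ?ins_partner_snd
  ?ins_partner_up ?ins_label_fst ?ins_label_snd ?ins_label_up ?lt_up.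
- by rewrite /up; case: ifP; case: ifP; lia.
- by rewrite /up; case: ifP; case: ifP; lia.
by move=> xy; apply: okn.
Qed.

Definition agree n f l g m := forall p, p < n + n -> f p = g p /\ l p = m p.

Lemma agree_okada_line n f l g m : agree n f l g m -> okada_line n f l ->
  okada_line n g m.
Proof.
move=> e [okl okn]; split=> [p lt|p q lt].
  have [[a b c d] [o g' h i j]] := okl _ lt.
  have [e1 e2] := e _ lt; have [e3 e4] := e _ a.
  by rewrite /okada_point -e1 -e2 -e3 -e4; split; split.
have [[a _ _ _] _] := okl _ lt.
have [e1 e2] := e _ lt; rewrite -e1 => /[dup] ltq /(okn _ _ lt).
have [| -> ->] := e q; first by lia.
by rewrite -e2.
Qed.

(** The inserted arc is recognised as the leftmost small arc k, k+1, among
    those that start in the middle or on its right, whose label is maximal: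
    before the insertion, such an arc further left would have had too large a
    label for the smaller rank. *)
Lemma ins_first n c f l k : c <= n -> okada_line n f l -> n <= k < n + c ->
  ins_partner (n + c) f k = k.+1 -> ins_label (n + c) (n.+1 - c) l k
    = n.+1 + n - k -> False.
Proof.
move=> le [okl _] b.
have -> : k = up (n + c) k by rewrite /up; case: ifP; lia.
rewrite ins_partner_up ins_label_up => e1 e2.
have ltk : k < n + n by lia.
have [[a b' c' d] [_ _ h _ _]] := okl _ ltk.
have e : f k = k.+1.
  by move: e1; rewrite /up; case: ifP; case: ifP; lia.
have [_ [_ _ h' _ _]] := okl _ a.
by move: e2; rewrite -d e {1}/up; case: ifP; move: h'; rewrite e; lia.
Qed.

Lemma ins_inj n c f l c' f' l' : c <= n -> c' <= n -> okada_line n f l ->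
  okada_line n f' l' ->
  agree n.+1 (ins_partner (n + c) f) (ins_label (n + c) (n.+1 - c) l)
             (ins_partner (n + c') f') (ins_label (n + c') (n.+1 - c') l') ->
  c = c' /\ agree n f l f' l'.
Proof.
move=> le le' o o' e.
have ec : c = c'.
  have [e1 e2] := e (n + c) ltac:(lia); have [e3 e4] := e (n + c') ltac:(lia).
  case: (ltngtP c c') => // lt; exfalso.
    apply: (ins_first le' o' (k := n + c)); first by lia.
      by rewrite -e1 ins_partner_fst.
    by rewrite -e2 ins_label_fst; lia.
  apply: (ins_first le o (k := n + c')); first by lia.
    by rewrite e3 ins_partner_fst.
  by rewrite e4 ins_label_fst; lia.
split=> // p lt; subst c'.
have [|] := e (up (n + c) p); first by rewrite /up; case: ifP; lia.
by rewrite !ins_partner_up !ins_label_up => /(can_inj (@upK _)).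
Qed.

(** Descent along right ends with a maximal label: if the arc that ends in x is
    not small, the arc that ends in x-1 is nested in it, and its label, being
    larger and of the right parity, is maximal again. *)
Lemma okada_line_last n F L x : okada_line n F L -> x < n + n -> F x < x ->
  L x = n + n - x ->
  exists k, [/\ n <= k.+1, k < x, F k = k.+1 & L k = (n + n).-1 - k].
Proof.
move=> [okl okn]; elim: x => // x IH lt Fx Lx.
have [[a b c d] [_ _ _ _ /(_ Fx) j]] := okl _ lt.
have [[a' _ _ _] [_ g' _ _ _]] := okl _ a.
have ltx := ltnW lt.
have [E|ne] := eqVneq (F x.+1) x.
  by exists x; move: c d g'; rewrite E => ->; split=> //; lia.
have [|B ll] := okn (F x.+1) x a; first by rewrite c; move: Fx ne; clear; lia.
rewrite c d in B ll; have [[_ b1 _ _] [_ _ h1 _ j1]] := okl _ ltx.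
have Fx1 : F x < x by move: B b1; clear; lia.
have [|k [? ? ? ?]] := IH ltx Fx1; last by exists k; split=> //; apply: ltnW.
by move: ll h1 j Lx (j1 Fx1) lt; clear; lia.
Qed.

(** Every Okada matching arises by an insertion. A small arc with maximal label
    exists by descent from the last position, whose label is 1. When the
    leftmost one is removed, the labels on its left still fit the smaller rank:
    one that does not would be maximal, and lead to a candidate further left. *)
Lemma okada_line_split n F L : okada_line n.+1 F L ->
  exists c f l, [/\ c <= n, okada_line n f l &
    agree n.+1 F L (ins_partner (n + c) f) (ins_label (n + c) (n.+1 - c) l)].
Proof.
move=> o; have [okl okn] := o.
(* the candidates for the inserted arc *)
pose P k := [&& n <= k, F k == k.+1, L k == n.+1 + n - k & k < n.+1 + n].
have exP : exists k, P k.
  have lt : n.+1 + n < n.+1 + n.+1 by lin.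
  have [[a b c d] [e g h i j]] := okl _ lt.
  have [||k [k1 k2 k3 k4]] := okada_line_last o lt; [by lin | by lin |].
  by exists k; apply/and4P; split=> //; try apply/eqP; lin.
have := ex_minnP exP; case=> k /and4P[k1 /eqP k2 /eqP k3 k4] kmin.
have {}kmin j : n <= j < k -> F j = j.+1 -> L j = n.+1 + n - j -> False.
  move=> b e1 e2; have /kmin : P j by rewrite /P e1 e2 !eqxx; lin.
  by lin.
have [[_ _ k5 k6] _] := okl k ltac:(lin); rewrite k2 in k5 k6.
pose f x := down k (F (up k x)); pose l x := L (up k x).
have upF x : x < n + n -> up k (f x) = F (up k x).
  move=> lt; have ltu : up k x < n.+1 + n.+1 by rewrite /up; case: ifP; lin.
  have [[_ _ inv _] _] := okl _ ltu.
  have [u1 u2] := up_neq k x.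
  by rewrite /f downK // => E; move: inv; rewrite E; lin.
have agr : agree n.+1 F L (ins_partner k f) (ins_label k (n.+1 + n - k) l).
  move=> p; case: (insP k p) => [||x] lt;
    rewrite ?ins_partner_fst ?ins_partner_snd ?ins_partner_up ?ins_label_fst
    ?ins_label_snd ?ins_label_up //.
    by rewrite k5 k6.
  by rewrite upF //; move: lt; rewrite /up; case: ifP; lin.
exists (k - n), f, l; split;
  [by lin | | by rewrite subnKC // (_ : n.+1 - (k - n) = n.+1 + n - k) //; lin].
have F_lt x : x < n + n -> f x < n + n.
  move=> lt; have ltu : up k x < n.+1 + n.+1 by rewrite /up; case: ifP; lin.
  have [[a _ _ _] _] := okl _ ltu; move: a; rewrite -upF // {1}/up; case: ifP;
    lin.
split=> [x lt|x y lt]; last first.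
  have ltu : up k x < n.+1 + n.+1 by rewrite /up; case: ifP; lin.
  move=> b; have [] := okn _ (up k y) ltu.
    by rewrite -upF // !lt_up.
  by rewrite -!upF ?lt_up //; have := F_lt _ lt; lin.
have ltu : up k x < n.+1 + n.+1 by rewrite /up; case: ifP; lin.
have [[a b c d] [e g h i j]] := okl _ ltu.
rewrite -upF // in a b c d i j.
rewrite -upF ?F_lt // in c; rewrite !lt_up !odd_up in i j.
have fx : f x <> x by move=> E; apply: b; rewrite E.
have ff : f (f x) = x by apply: (can_inj (@upK k)); rewrite -c upF // F_lt.
split; split=> //; rewrite ?F_lt // /l.
  by move: g h; rewrite /up; case: ifP; lin.
have [|ge] := ltnP x k; last by move: h; rewrite /up ifF; lin.
move=> ltk; have ux : up k x = x by rewrite /up ltk.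
have Fu := upF _ lt; rewrite ux in g h d Fu *.
have lf : L (F x) <= n.+1 + n.+1 - F x.
  have ltF : F x < n.+1 + n.+1 by move: a; rewrite Fu.
  by have [_ [_ _ ? _ _]] := okl _ ltF.
case: (ltnP x (f x)) => [ltf|gef].
  rewrite Fu in d; have F1 : x < F x by rewrite -Fu /up; case: ifP; lin.
  have ii := i ltf; rewrite ux in ii.
  case: (leqP (L x) (n + n - x)) => // big; exfalso.
  by apply: (kmin x); lin.
have jj := j ltac:(lin); rewrite ux in jj.
case: (leqP (L x) (n + n - x)) => // big; exfalso.
have F1 : F x < x by rewrite -Fu /up; case: ifP; lin.
have ltx : x < n.+1 + n.+1 by lin.
have [|k' [? ? ? ?]] := okada_line_last o ltx F1; first by lin.
by apply: (kmin k'); lin.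
Qed.

End Line.

(** * Parity of arcs; drawing diagrams on the line *)

Section Parity.
Variables (M : nat) (f : nat -> nat).
Hypothesis f_match : forall p, p < M -> [/\ f p < M, f p <> p & f (f p) = p].
Hypothesis f_cross : forall p q, p < M -> p < q < f p -> p < f q < f p.

(** In a noncrossing matching, an interval whose nodes are matched inside it or
    beyond b0 splits into nodes of the second kind and closed intervals, whose
    lengths are even. *)
Lemma count_escaping b0 a b : a <= b -> b <= b0 -> b0 <= M ->
  (forall y, a <= y < b -> (a <= f y < b) || (b0 <= f y)) ->
  odd (count (fun y => b0 <= f y) (iota a (b - a))) = odd (b - a).
Proof.
move=> ab bb0 b0M; move: {2}(b - a).+1 (ltnSn (b - a)) => s.
elim: s a b ab bb0 => // s IH a b ab bb0 lts cl.
have [->|ltab] := eqVneq a b; first by rewrite subnn.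
have {}ltab : a < b by lia.
have [a1 a2 a3] := f_match (p := a) ltac:(lia).
case/orP: (cl a ltac:(lia)) => [ac|esc]; last first.
  rewrite (_ : b - a = (b - a.+1).+1) /= ?esc; last by lia.
  rewrite oddD IH //; try lia; move=> y yb.
  have := cl y ltac:(lia); have [|] := eqVneq (f y) a; last by lia.
  by move=> E; have [_ _ e] := f_match (p := y) ltac:(lia); move: e; rewrite E;
    lia.
have ltac : a < f a by lia.
have in1 y : a < y < f a -> a < f y < f a by apply: f_cross; lia.
set c := f a in ac ltac in1 a2 a3 *.
have -> : b - a = ((c - a.+1) + (b - c.+1).+1).+1 by lia.
have -> : iota a ((c - a.+1) + (b - c.+1).+1).+1 =
    a :: iota a.+1 (c - a.+1) ++ c :: iota c.+1 (b - c.+1).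
  by rewrite /= iotaD /= (_ : a.+1 + (c - a.+1) = c) //; lia.
rewrite /= count_cat /= a3 -/c [b0 <= c]leqNgt [b0 <= a]leqNgt.
rewrite (_ : c < b0) 1?(_ : a < b0); try lia.
rewrite /= !add0n !oddD /= [odd _ (+) ~~ _]addbN negbK.
congr (_ (+) _); apply: IH; try lia.
  by move=> y yb; have := in1 y yb; lia.
move=> y yb; have [y1 y2 y3] := f_match (p := y) ltac:(lia).
have := cl y ltac:(lia); case: (leqP b0 (f y)) => [_|_]; first by rewrite !orbT.
rewrite !orbF => fy; have [E|n1] := eqVneq (f y) a; first by exfalso; move: y3;
  rewrite E -/c; lia.
have [E|n2] := eqVneq (f y) c; first by exfalso; move: y3; rewrite E a3; lia.
case: (ltnP (f y) c) => [lt|]; last by lia.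
by have := in1 (f y) ltac:(lia); rewrite y3; lia.
Qed.

Lemma arc_parity p : p < M -> p < f p -> odd (f p) = ~~ odd p.
Proof.
move=> lt ltf; have [a1 a2 a3] := f_match lt.
have := @count_escaping M p.+1 (f p) ltf ltac:(lia) (leqnn M).
have -> : count (fun y => M <= f y) (iota p.+1 (f p - p.+1)) = 0.
  apply/eqP; rewrite -leqn0 leqNgt -has_count; apply/hasPn => y.
  by rewrite mem_iota => yb; rewrite -ltnNge;
    have [] := f_match (p := y) ltac:(lia).
move=> /(_ _)/esym e; have : odd (f p - p.+1) = false.
  by apply: e => y yb; have := f_cross lt yb; lia.
by rewrite oddB //=; case: (odd p) (odd (f p)) => [] [].
Qed.
End Parity.

Section Represent.
Variable N : nat.
Implicit Types (D : diagram N) (a b : node N).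

Lemma pos_lt a : pos a < N + N.
Proof. by case: a => -[] i; rewrite /pos /absn /=; have := ltn_ord i; lia. Qed.

Lemma pos_inj : injective (@pos N).
Proof.
move=> [b i] [b' j]; rewrite /pos /absn /=; have := ltn_ord i;
  have := ltn_ord j.
by case: b b' => [] [] //= ? ? e; (try lia); congr pair; apply: ord_inj; lia.
Qed.

Lemma pos_surj p : p < N + N -> exists a, pos a = p.
Proof.
move=> lt; case: (ltnP p N) => [ltN|geN].
  by exists (false, Ordinal ltN).
have lt' : N + N - p.+1 < N by lia.
by exists (true, Ordinal lt'); rewrite /pos /absn /=; lia.
Qed.

Lemma pos_absn a : absn a = minn (pos a).+1 (N + N - pos a).
Proof. by case: a => -[] i; rewrite /pos /absn /=; have := ltn_ord i; lia. Qed.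

Lemma pos_flip a : pos (flip a) = (N + N).-1 - pos a.
Proof. by case: a => -[] i; rewrite /pos /absn /=; have := ltn_ord i; lia. Qed.

(** f and l are the matching and the labels of D, read on the line of nodes.
    Functions on all integers allow ranks to change freely; only their values
    below 2N matter. *)
Definition drawn D (f l : nat -> nat) :=
  forall a, pos (partner D a) = f (pos a) /\ slab D a = l (pos a).

Definition along_line D (g : node N -> nat) p :=
  if [pick a | pos a == p] is Some a then g a else 0.

Lemma along_lineE D g a : along_line D g (pos a) = g a.
Proof.
by rewrite /along_line; case: pickP => [b /eqP/pos_inj-> //|/(_ a)];
  rewrite eqxx.
Qed.

Lemma drawn_exists D : exists f l, drawn D f l.
Proof.
exists (along_line D (fun a => pos (partner D a))),
  (along_line D (slab D)) => a.
by rewrite !along_lineE.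
Qed.

Lemma drawn_agree D f l f' l' : drawn D f l -> drawn D f' l' ->
  agree N f l f' l'.
Proof.
move=> r r' p /pos_surj[a <-].
by have [<- <-] := r a; have [<- <-] := r' a.
Qed.

Lemma agree_drawn D f l f' l' : agree N f l f' l' -> drawn D f l ->
  drawn D f' l'.
Proof. by move=> e r a; have [<- <-] := e _ (pos_lt a); apply: r. Qed.

Lemma drawn_inj D D' f l : drawn D f l -> drawn D' f l -> D = D'.
Proof.
move=> r r'; apply: diagram_ext => a.
  by apply: pos_inj; have [-> _] := r a; have [-> _] := r' a.
by have [_ ->] := r a; have [_ ->] := r' a.
Qed.

Lemma drawn_of_line f l : (forall p, p < N + N -> f p < N + N /\ l p <= N) ->
  exists D, drawn D f l.
Proof.
move=> b; exists [ffun a => (odflt a [pick c | pos c == f (pos a)], inord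
  (l (pos a)))].
move=> a; have [b1 b2] := b _ (pos_lt a).
rewrite /partner /slab /lab ffunE /= inordK //; split=> //.
case: pickP => [c /eqP //|no]; have [c e] := pos_surj b1.
by have := no c; rewrite e eqxx.
Qed.

(** Of the two ends of an arc {p < q}, the first is the closer one to its side
    or the second one is; either distance has the parity of p + 1. *)
Lemma odd_min_absn p q : p < q < N + N -> odd q = ~~ odd p ->
  odd (minn (minn p.+1 (N + N - p)) (minn q.+1 (N + N - q))) = ~~ odd p.
Proof.
move=> /andP[lt ltq] oq.
have -> : minn (minn p.+1 (N + N - p)) (minn q.+1 (N + N - q)) =
    minn p.+1 (N + N - q) by clear oq; lia.
by case: leqP => _ //; rewrite oddB ?(ltnW ltq) // addnn odd_double oq.
Qed.

Lemma drawn_okada D f l : drawn D f l -> is_okada D <-> okada_line N f l.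
Proof.
move=> r; have rf a : pos (partner D a) = f (pos a) by have [] := r a.
have rl a : slab D a = l (pos a) by have [] := r a.
split=> [/and4P[/matchedP m /forallP nc /forallP wl /forallP nl]|[okl okn]].
  have fm p : p < N + N -> [/\ f p < N + N, f p <> p & f (f p) = p].
    case/pos_surj=> a <-; have [ma mb mc] := m a.
    by rewrite -!rf mb; split=> //; [apply: pos_lt | move/pos_inj].
  have cr p q : p < N + N -> p < q < f p -> p < f q < f p.
    move=> lt b; have [f1 f2 f3] := fm _ lt.
    have ltq : q < N + N by lin.
    have [g1 g2 g3] := fm _ ltq.
    have ne1 : f q <> p by move=> E; move: g3; rewrite E; lin.
    have ne2 : f q <> f p by move/(congr1 f); rewrite f3 g3; lin.
    have [a ea] := pos_surj lt; have [c ec] := pos_surj ltq.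
    have /forallP/(_ c) := nc a; have /forallP/(_ a) := nc (partner D c).
    have [_ -> _] := m c; rewrite !rf ea ec; lin.
  split=> [p lt|p q lt b].
    have [f1 f2 f3] := fm _ lt; have [a ea] := pos_surj lt.
    have [_ _ la] := m a.
    have par := arc_parity fm cr.
    have := wl a; have [_ _ +] := m a;
      rewrite -/(slab D a) !pos_absn !rl rf ea => e.
    move=> /and3P[w1 w2 /eqP w3]; split; split=> //; try lin.
      by move=> ltf; rewrite w3 odd_min_absn ?par // ltf.
    have := par (f p) f1; rewrite f3 => op ltf.
    by rewrite w3 minnC odd_min_absn ?ltf ?op ?negbK.
  have cq := cr _ _ lt b; split=> //.
  have [f1 f2 f3] := fm _ lt.
  have ltq : q < N + N by lin.
  have [g1 g2 g3] := fm _ ltq.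
  have [a ea] := pos_surj lt; have [c ec] := pos_surj ltq.
  have [_ mc lc] := m c.
  have /forallP/(_ a) := nl c; have /forallP/(_ a) := nl (partner D c).
  rewrite mc !rf !ec !ea -!/(slab _ _) lc !rl !ec !ea.
  by case: (ltngtP q (f q)) => // ?; lin.
have fm p : p < N + N -> [/\ f p < N + N, f p <> p & f (f p) = p].
  by move=> /okl[[]].
apply/and4P; split.
- apply/matchedP => a; have [[a1 a2 a3 a4] _] := okl _ (pos_lt a).
  split; first by move=> /(congr1 (@pos N)); rewrite rf.
    by apply: pos_inj; rewrite !rf.
  by rewrite !rl rf.
- apply/forallP=> a; apply/forallP=> c; rewrite !rf; apply/negP.
  by move=> b; have := okn (pos a) (pos c) (pos_lt a); lin.
- apply/forallP=> a; have [[a1 a2 a3 a4] [b1 b2 b3 b4 b5]] := okl _ (pos_lt a).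
  have [_ [_ b2' b3' _ _]] := okl _ a1.
  rewrite -/(slab D a) !pos_absn rl rf.
  apply/and3P; split=> //; first by rewrite -a4 in b2 b3; lin.
  have cr p q : p < N + N -> p < q < f p -> p < f q < f p.
    by move=> lt /(okn _ _ lt)[].
  have par := arc_parity fm cr.
  case: (ltngtP (pos a) (f (pos a))) => ltf; last by case: a2.
    by rewrite odd_min_absn ?ltf ?par ?b4 ?pos_lt.
  have op : odd (pos a) = ~~ odd (f (pos a)) by rewrite -(par _ a1) a3.
  by rewrite minnC odd_min_absn ?ltf ?pos_lt // b5 // op.
apply/forallP=> a; apply/forallP=> c; apply/implyP; rewrite !rf => b.
rewrite -!/(slab _ _) !rl.
by have [] := okn (pos c) (pos a) (pos_lt c) ltac:(lin).
Qed.

Lemma drawn_id : drawn (diagram_id N) (fun p => (N + N).-1 - p)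
  (fun p => minn p.+1 (N + N - p)).
Proof. by move=> a; rewrite partner_id slab_id pos_flip pos_absn. Qed.

Lemma pos_splice u v (g : node N -> node N) f a :
  (forall a, pos (g a) = f (pos a)) ->
  pos (splice u v g a) = splice (pos u) (pos v) f (pos a).
Proof.
by move=> e; rewrite /splice -!e !(inj_eq pos_inj); do ! case: ifP => // _;
  rewrite e.
Qed.

Lemma drawn_surgery u v z D f l : z <= N -> drawn D f l ->
  drawn (surgery u v z D) (splice (pos u) (pos v) f)
    (splice_lab (pos u) (pos v) z f l).
Proof.
move=> zN r a; rewrite partner_surgery slab_surgery //.
have rf b : pos (partner D b) = f (pos b) by have [] := r b.
have rl b : slab D b = l (pos b) by have [] := r b.
split; first exact: pos_splice.
by rewrite /splice_lab -!rf !(inj_eq pos_inj) !rl.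
Qed.

Lemma drawn_act_left h D f l : h.+1 < N -> drawn D f l ->
  drawn (gen_act false h D) (splice h h.+1 f) (splice_lab h h.+1 h.+1 f l).
Proof. by move=> lt r; rewrite gen_actE; apply: drawn_surgery r;
  apply: ltnW. Qed.

Lemma drawn_act_right h D f l : h.+1 < N -> drawn D f l ->
  drawn (gen_act true h D) (splice (N + N - h.+2).+1 (N + N - h.+2) f)
     (splice_lab (N + N - h.+2).+1 (N + N - h.+2) h.+1 f l).
Proof.
move=> lt r; rewrite gen_actE; have ->
  : (N + N - h.+2).+1 = N + N - h.+1 by lia.
by apply: drawn_surgery r; apply: ltnW.
Qed.
End Represent.

(** * Inserting an arc *)

Section TwoSides.
Variable N : nat.
Implicit Types D : diagram N.

Lemma gen_act_id h : h.+1 < N ->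
  gen_act false h (diagram_id N) = gen_act true h (diagram_id N).
Proof.
move=> lt; rewrite !gen_actE; apply: diagram_ext => a.
  rewrite !partner_surgery /splice !partner_id /flip /=.
  by case: a => -[] i; rewrite !xpair_eqE /=; do ! case: ifP.
rewrite !slab_surgery /splice_lab ?partner_id ?slab_id /flip /absn /=;
  try exact: ltnW.
case: a => -[] i; rewrite !xpair_eqE /= -!val_eqE /=.
  by do ! case: eqP => //=; lia.
by do ! case: eqP => //=; lia.
Qed.

(** Multiplications on both sides commute, as they concern disjoint sets of
    nodes. *)
Lemma word_act_right w h D : admissible D -> valid N w -> h.+1 < N ->
  word_act w (gen_act true h D) = gen_act true h (word_act w D).
Proof.
move=> g + lt; elim: w => //= h' w IH /andP[lt' vw].
by rewrite IH // gen_act_comm //; have [] := word_act_admissible w g.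
Qed.
End TwoSides.

Arguments drawn_id : clear implicits.

Definition line_act h (fl : (nat -> nat) * (nat -> nat)) :=
  (splice h h.+1 fl.1, splice_lab h h.+1 h.+1 fl.1 fl.2).

Definition line_word_act w fl := foldr line_act fl w.

Definition insert_arc n c (fl : (nat -> nat) * (nat -> nat)) :=
  (ins_partner (n + c) fl.1, ins_label (n + c) (n.+1 - c) fl.2).

Definition line_id n : (nat -> nat) * (nat -> nat) :=
  (fun p => (n + n).-1 - p, fun p => minn p.+1 (n + n - p)).

Lemma drawn_word_act N w (D : diagram N) fl : valid N w -> drawn D fl.1 fl.2 ->
  drawn (word_act w D) (line_word_act w fl).1 (line_word_act w fl).2.
Proof.
move=> + r; elim: w => //= h w IH /andP[lt vw].
exact: drawn_act_left lt (IH vw).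
Qed.

Lemma up_eqF k x : (k == up k x = false) * (k.+1 == up k x = false).
Proof. by have [? ?] := up_neq k x; split; apply/eqP => /esym. Qed.

Lemma splice_ins k u v f : splice (up k u) (up k v) (ins_partner k f)
  =1 ins_partner k (splice u v f).
Proof.
move=> x; rewrite /splice !ins_partner_up.
case: (insP k x) => [||y]; rewrite ?ins_partner_fst ?ins_partner_snd
  ?ins_partner_up ?eq_up ?up_eqF //.
by do ! case: ifP.
Qed.

Lemma splice_lab_ins k u v z z' f l :
  splice_lab (up k u) (up k v) z (ins_partner k f) (ins_label k z' l)
    =1 ins_label k z' (splice_lab u v z f l).
Proof.
move=> x; rewrite /splice_lab !ins_partner_up.
case: (insP k x) => [||y]; rewrite ?ins_label_fst ?ins_label_snd ?ins_label_up
  ?eq_up ?up_eqF //.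
Qed.

Lemma line_act_ins h n c fl : h.+1 < n ->
  line_act h (insert_arc n c fl) = insert_arc n c (line_act h fl).
Proof.
move=> lt; rewrite /line_act /insert_arc /=.
have e1 : up (n + c) h = h by rewrite /up; case: ifP; lia.
have e2 : up (n + c) h.+1 = h.+1 by rewrite /up; case: ifP; lia.
congr pair; apply: funext => x; rewrite -{1}e1 -{1}e2.
  exact: splice_ins.
by rewrite -[splice_lab _ _ _ _ _ _]/(splice_lab _ _ h.+1 _ _ x) splice_lab_ins.
Qed.

Lemma line_word_act_ins w n c fl : valid n w ->
  line_word_act w (insert_arc n c fl) = insert_arc n c (line_word_act w fl).
Proof. by elim: w => //= h w IH /andP[lt vw]; rewrite IH // line_act_ins. Qed.

(** Multiplying on the right by one more letter of a run moves the inserted arc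
    by one place. *)
Lemma ins_shift n c f l : c < n -> okada_line n f l ->
  let k := n + c in
  agree n.+1 (splice k.+2 k.+1 (ins_partner k f))
    (splice_lab k.+2 k.+1 (n - c) (ins_partner k f) (ins_label k (n.+1 - c) l))
    (ins_partner k.+1 f) (ins_label k.+1 (n - c) l).
Proof.
move=> lt [okl _] k x ltx.
have upS y : y <> k -> up k.+1 y = up k y.
  by rewrite /up => ne; case: ifP; case: ifP; lia.
have upk : up k.+1 k = k by rewrite /up ltnSn.
have upk2 : up k k = k.+2 by rewrite /up ltnn.
have fm y : y < n + n -> [/\ f y <> y, f (f y) = y & l (f y) = l y].
  by move=> /okl[[]].
have [k1 k2 k3] := fm k ltac:(lia).
have lk : l k <= n - c.
  by have [_ [_ _ ? _ _]] := okl k ltac:(lia); lia.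
have Fk : ins_partner k f k.+2 = up k (f k) by rewrite -upk2 ins_partner_up.
have Lk z : ins_label k z l k.+2 = l k by rewrite -upk2 ins_label_up.
rewrite /splice /splice_lab ins_partner_snd ins_label_snd Fk Lk.
have mk : minn (l k) (n.+1 - c) = l k by lia.
rewrite mk; case: (insP k.+1 x) ltx => [||y] lty;
  rewrite ?ins_partner_fst ?ins_partner_snd ?ins_label_fst ?ins_label_snd
  ?ins_partner_up ?ins_label_up.
- by rewrite eqxx orbT; case: eqP => //; lia.
- by rewrite eqxx.
have {}lty : y < n + n by move: lty; rewrite /up; case: ifP; lia.
have [y1 y2 y3] := fm y lty.
rewrite [_ == k.+2]eq_sym [_ == k.+1]eq_sym !up_eqF /=.
have [->|/eqP ne] := eqVneq y k.
  by rewrite upk up_eqF eqxx upS.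
rewrite upS // eq_up [_ == k]eq_sym up_eqF orbF.
case: eqP => [->|ne2]; first by rewrite k2 k3 upk.
rewrite ins_partner_up ins_label_up upS //.
by move=> E; apply: ne2; rewrite -E.
Qed.

(** Each letter of the run is moved from the left to the right side of the
    identity, where it shifts the arc inserted in the middle. *)
Lemma drawn_run n c : c <= n ->
  drawn (word_act (run n c) (diagram_id n.+1)) (insert_arc n c (line_id n)).1
    (insert_arc n c (line_id n)).2.
Proof.
have oid : okada_line n (line_id n).1 (line_id n).2.
  split=> [p lt|p q lt]; last by move=> /= b; split; lia.
  by split; split=> /=; lia.
elim: c => [_|c IH lt].
  rewrite [word_act _ _]/=; apply: agree_drawn (drawn_id n.+1) => p lt;
    rewrite /insert_arc addn0 subn0 /=.
  case: (insP n p) lt => [||x] lt; rewrite ?ins_partner_fst ?ins_partner_snd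
    ?ins_label_fst ?ins_label_snd ?ins_partner_up ?ins_label_up.
  - by split; lia.
  - by split; lia.
  by move: lt; rewrite /up /=; do ! case: ifP; split; lia.
have -> : run n c.+1 = run n c ++ [:: n - c.+1].
  by rewrite -addn1 run_cat /run /= -subnDA addn1.
have ltn1 : (n - c.+1).+1 < n.+1 by lia.
rewrite word_act_cat [word_act [:: _] _]/= gen_act_id // word_act_right //;
  last first.
- exact/valid_run/ltnW.
- exact: admissible_id.
have e1 : n.+1 + n.+1 - (n - c.+1).+2 = (n + c).+1 by lia.
have := drawn_act_right ltn1 (IH (ltnW lt)); rewrite e1 /=.
apply: agree_drawn => p ltp; have := ins_shift lt oid ltp.
by rewrite /= addnS subSS subnSK.
Qed.

Definition code_line c n := line_word_act (code_word c n) (line_id n).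

Lemma drawn_code n c : bounded c ->
  drawn (word_act (code_word c n) (diagram_id n)) (code_line c n).1
    (code_line c n).2.
Proof. by move=> cb; apply: drawn_word_act;
  [apply: valid_code_word | apply: drawn_id]. Qed.

(** The last run inserts an arc in the identity, and the letters of the other
    runs act on the left of it. *)
Lemma code_line_ins n c : bounded c ->
  agree n.+1 (code_line c n.+1).1 (code_line c n.+1).2
    (insert_arc n (c n) (code_line c n)).1
      (insert_arc n (c n) (code_line c n)).2.
Proof.
move=> cb; apply: drawn_agree (drawn_code cb) _.
rewrite [code_word c n.+1]/= word_act_cat /code_line -line_word_act_ins;
  last exact: valid_code_word.
apply: drawn_word_act; last exact: drawn_run.
by apply: validW (valid_code_word _ cb).
Qed.

Arguments code_line_ins : clear implicits.

Lemma agree_sym n f l f' l' : agree n f l f' l' -> agree n f' l' f l.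
Proof. by move=> e p /e[]. Qed.

Lemma agree_trans n f l f' l' f'' l'' :
  agree n f l f' l' -> agree n f' l' f'' l'' -> agree n f l f'' l''.
Proof. by move=> e e' p lt; have [-> ->] := e _ lt; apply: e'. Qed.

Lemma code_line_okada n c : bounded c ->
  okada_line n (code_line c n).1 (code_line c n).2.
Proof.
move=> cb; elim: n => [|n IH]; first by split.
by apply: agree_okada_line (agree_sym (code_line_ins n _ cb)) _;
  apply: ins_okada_line.
Qed.

Lemma code_line_inj n c c' : bounded c -> bounded c' ->
  agree n (code_line c n).1 (code_line c n).2 (code_line c' n).1
    (code_line c' n).2 ->
  forall i, i < n -> c i = c' i.
Proof.
move=> cb cb'; elim: n => // n IH e i.
have {}e := agree_trans (agree_sym (code_line_ins n _ cb))
  (agree_trans e (code_line_ins n _ cb')).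
have [ec {}e] := ins_inj (cb n) (cb' n) (code_line_okada n cb)
  (code_line_okada n cb') e.
by rewrite ltnS leq_eqVlt => /orP[/eqP-> //|]; apply: IH.
Qed.

Lemma agree_ins n c f l f' l' : c <= n -> agree n f l f' l' ->
  agree n.+1 (insert_arc n c (f, l)).1 (insert_arc n c (f, l)).2
    (insert_arc n c (f', l')).1 (insert_arc n c (f', l')).2.
Proof.
move=> le e p; case: (insP (n + c) p) => [||x] lt;
  rewrite /= ?ins_partner_fst ?ins_partner_snd ?ins_label_fst ?ins_label_snd //.
have [|E1 E2] := e x; first by move: lt; rewrite /up; case: ifP; lia.
by rewrite !ins_partner_up !ins_label_up E1 E2.
Qed.

Lemma code_line_surj n f l : okada_line n f l ->
  exists c, bounded c /\ agree n f l (code_line c n).1 (code_line c n).2.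
Proof.
elim: n f l => [|n IH] f l o; first by exists id; split.
have [d [f' [l' [le o' e]]]] := okada_line_split o.
have [c [cb e']] := IH _ _ o'.
pose c' i := if i < n then c i else if i == n then d else 0.
have cb' : bounded c'.
  by move=> i; rewrite /c'; case: ifP => _; [exact: cb | case: eqP => // ->].
exists c'; split=> //; apply: agree_trans e _.
apply: agree_trans (agree_sym (code_line_ins n _ cb')).
have -> : c' n = d by rewrite /c' ltnn eqxx.
have ew : code_word c' n = code_word c n by apply: eq_code_word => i;
  rewrite /c' => ->.
by have := agree_ins le e'; rewrite /code_line ew.
Qed.

(** * Crossings *)

Lemma sum_up k m (g : nat -> nat) : k <= m ->
  \sum_(0 <= p < m.+2) g p = g k + g k.+1 + \sum_(0 <= y < m) g (up k y).
Proof.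
move=> le; rewrite (big_cat_nat (n := k)) //=; last by lia.
rewrite [\sum_(k <= _ < _) _]big_ltn; last by lia.
rewrite [\sum_(k.+1 <= _ < _) _]big_ltn; last by lia.
rewrite !big_add1 /= [in RHS](big_cat_nat (n := k)) //=.
have -> : \sum_(0 <= y < k) g (up k y) = \sum_(0 <= y < k) g y.
  by apply: eq_big_nat => y /andP[_ lt]; rewrite /up lt.
have -> : \sum_(k <= y < m) g (up k y) = \sum_(k <= y < m) g y.+2.
  by apply: eq_big_nat => y /andP[ge _]; rewrite /up ltnNge ge.
lia.
Qed.

(** Draw each arc so that it reaches down to the level of its label. The number
    of crossings with the vertical line between j+1 and j+2 is then the sum over
    all ends of arcs of the condition below. *)
Definition crossings n j (l : nat -> nat) : nat :=
  \sum_(0 <= p < n + n) (l p <= j.+1 < minn p.+1 (n + n - p)).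

Lemma crossings_agree n j f l f' l' : agree n f l f' l' ->
  crossings n j l = crossings n j l'.
Proof. by move=> e; apply: eq_big_nat => p /andP[_ lt];
  have [_ ->] := e p lt. Qed.

(** Each arc that the insertion shifts on the right is stretched over two more
    levels, and the new arc and the turn in the middle account for the rest. *)
Lemma crossings_ins n c j f l : c <= n -> okada_line n f l ->
  crossings n.+1 j (ins_label (n + c) (n.+1 - c) l)
    = crossings n j l + (n - c <= j < n).*2.
Proof.
move=> le [okl _]; rewrite /crossings addSn addnS (@sum_up (n + c));
  last by lia.
rewrite ins_label_fst ins_label_snd.
have -> : \sum_(0 <= y < n + n)
    (ins_label (n + c) (n.+1 - c) l (up (n + c) y) <= j.+1 <
       minn (up (n + c) y).+1 ((n + n).+2 - up (n + c) y)) =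
  crossings n j l + \sum_(0 <= y < n + n)
     (minn y.+1 (n + n - y) <= j.+1 < minn (up (n + c) y).+1
       ((n + n).+2 - up (n + c) y)).
  rewrite /crossings -big_split /=; apply: eq_big_nat => y /andP[_ lt].
  have [_ [_ b1 b2 _ _]] := okl y lt.
  by rewrite ins_label_up /up; case: ifP; lia.
set S := \sum_(0 <= y < n + n) (minn _ _ <= _ < _).
have -> : S = (n - c <= j < n) + (n - c < j < n).
  rewrite {}/S (big_cat_nat (n := n)) ?leq_addr //= big1_seq; last first.
    by move=> y /andP[_]; rewrite mem_index_iota /up; case: ifP; lia.
  rewrite add0n (big_cat_nat (n := n + c)) /=; try lia.
  rewrite [X in _ + X]big1_seq; last first.
    by move=> y /andP[_]; rewrite mem_index_iota /up; case: ifP; lia.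
  have -> : \sum_(n <= y < n + c)
     (minn y.+1 (n + n - y) <= j.+1 < minn (up (n + c) y).+1
       ((n + n).+2 - up (n + c) y)) =
    \sum_(n <= y < n + c) (minn y.+1 (n + n - y) <= j.+1 < minn y.+1
      ((n + n).+2 - y)).
    by apply: eq_big_nat => y b; rewrite /up; case: ifP; lia.
  elim: c le => [|c IH] lt; first by rewrite big_geq; lia.
  by rewrite addnS big_nat_recr ?leq_addr //=; have := IH (ltnW lt); lia.
rewrite -/(crossings n j l); lia.
Qed.

Lemma count_run n c j : c <= n -> count_mem j (run n c) = (n - c <= j < n).
Proof.
move=> le; rewrite count_uniq_mem ?mem_run //.
rewrite map_inj_in_uniq ?iota_uniq // => x y; rewrite !mem_iota; lia.
Qed.

(** Each occurrence of a letter in the word of a code is paid for by two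
    crossings. *)
Lemma crossings_code_line n c j : bounded c ->
  crossings n j (code_line c n).2 = (count_mem j (code_word c n)).*2.
Proof.
move=> cb; elim: n => [|n IH]; first by rewrite /crossings big_geq.
rewrite (crossings_agree j (code_line_ins n c cb))
  (crossings_ins _ (cb n) (code_line_okada n cb)).
by rewrite IH /= count_cat count_run // doubleD.
Qed.

Section Levels.
Variable N : nat.
Implicit Types D : diagram N.

(** The crossings of D at a level, as a sum over the nodes; this form splits
    into contributions of the two halves of D. *)
Definition level D j : nat := \sum_(a : node N) (slab D a <= j.+1 < absn a).

Lemma pos_bij : bijective (fun a : node N => Ordinal (pos_lt a)).
Proof.
apply: inj_card_bij => [a b [] /pos_inj //|].
by rewrite card_prod card_bool !card_ord mul2n addnn.
Qed.

Lemma drawn_level D f l j : drawn D f l -> level D j = crossings N j l.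
Proof.
move=> r; rewrite /crossings big_mkord (reindex _ (onW_bij _ pos_bij)) /=.
by apply: eq_bigr => a _; have [_ ->] := r a; rewrite pos_absn.
Qed.

Lemma level_code_word c j : bounded c ->
  level (word_act (code_word c N) (diagram_id N)) j
    = (count_mem j (code_word c N)).*2.
Proof. by move=> cb; rewrite (drawn_level j (drawn_code cb))
  crossings_code_line. Qed.
End Levels.

(** * The product of diagrams *)

Lemma connect_le (T : finType) (e : rel T) (R : T -> T -> Prop) :
  (forall x, R x x) -> (forall x y z, R x y -> R y z -> R x z) ->
  (forall x y, e x y -> R x y) -> forall x y, connect e x y -> R x y.
Proof.
move=> rr tr er x y /connectP[p + ->]; elim: p x => //= z p IH x /andP[xz pz].
by apply: (tr _ z); [apply: er | apply: IH].
Qed.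

Section Glue.
Variable N : nat.
Implicit Types (D : diagram N) (a b c : node N).
Local Notation vertex := (node N + 'I_N)%type.

Variant glue_edge_spec D1 D2 : vertex -> vertex -> Prop :=
| EdgeL a : glue_edge_spec D1 D2 (glue_left a) (glue_left (partner D1 a))
| EdgeR a : glue_edge_spec D1 D2 (glue_right a) (glue_right (partner D2 a)).

Lemma glue_edgeP D1 D2 x y : reflect (glue_edge_spec D1 D2 x y)
  (glue_edge D1 D2 x y).
Proof.
apply: (iffP orP) => [[] /existsP[a /andP[/eqP-> /eqP->]]|[] a].
- exact: EdgeL.
- exact: EdgeR.
- by left; apply/existsP; exists a; rewrite !eqxx.
by right; apply/existsP; exists a; rewrite !eqxx.
Qed.

Lemma edgeL D1 D2 a : glue_conn D1 D2 (glue_left a) (glue_left (partner D1 a)).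
Proof. by apply: connect1; apply/glue_edgeP/EdgeL. Qed.

Lemma edgeR D1 D2 a : glue_conn D1 D2 (glue_right a)
  (glue_right (partner D2 a)).
Proof. by apply: connect1; apply/glue_edgeP/EdgeR. Qed.

Lemma conn_sym D1 D2 : matched D1 -> matched D2 -> symmetric (glue_conn D1 D2).
Proof.
move=> m1 m2; apply: sym_connect_sym => x y.
suff h x' y' : glue_edge D1 D2 x' y' -> glue_edge D1 D2 y' x'.
  by apply/idP/idP; apply: h.
move=> /glue_edgeP[] a; apply/glue_edgeP.
  by have [_ e _] := m1 a; have := EdgeL D1 D2 (partner D1 a); rewrite e.
by have [_ e _] := m2 a; have := EdgeR D1 D2 (partner D2 a); rewrite e.
Qed.

Lemma conn_trans D1 D2 y x z :
  glue_conn D1 D2 x y -> glue_conn D1 D2 y z -> glue_conn D1 D2 x z.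
Proof. exact: connect_trans. Qed.

(** A minimum of labels is described by the integers above it, so that joining
    two components becomes a disjunction. *)
Definition arc_le D1 D2 (x : vertex) k :=
  exists c, (glue_conn D1 D2 x (glue_left c) /\ slab D1 c <= k) \/
            (glue_conn D1 D2 x (glue_right c) /\ slab D2 c <= k).

(** D results from gluing D1 and D2. Together with [glued_mul] this relation
    gives access to products; it is established by induction along a word, so
    that no argument about the shape of the components is needed. *)
Definition glued D1 D2 D :=
  (forall a b, glue_conn D1 D2 (inl a) (inl b)
    = (b == a) || (b == partner D a)) /\
  (forall a k, slab D a <= k <-> arc_le D1 D2 (inl a) k).

Lemma glued_mul D1 D2 D : matched D -> glued D1 D2 D -> diagram_mul D1 D2 = D.
Proof.
move=> m [cn le]; have slabN D' a : slab D' a <= N by rewrite -ltnS ltn_ord.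
apply: diagram_ext => a.
  rewrite /partner ffunE /=; case: pickP => [b|no] /=.
    by rewrite cn -/(partner D a); case: eqVneq => //= _ /eqP.
  have [na _ _] := m a; have := no (partner D a).
  by rewrite cn eqxx orbT andbT -/(partner D a) => /negbFE/eqP.
rewrite {1}/slab /lab ffunE /=; set M := Order.min _ _.
have low k : arc_le D1 D2 (inl a) k -> M <= k.
  case=> c [] [cc lk]; apply: leq_trans lk.
    rewrite -[_ <= _]/(M <= lab D1 c)%O /M ge_min; apply/orP; left.
    exact: bigmin_le_cond.
  rewrite -[_ <= _]/(M <= lab D2 c)%O /M ge_min; apply/orP; right.
  exact: bigmin_le_cond.
apply/eqP; rewrite eqn_leq; apply/andP; split; first by apply/low/le.
rewrite -[_ <= _]/(lab D a <= M)%O /M le_min; apply/andP; split.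
  apply/bigmin_geP; split=> [|c cc]; first exact: slabN.
  by apply/le; exists c; left.
apply/bigmin_geP; split=> [|c cc]; first exact: slabN.
by apply/le; exists c; right.
Qed.

(** Each outer node on the left is just prolonged by a strand, whose label is
    not smaller than the label of the node. *)
Lemma glued_id D : admissible D -> glued (diagram_id N) D D.
Proof.
move=> [m le]; pose r (x : vertex) : node N := match x with inl a => a | inr
  i => (false, i) end.
have rR a : r (glue_right a) = a by case: a => -[].
have inv a : partner D (partner D a) = a by have [] := m a.
have into x y : glue_conn (diagram_id N) D x y ->
  r y = r x \/ r y = partner D (r x).
  move: x y; apply: connect_le.
  - by left.
  - by move=> x y z [->|->] [->|->]; rewrite ?inv; auto.
  move=> x y /glue_edgeP[] a; last by right; rewrite !rR.
  by left; rewrite partner_id /flip; case: a => -[] i.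
have to_right a : glue_conn (diagram_id N) D (inl a) (glue_right a).
  case: a => -[] i; first exact: connect0.
  by have := edgeL (diagram_id N) D (false, i); rewrite partner_id.
have sym := conn_sym (admissible_id N).1 m.
split=> [a b|a k].
  apply/idP/orP => [/into[] /= ->|[]/eqP->]; rewrite ?eqxx; auto.
    exact: connect0.
  apply: (conn_trans (to_right a)); apply: (conn_trans (edgeR _ _ _)).
  by rewrite sym; apply: to_right.
have lp b : slab D (partner D b) = slab D b by have [] := m b.
split=> [lk|[c [[cc]|[cc]]]]; first by exists a; right.
  rewrite slab_id => ck.
  have e : absn (r (glue_left c)) = absn c by case: (c) => -[].
  have := into _ _ cc; rewrite /= => cs; apply: leq_trans ck.
  by rewrite -e; case: cs => E; [rewrite E; apply: le | rewrite -lp -E;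
    apply: le].
by case: (into _ _ cc); rewrite rR /= => ->; rewrite ?lp.
Qed.

Section Step.
Variables (D1 D2 D : diagram N) (i j : 'I_N) (z : nat).
Local Notation u := ((false, i) : node N).
Local Notation v := ((false, j) : node N).
Hypotheses (m1 : matched D1) (m2 : matched D2) (m : matched D) (uv : u <> v)
  (zN : z <= N).
Hypothesis gl : glued D1 D2 D.
Local Notation D1' := (surgery u v z D1).
Local Notation conn := (glue_conn D1 D2).
Local Notation conn' := (glue_conn D1' D2).
Local Notation p := (partner D1 u).
Local Notation q := (partner D1 v).

Let m1' : matched D1'. Proof. exact: surgery_matched. Qed.
Let sym := conn_sym m1 m2.
Let sym' := conn_sym m1' m2.

Lemma step_uv x : conn' (inl u) x = (x == inl u) || (x == inl v).
Proof.
have e : partner D1' u = v by rewrite partner_surgery /splice eqxx.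
apply/idP/idP => [c|/orP[]/eqP->]; last 2 first.
- exact: connect0.
- by have := edgeL D1' D2 u; rewrite e.
suff h x' y : conn' x' y -> x' = inl u \/ x' = inl v -> y = inl u \/ y = inl v.
  by case: (h _ _ c (or_introl erefl)) => ->; rewrite eqxx ?orbT.
move: x' y; apply: connect_le => [//|x' y w h1 h2 /h1/h2//|x' y].
case/glue_edgeP=> b; last by case: b => -[] ? [].
rewrite partner_surgery /splice.
have hb w : glue_left b = inl (false, w) ->
  b = (false, w) by case: b => -[] ? // [->].
case=> [/hb|/hb] ->; rewrite ?eqxx; first by right.
by case: eqP => _; [right | left].
Qed.

Lemma step_vu x : conn' (inl v) x = (x == inl u) || (x == inl v).
Proof.
have e : conn' (inl u) (inl v) by rewrite step_uv eqxx orbT.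
rewrite -step_uv; apply/idP/idP => h; first exact: conn_trans e h.
by apply: conn_trans h; rewrite sym'.
Qed.

(** The two components of the ends u and v, which the surgery opens and then
    joins. *)
Definition cut x := conn (inl u) x || conn (inl v) x.

Lemma cutP x y : conn x y -> cut x = cut y.
Proof.
move=> c; have c' : conn y x by rewrite sym.
by apply/idP/idP => /orP[h|h]; apply/orP; [left|right|left|right];
  apply: conn_trans h _.
Qed.

Lemma cut_left : cut (glue_left p) && cut (glue_left q).
Proof.
apply/andP; split.
  by rewrite -(cutP (edgeL D1 D2 u)) /cut /glue_conn connect0.
by rewrite -(cutP (edgeL D1 D2 v)) /cut /glue_conn connect0 orbT.
Qed.

Lemma step_conn_sub x y : conn' x y -> conn x y \/ cut x /\ cut y.
Proof.
move: x y; apply: connect_le => [x|x y w|x y].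
- by left; apply: connect0.
- case=> [h|[h1 h2]] [h'|[h1' h2']].
  + by left; apply: conn_trans h h'.
  + by right; rewrite (cutP h).
  + by right; rewrite -(cutP h').
  by right.
have [/andP[cp cq]] := cut_left.
case/glue_edgeP=> b; last by left; apply: edgeR.
rewrite partner_surgery /splice.
have cu : cut (inl u) by rewrite /cut /glue_conn connect0.
have cv : cut (inl v) by rewrite /cut /glue_conn connect0 orbT.
case: eqP => [->|_]; first by right.
case: eqP => [->|_]; first by right.
case: eqP => [->|_]; first by right.
case: eqP => [->|_]; first by right.
by left; apply: edgeL.
Qed.

Hypothesis pv : p <> v.
Let qu : q <> u.
Proof. by move=> e; apply: pv; have [_ <- _] := m1 v; rewrite e. Qed.
Let pu : p <> u. Proof. by have [] := m1 u. Qed.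
Let qv : q <> v. Proof. by have [] := m1 v. Qed.

Lemma glue_left_neq a (k : 'I_N) : a <> (false, k) ->
  glue_left a <> inl (false, k).
Proof. by case: a => -[] k' // n [] e; apply: n; rewrite e. Qed.

Lemma glue_right_neq a (k : 'I_N) : glue_right a <> inl (false, k).
Proof. by case: a => -[]. Qed.

Lemma step_pq : conn' (glue_left p) (glue_left q).
Proof.
have := edgeL D1' D2 p; rewrite partner_surgery /splice.
by case: eqP => // _; case: eqP => // _; rewrite eqxx.
Qed.

(** A path may pass through u or v only on its way to their partners, so that
    replacing u and v by these partners makes it avoid u and v. *)
Lemma step_conn x y : conn x y ->
  x <> inl u -> x <> inl v -> y <> inl u -> y <> inl v -> conn' x y.
Proof.
pose r (x : vertex) := if x == inl u then glue_left p else
                      if x == inl v then glue_left q else x.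
have rid x' : x' <> inl u -> x' <> inl v -> r x' = x'.
  by rewrite /r => /eqP/negbTE-> /eqP/negbTE->.
suff h : conn x y -> conn' (r x) (r y).
  by move=> /h + a b c d; rewrite !rid.
move: x y; apply: connect_le => [x|x y w|x y]; first exact: connect0.
  exact: conn_trans.
case/glue_edgeP=> b; last first.
  by rewrite !rid; try exact: glue_right_neq; apply: edgeR.
have inv a : partner D1 (partner D1 a) = a by have [] := m1 a.
have [->|/eqP bu] := eqVneq b u.
  rewrite (rid (glue_left p)); try exact: glue_left_neq.
  by rewrite /r eqxx; apply: connect0.
have [->|/eqP bv] := eqVneq b v.
  rewrite (rid (glue_left q)); try exact: glue_left_neq.
  rewrite /r; case: eqP => [[e]|_]; first by case: uv; rewrite /= e.
  by rewrite eqxx; apply: connect0.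
have [->|/eqP bp] := eqVneq b p.
  rewrite inv (rid (glue_left p)); try exact: glue_left_neq.
  by rewrite /r eqxx; apply: connect0.
have [->|/eqP bq] := eqVneq b q.
  rewrite inv (rid (glue_left q)); try exact: glue_left_neq.
  rewrite /r; case: eqP => [[e]|_]; first by case: uv; rewrite /= e.
  by rewrite eqxx; apply: connect0.
have := edgeL D1' D2 b; rewrite partner_surgery /splice.
do 4 (case: eqP => // _).
rewrite !rid //; apply: glue_left_neq => // e.
- by apply: bp; rewrite -e inv.
- by apply: bq; rewrite -e inv.
Qed.

Lemma step_cut x y : cut x -> cut y ->
  x <> inl u -> x <> inl v -> y <> inl u -> y <> inl v -> conn' x y.
Proof.
move=> cx cy a b c d.
have to x' : x' <> inl u -> x' <> inl v -> cut x' -> conn' (glue_left p) x'.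
  move=> a' b' /orP[h|h].
    apply: step_conn => //; try exact: glue_left_neq.
    by apply: conn_trans h; rewrite sym; apply: edgeL.
  apply: conn_trans step_pq _.
  apply: step_conn => //; try exact: glue_left_neq.
  by apply: conn_trans h; rewrite sym; apply: edgeL.
by apply: conn_trans (to y c d cy); rewrite sym'; apply: to.
Qed.

Lemma step_end x a : x = inl u \/ x = inl v -> a <> u -> a <> v ->
  conn' (inl a) x = false.
Proof.
move=> e au av; rewrite sym'; apply/negbTE.
by case: e => ->; rewrite ?step_uv ?step_vu; apply/norP; split;
  apply/eqP => -[].
Qed.

Lemma step_connE a x : a <> u -> a <> v -> x <> inl u -> x <> inl v ->
  conn' (inl a) x = conn (inl a) x || (cut (inl a) && cut x).
Proof.
move=> au av xu xv; have nu : inl a <> inl u :> vertex by case.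
have nv : inl a <> inl v :> vertex by case.
apply/idP/idP => [/step_conn_sub[->//|[-> ->]]|/orP[h|/andP[h h']]].
- by rewrite orbT.
- exact: step_conn.
- exact: step_cut.
Qed.

Let inv a : partner D (partner D a) = a. Proof. by have [] := m a. Qed.

Lemma step_end_le a k : a = u \/ a = v -> z <= k <-> arc_le D1' D2 (inl a) k.
Proof.
move=> au; split=> [zk|[c cc]].
  exists a; left; split; first by case: au => ->; apply: connect0.
  by rewrite slab_surgery // /splice_lab; case: au => ->; rewrite eqxx ?orbT.
have gE x : conn' (inl a) x = (x == inl u) || (x == inl v).
  by case: au => ->; [apply: step_uv | apply: step_vu].
have hc w : glue_left c = inl (false, w) ->
  c = (false, w) by case: (c) => -[] ? // [->].
case: cc; rewrite gE => -[/orP[]/eqP h].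
- by rewrite (hc _ h) slab_surgery // /splice_lab eqxx.
- by rewrite (hc _ h) slab_surgery // /splice_lab eqxx orbT.
- by case: (glue_right_neq h).
- by case: (glue_right_neq h).
Qed.

(** A component that was cut has become the union of both, without the arcs at
    u and v; the labels of these survive in the new arc between p and q. *)
Lemma step_other_le a k : a <> u -> a <> v ->
  arc_le D1' D2 (inl a) k <->
  (if cut (inl a) then arc_le D1 D2 (inl u) k \/ arc_le D1 D2 (inl v) k
   else arc_le D1 D2 (inl a) k).
Proof.
move=> au av.
have hl c : c <> u -> c <> v -> glue_left c <> inl u /\ glue_left c <> inl v.
  by move=> ? ?; split; apply: glue_left_neq.
have hr c : glue_right c <> inl u /\ glue_right c <> inl v.
  by split; apply: glue_right_neq.
have [cp cq] := andP cut_left.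
have lp : slab D1' p = minn (slab D1 u) (slab D1 v).
  rewrite slab_surgery // /splice_lab eqxx; case: eqP => //; case: eqP => //.
have lq : slab D1' q = minn (slab D1 u) (slab D1 v).
  by rewrite slab_surgery // /splice_lab eqxx orbT; case: eqP => //; case: eqP.
split.
  case=> c [] [cc lk].
    have cu : c <> u.
      by move=> e; move: cc; rewrite e -[glue_left _]/(inl u) step_end; auto.
    have cv : c <> v.
      by move=> e; move: cc; rewrite e -[glue_left _]/(inl v) step_end; auto.
    have [n1 n2] := hl c cu cv.
    rewrite step_connE // in cc.
    have lc : slab D1' c = if (c == p) || (c == q) then minn (slab D1 u)
      (slab D1 v) else slab D1 c.
      by rewrite slab_surgery // /splice_lab; do 2 (case: eqP => //= _).
    have cc' : conn (inl a) (glue_left c) ->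
      cut (inl a) = cut (glue_left c) by apply: cutP.
    have base : (c == p) || (c == q) -> slab D1' c <= k ->
      arc_le D1 D2 (inl u) k \/ arc_le D1 D2 (inl v) k.
      move=> e; rewrite lc e geq_min => /orP[h|h]; [left|right].
        by exists u; left; split=> //; apply: connect0.
      by exists v; left; split=> //; apply: connect0.
    have cutpq : (c == p) || (c == q) -> cut (glue_left c) by case/orP=> /eqP->.
    case E: ((c == p) || (c == q)).
      have -> : cut (inl a) by case/orP: cc => [/cc'-> | /andP[]//];
        apply: cutpq.
      exact: base.
    rewrite lc E in lk.
    case/orP: cc => [h|/andP[-> /orP[h|h]]]; last 2 first.
    - by left; exists c; left.
    - by right; exists c; left.
    case: ifP => [/orP[h'|h']|_]; last by exists c; left.
    + by left; exists c; left; split=> //; apply: conn_trans h' h.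
    + by right; exists c; left; split=> //; apply: conn_trans h' h.
  have [n1 n2] := hr c; rewrite step_connE // in cc.
  case/orP: cc => [h|/andP[-> /orP[h|h]]]; last 2 first.
  - by left; exists c; right.
  - by right; exists c; right.
  case: ifP => [/orP[h'|h']|_]; last by exists c; right.
  + by left; exists c; right; split=> //; apply: conn_trans h' h.
  + by right; exists c; right; split=> //; apply: conn_trans h' h.
have key w : w = u \/ w = v -> cut (inl a) -> arc_le D1 D2 (inl w) k ->
  arc_le D1' D2 (inl a) k.
  move=> ew ca [c [] [cc lk]]; last first.
    have [n1 n2] := hr c; exists c; right; split=> //;
      rewrite step_connE // ca /=.
    by case: ew cc => -> h; rewrite /cut h ?orbT.
  have [cu|/eqP cu] := eqVneq c u.
    exists p; left; split; last by rewrite lp geq_min -cu lk.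
    by have [n1 n2] := hl p pu pv; rewrite step_connE // ca cp orbT.
  have [cv|/eqP cv] := eqVneq c v.
    exists q; left; split; last by rewrite lq geq_min -cv lk orbT.
    by have [n1 n2] := hl q qu qv; rewrite step_connE // ca cq orbT.
  have [n1 n2] := hl c cu cv.
  exists c; left; split.
    by rewrite step_connE // ca /=; case: ew cc => -> h; rewrite /cut h ?orbT.
  have [_ _ lu] := m1 u; have [_ _ lv] := m1 v.
  rewrite slab_surgery // /splice_lab; case: eqP => // _; case: eqP => //= _.
  by case: ifP => // /orP[]/eqP e; rewrite e ?lu ?lv in lk; lia.
case: ifP => ca; first by case; apply: key; auto.
case=> c [] [cc lk]; last first.
  by have [n1 n2] := hr c; exists c; right; split=> //;
    rewrite step_connE // cc.
have ncut : cut (glue_left c) = false by rewrite -(cutP cc).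
have cu : c <> u by move=> e; move: ncut; rewrite e /cut /glue_conn connect0.
have cv : c <> v by move=> e; move: ncut;
  rewrite e /cut /glue_conn connect0 orbT.
have [n1 n2] := hl c cu cv; exists c; left; split;
  first by rewrite step_connE // cc.
rewrite slab_surgery // /splice_lab; case: eqP => // _; case: eqP => //= _.
by case: ifP => // /orP[]/eqP e; rewrite e ?cp ?cq in ncut.
Qed.

(** Surgery on the left factor, when u and v are not yet partners in it. *)
Lemma glued_surg_apart : glued D1' D2 (surgery u v z D).
Proof.
have [cn le] := gl.
have cutE a : cut (inl a) = (a == u) || (a == partner D u) || (a == v) ||
  (a == partner D v).
  by rewrite /cut !cn !orbA.
split=> [a b|a k].
  rewrite partner_surgery; have [->|/eqP au] := eqVneq a u.
    by rewrite step_uv /splice eqxx.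
  have [->|/eqP av] := eqVneq a v.
    have vu : (v == u) = false by apply/eqP => e; apply: uv.
    by rewrite step_vu /splice vu eqxx; apply: orbC.
  have mm := splice_matching z m uv.
  have [->|/eqP bu] := eqVneq b u.
    rewrite step_end; auto; apply/esym/negbTE/norP; split; apply/eqP => e;
      first exact: au (esym e).
    by have [_ + _] := mm a; rewrite -e /splice eqxx => e2; apply: av.
  have [->|/eqP bv] := eqVneq b v.
    rewrite step_end; auto; apply/esym/negbTE/norP; split; apply/eqP => e;
      first exact: av (esym e).
    have [_ + _] := mm a; rewrite -e /splice eqxx; case: eqP => [e' _|_ e'].
      by case: uv; rewrite e'.
    by apply: au.
  rewrite step_connE //; try by case.
  rewrite cn !cutE /splice.
  have iu := inv u; have iv := inv v; have ia := inv a; have ib := inv b.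
  have [fu _ _] := m u; have [fv _ _] := m v; have [fa _ _] := m a;
    have [fb _ _] := m b.
  by repeat eqcase.
rewrite slab_surgery // /splice_lab.
have [->|/eqP au] := eqVneq a u; first by apply: step_end_le; left.
have [->|/eqP av] := eqVneq a v; first by apply: step_end_le; right.
rewrite /=; split=> [h|/step_other_le].
  apply/step_other_le => //; move: h; rewrite cutE.
  have lu := le u k; have lv := le v k; have la := le a k.
  move/eqP/negbTE: (au) => ->; move/eqP/negbTE: (av) => ->; rewrite /= orbF.
  by case: ifP => _; rewrite ?geq_min; [case/orP; tauto | tauto].
move=> /(_ au av); rewrite cutE.
have lu := le u k; have lv := le v k; have la := le a k.
move/eqP/negbTE: (au) => ->; move/eqP/negbTE: (av) => ->; rewrite /= orbF.
case: ifP => _; rewrite ?geq_min; last by tauto.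
by case=> [/lu->|/lv->]; rewrite ?orbT.
Qed.
End Step.

(** When u and v are already partners in the left factor, they form a component,
    and the surgery only changes its label. *)
Lemma glued_surg_loop (D1 D2 D : diagram N) (i j : 'I_N) z :
  let u := (false, i) in let v := (false, j) in
  matched D1 -> matched D2 -> matched D -> u <> v -> z <= N -> glued D1 D2 D ->
  partner D1 u = v -> glued (surgery u v z D1) D2 (surgery u v z D).
Proof.
move=> u v m1 m2 m uv zN [cn le] e.
have e' : partner D1 v = u by have [_ <- _] := m1 u; rewrite e.
have sp1 : splice u v (partner D1) =1 partner D1.
  move=> a; rewrite /splice e e'.
  by have [fa fa' _] := m1 a; repeat eqcase.
have ED : partner D u = v.
  have := edgeL D1 D2 u; rewrite e cn => /orP[]/eqP // ee.
  by case: uv.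
have ED' : partner D v = u by have [_ <- _] := m u; rewrite ED.
have spD : splice u v (partner D) =1 partner D.
  move=> a; rewrite /splice ED ED'.
  by have [fa fa' _] := m a; repeat eqcase.
have cE x y : glue_conn (surgery u v z D1) D2 x y = glue_conn D1 D2 x y.
  apply: eq_connect => x' y'; apply/idP/idP => /glue_edgeP[] a;
    apply/glue_edgeP; try exact: EdgeR.
    by rewrite partner_surgery sp1; apply: EdgeL.
  by rewrite -sp1 -(partner_surgery _ _ z); apply: EdgeL.
split=> [a b|a k]; first by rewrite cE partner_surgery spD.
have sl1 (E : diagram N) c : partner E u = v -> partner E v = u ->
  slab (surgery u v z E) c = if (c == u) || (c == v) then z else slab E c.
  move=> Eu Ev; rewrite slab_surgery // /splice_lab Eu Ev.
  by case: eqP => //= _; case: eqP.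
rewrite sl1 //; have hc c w : glue_left c = inl (false, w) -> c = (false, w).
  by case: (c) => -[] ? // [->].
have inner x : glue_conn D1 D2 (inl u) x -> x = inl u \/ x = inl v.
  suff h x' y : glue_conn D1 D2 x' y -> x' = inl u \/ x' = inl v ->
    y = inl u \/ y = inl v.
    by move/h; apply; left.
  move: x' y; apply: connect_le => [//|x' y w h1 h2 /h1/h2//|x' y].
  case/glue_edgeP=> b; last by case: b => -[] ? [].
  by case=> /hc ->; rewrite -/u -/v ?e ?e'; auto.
have auv : (a == u) || (a == v) <-> glue_conn D1 D2 (inl u) (inl a).
  by rewrite cn ED.
have sy := conn_sym m1 m2.
case E: ((a == u) || (a == v)).
  move/auv in E; split=> [zk|[c]].
    exists u; left; rewrite cE; split; first by rewrite sy; exact: E.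
    by rewrite sl1 // eqxx.
  rewrite !cE => -[] [cc].
    have /inner[/hc->|/hc->] := conn_trans E cc;
      rewrite sl1 // -/u -/v ?eqxx ?orbT //.
  have := inner _ (conn_trans E cc); case: (c) => -[] ? [] //.
have out c : glue_conn D1 D2 (inl a) (glue_left c) ->
  ((c == u) || (c == v)) = false.
  move=> cc; apply/negbTE/negP => cuv; move/negP: E; apply.
  apply/auv; apply: (@conn_trans D1 D2 (glue_left c)); last by rewrite sy.
  by case/orP: cuv => /eqP->; [apply: connect0 | rewrite cn ED eqxx orbT].
rewrite le; split=> -[c [[cc lk]|[cc lk]]]; exists c; rewrite ?cE in cc *; auto.
  by left; rewrite sl1 // out.
by left; rewrite sl1 // out in lk.
Qed.

Lemma glued_gen_act h D1 D2 D : h.+1 < N -> matched D1 -> matched D2 ->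
  matched D ->
  glued D1 D2 D -> glued (gen_act false h D1) D2 (gen_act false h D).
Proof.
move=> lt m1 m2 m gl; rewrite !gen_actE.
have uv : (false, Ordinal (ltnW lt)) <> (false, Ordinal lt) :> node N.
  by apply: neq_node => -[]; lia.
have zN : h.+1 <= N by apply: ltnW.
have [e|/eqP ne] := eqVneq (partner D1 (false, Ordinal (ltnW lt)))
  (false, Ordinal lt).
  exact: glued_surg_loop.
exact: glued_surg_apart.
Qed.

(** Surgery on the left factor is the same surgery on the product, so that a
    letter can be moved out of the left factor. *)
Lemma diagram_mul_word w v : valid N w ->
  diagram_mul (word_act w (diagram_id N)) (word_act v (diagram_id N)) =
  word_act (w ++ v) (diagram_id N).
Proof.
move=> vw; have gw u : admissible (word_act u (diagram_id N)) by apply: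
  word_act_admissible; apply: admissible_id.
apply: glued_mul; first by have [] := gw (w ++ v).
rewrite word_act_cat; elim: w vw => [_|h w IH /andP[lt vw]] /=.
  by apply: glued_id; apply: gw.
by apply: glued_gen_act => //; [have [] := gw w | have [] := gw v |
  rewrite -word_act_cat; have [] := gw (w ++ v) | apply: IH].
Qed.

Lemma diagram_A_word h : h.+1 < N ->
  diagram_A N h.+1 = word_act [:: h] (diagram_id N).
Proof.
move=> lt; rewrite /= gen_actE.
have zN : h.+1 <= N by apply: ltnW.
have insS (k : nat) (i : 'I_N) (ltk : k < N) : insubd i k = Ordinal ltk.
  by apply: val_inj; rewrite val_insubd ltk.
apply: diagram_ext => -[b [i lti]]; rewrite ?partner_surgery ?slab_surgery //
  /splice /splice_lab
  ?partner_id ?slab_id /flip ?xpair_eqE -?val_eqE.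
  rewrite /partner ffunE /absn /= !eqSS; have [ei|n1] := eqVneq i h.
    subst i; have E : Ordinal lti = Ordinal (ltnW lt) by exact: val_inj.
    by rewrite insS; case: b => //=; rewrite ?andbF ?(ltn_eqF (ltnSn h)) //.
  have [ei|n2] := eqVneq i h.+1.
    subst i; have E : Ordinal lti = Ordinal lt by exact: val_inj.
    rewrite (insS _ _ (ltnW lt)); case: b => //=; rewrite ?andbF //=.
  by rewrite !andbF /=.
rewrite /slab /lab ffunE /absn /= !eqSS; have [ei|n1] := eqVneq i h.
  by rewrite inordK ?ltnS // ei; case: b => //=; lia.
have [ei|n2] := eqVneq i h.+1.
  by rewrite inordK ?ltnS // ei; case: b => //=; lia.
by rewrite !andbF /= inordK.
Qed.

End Glue.

(** * Codes of permutations *)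

Lemma code_word_flatten (c : nat -> nat) n :
  code_word c n = flatten [seq run i (c i) | i <- iota 0 n].
Proof.
elim: n => //= n ->;
  rewrite -[RHS]/(flatten (map (fun i => run i (c i)) (iota 0 n.+1))).
by rewrite -[in RHS]addn1 iotaD map_cat flatten_cat /= add0n cats0.
Qed.

Lemma big_run (T : Type) (op : T -> T -> T) (idx : T) (g : nat -> T)
  (n c : nat) :
  c <= n -> \big[op/idx]_(j < c) g (n - j)
    = foldr (fun h => op (g h.+1)) idx (run n c).
Proof.
move=> le; rewrite -(big_mkord xpredT (fun j => g (n - j))) /index_iota subn0
  unlock /run.
rewrite /reducebig.
have : all (fun j => j < n) (iota 0 c) by apply/allP => j; rewrite mem_iota;
  lia.
elim: (iota 0 c) => //= j s IH /andP[lt al].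
by rewrite IH //= subnSK.
Qed.

Section Codes.
Variable N : nat.
Implicit Type s : 'S_N.

Definition lehmer s (k : nat) : nat :=
  if insub k is Some i then perm_code s i else 0.

Lemma lehmerE s (i : 'I_N) : lehmer s i = perm_code s i.
Proof. by rewrite /lehmer valK. Qed.

Lemma perm_code_le s (i : 'I_N) : perm_code s i <= i.
Proof.
rewrite /perm_code cardE -(size_map val) -[X in _ <= X](size_iota 0).
apply: uniq_leq_size; first by rewrite map_inj_uniq ?enum_uniq //;
  apply: val_inj.
by move=> x /mapP[k + ->]; rewrite mem_enum inE mem_iota add0n => /andP[].
Qed.

Lemma lehmer_bounded s : bounded (lehmer s).
Proof. by move=> k; rewrite /lehmer; case: insubP => // i _ <-;
  apply: perm_code_le. Qed.

Definition perm_word s : seq nat := code_word (lehmer s) N.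

Lemma valid_perm_word s : valid N (perm_word s).
Proof. exact/valid_code_word/lehmer_bounded. Qed.

Lemma perm_prod_blocks (T : Type) (op : T -> T -> T) (idx : T) (g : nat -> T) s
  :
  perm_prod op idx g s =
  foldr (fun i => op (foldr (fun h => op (g h.+1)) idx (run i (lehmer s i))))
    idx (iota 0 N).
Proof.
rewrite /perm_prod.
rewrite (eq_bigr (fun i : 'I_N => foldr (fun h => op (g h.+1)) idx
  (run i (lehmer s i)))).
  rewrite -(big_mkord xpredT (fun i => foldr (fun h => op (g h.+1)) idx
    (run i (lehmer s i)))).
  by rewrite /index_iota subn0 unlock.
by move=> i _; rewrite lehmerE big_run // perm_code_le.
Qed.

Lemma diagram_perm_word s : diagram_perm s
  = word_act (perm_word s) (diagram_id N).
Proof.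
rewrite /diagram_perm perm_prod_blocks /perm_word code_word_flatten.
have all_lt : all (fun i => i < N) (iota 0 N) by apply/allP => i;
  rewrite mem_iota.
elim: (iota 0 N) all_lt => //= i l IH /andP[lt al]; rewrite {}IH //.
have vb : valid N (run i (lehmer s i)).
  exact: validW lt (valid_run (lehmer_bounded s i)).
suff -> : foldr (fun h => diagram_mul (diagram_A N h.+1)) (diagram_id N)
    (run i (lehmer s i)) = word_act (run i (lehmer s i)) (diagram_id N).
  exact: diagram_mul_word.
elim: (run _ _) vb => //= h w IHw /andP[lth vw]; rewrite {}IHw //.
by rewrite diagram_A_word // diagram_mul_word // /valid /= lth.
Qed.

Lemma okada_perm_word (K : fieldType) (X : (N.-1).-tuple K)
  (Y : (N.-2).-tuple K) s :
  okada_perm X Y s = okada_word X Y (perm_word s).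
Proof.
rewrite /okada_perm perm_prod_blocks /perm_word code_word_flatten /okada_word.
elim: (iota 0 N) => /= [|i l ->]; first by rewrite big_nil.
rewrite big_cat; congr (_ * _)%R.
by elim: (run _ _) => /= [|h w ->]; rewrite ?big_nil ?big_cons.
Qed.

(** The code at i counts the earlier k whose value under the inverse is larger.
    These k form a final segment for the order of values, which is known by
    induction, and a final segment is determined by its size. *)
Lemma perm_code_order (s s' : 'S_N) :
  (forall i, perm_code s i = perm_code s' i) ->
  forall i k : 'I_N, k < i -> ((s^-1)%g i < (s^-1)%g k)
    = ((s'^-1)%g i < (s'^-1)%g k).
Proof.
move=> e i; have [n] := ubnP i; elim: n i => // n IH i lti.
set t := (s^-1)%g; set t' := (s'^-1)%g.
have ord (x y : 'I_N) : x < i -> y < i -> (t x < t y) = (t' x < t' y).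
  have lt_of (x' y' : 'I_N) : y' < x' -> x' < i ->
    (t x' < t y') = (t' x' < t' y').
    by move=> ? ?; apply: IH => //; lia.
  move=> xi yi; case: (ltngtP x y) => [xy|yx|/val_inj->]; last by rewrite !ltnn.
    have := lt_of y x xy yi.
    have ne : t x != t y by rewrite (inj_eq perm_inj) -val_eqE neq_ltn xy.
    have ne' : t' x != t' y by rewrite (inj_eq perm_inj) -val_eqE neq_ltn xy.
    by move: ne ne'; rewrite -!val_eqE /=; lia.
  exact: lt_of.
pose S := [set k : 'I_N | (k < i) && (t i < t k)].
pose S' := [set k : 'I_N | (k < i) && (t' i < t' k)].
have cS : #|S| = #|S'| := e i.
suff eS : S = S' by move=> k ki; have /setP/(_ k) := eS; rewrite !inE ki.
(* both sets are final segments for the same order *)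
have : (S \subset S') || (S' \subset S).
  rewrite -[_ || _]negbK negb_or; apply/negP =>
    /andP[/subsetPn[x + xn] /subsetPn[y + yn]].
  rewrite !inE in xn yn *; move=> /andP[xi tx] /andP[yi ty].
  move: xn yn; rewrite xi yi /= -!leqNgt => tx' ty'.
  have := ord x y xi yi; have := ord y x yi xi; lia.
case/orP=> sub; apply/eqP; first by rewrite eqEcard sub cS leqnn.
by rewrite eq_sym eqEcard sub cS leqnn.
Qed.

Lemma perm_code_inj (s s' : 'S_N) : (forall i, perm_code s i = perm_code s' i)
  -> s = s'.
Proof.
move=> /perm_code_order lt.
have ord (x y : 'I_N) : ((s^-1)%g x < (s^-1)%g y) = ((s'^-1)%g x < (s'^-1)%g y).
  case: (ltngtP x y) => [xy|yx|/val_inj->]; last by rewrite !ltnn.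
    have := lt y x xy.
    have ne : (s^-1)%g x != (s^-1)%g y by rewrite (inj_eq perm_inj) -val_eqE
      neq_ltn xy.
    have ne' : (s'^-1)%g x != (s'^-1)%g y by rewrite (inj_eq perm_inj) -val_eqE
      neq_ltn xy.
    by move: ne ne'; rewrite -!val_eqE /=; lia.
  exact: lt.
have rank (t : 'S_N) x : #|[set y : 'I_N | t y < t x]| = t x.
  rewrite -[RHS](size_iota 0) -(card_imset _ (@perm_inj _ t)).
  have -> : [set t y | y in [set y : 'I_N | t y < t x]]
    = [set z : 'I_N | z < t x].
    apply/setP=> z; rewrite inE; apply/imsetP/idP => [[y + ->]|lz];
      first by rewrite inE.
    by exists ((t^-1)%g z); rewrite ?inE ?permKV.
  rewrite cardE -(size_map val); apply/perm_size/uniq_perm.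
  - by rewrite map_inj_uniq ?enum_uniq //; apply: val_inj.
  - exact: iota_uniq.
  move=> z; rewrite mem_iota add0n; apply/mapP/idP => [[y + ->]|lz].
    by rewrite mem_enum inE.
  by exists (Ordinal (ltn_trans lz (ltn_ord _))); rewrite ?mem_enum ?inE.
apply: invg_inj; apply/permP => x; apply: ord_inj;
  rewrite -[LHS]rank -[RHS]rank.
by apply: eq_card => y; rewrite !inE ord.
Qed.

(** A permutation is determined by its code, and there are as many codes as
    permutations. *)
Lemma code_perm c : bounded c -> exists s, forall k, k < N -> lehmer s k = c k.
Proof.
move=> cb.
pose code s : {dffun forall i : 'I_N, 'I_i.+1} :=
  [ffun i => inord (perm_code s i)].
have codeE s i : code s i = perm_code s i :> nat.
  by rewrite ffunE inordK // ltnS perm_code_le.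
have code_inj : injective code.
  by move=> s s' e; apply: perm_code_inj => i; rewrite -!codeE e.
have le : #|{: {dffun forall i : 'I_N, 'I_i.+1}}| <= #|{: 'S_N}|.
  have -> : #|{: 'S_N}| = N`! by exact: card_Sn.
  rewrite card_dep_ffun foldrE big_map big_enum /=.
  rewrite (eq_bigr (fun i : 'I_N => i.+1)) => [|i _]; last by rewrite card_ord.
  by rewrite fact_prod big_add1 /= big_mkord.
have [d _ dK] := inj_card_bij code_inj le.
pose e : {dffun forall i : 'I_N, 'I_i.+1} := [ffun i : 'I_N => inord (c i)].
exists (d e) => k lt.
by rewrite (lehmerE _ (Ordinal lt)) -codeE dK ffunE inordK // ltnS; apply: cb.
Qed.

End Codes.

(** * The bijection between permutations and diagrams; mirror images *)

Section Bijection.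
Variable N : nat.
Implicit Types (s : 'S_N) (D : diagram N).
Local Notation idN := (diagram_id N).

Lemma diagram_perm_okada s : is_okada (diagram_perm s).
Proof.
rewrite diagram_perm_word; apply/(drawn_okada (drawn_code (lehmer_bounded s))).
exact/code_line_okada/lehmer_bounded.
Qed.

Lemma diagram_perm_inj : injective (@diagram_perm N).
Proof.
move=> s s'; rewrite !diagram_perm_word => e; apply: perm_code_inj => i.
rewrite -!lehmerE; apply: code_line_inj (ltn_ord i); try exact: lehmer_bounded.
have := drawn_code (n := N) (lehmer_bounded s); rewrite e => r.
exact: drawn_agree r (drawn_code (lehmer_bounded s')).
Qed.

Lemma diagram_perm_surj D : is_okada D -> exists s, diagram_perm s = D.
Proof.
have [f [l r]] := drawn_exists D; move/(drawn_okada r)/code_line_surj =>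
  [c [cb e]].
have [s es] := code_perm N cb; exists s.
rewrite diagram_perm_word /perm_word (eq_code_word es).
exact: drawn_inj (drawn_code cb) (agree_drawn e r).
Qed.

Lemma level_perm s j : level (diagram_perm s) j
  = (count_mem j (perm_word s)).*2.
Proof. by rewrite diagram_perm_word level_code_word //;
  apply: lehmer_bounded. Qed.

Lemma normal_form_perm w : valid N w -> exists s m,
  reduces N w m (perm_word s) /\ diagram_perm s = word_act w idN.
Proof.
move=> vw; have [c [m [cb r]]] := normal_form (leqnn N) vw.
have [s es] := code_perm N cb; exists s, m.
rewrite diagram_perm_word /perm_word (eq_code_word es); split=> //.
by rewrite (reduces_word_act r) //; apply: admissible_id.
Qed.

Lemma reduces_level w m s j : reduces N w m (perm_word s) ->
  (count_mem j w).*2 = (count_mem (false, j) m + ydeg m j).*2 + level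
    (word_act w idN) j.
Proof.
move=> r; rewrite (reduces_count r) doubleD -level_perm diagram_perm_word.
by rewrite (reduces_word_act r) //; apply: admissible_id.
Qed.

(** Closing a loop at a letter does not change the crossings at its level. *)
Lemma level_loop h j D : h.+1 < N -> admissible D -> loop h j D ->
  level (gen_act false h D) h = level D h.
Proof.
move=> lt [m le]; rewrite loopE => /andP[/eqP e _].
set u := (false, Ordinal (ltnW lt)) in e *; set v := (false, Ordinal lt) in e *.
have [fu ffu lu] := m u; rewrite e in ffu lu.
apply: eq_bigr => a _; congr nat_of_bool.
rewrite gen_actE slab_surgery; last exact: ltnW.
rewrite /splice_lab -/u -/v e ffu.
have le1 := le u; rewrite /absn /= in le1.
case: eqP => [->|_] /=; first by rewrite /absn /= ltnn !andbF.
case: eqP => [->|_] //=.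
by rewrite lu /absn /= le1 !leqnn.
Qed.

(** A word without superfluous letters closes no loop, since the letter that
    closes the loop would not raise the number of crossings at its level. *)
Lemma reduced_loops w : valid N w ->
  (forall j, (count_mem j w).*2 = level (word_act w idN) j) ->
  forall j, loops j w idN = 0.
Proof.
elim: w => //= h v IH /andP[lt vv] rd j.
have gv : admissible (word_act v idN) by apply: word_act_admissible;
  apply: admissible_id.
have [t [m [r et]]] := normal_form_perm vv.
have vht : valid N (h :: perm_word t) by rewrite /valid /= lt;
  apply: valid_perm_word.
have [s [m' [r' es]]] := normal_form_perm vht.
have ev : word_act (perm_word t) idN
  = word_act v idN by rewrite -et diagram_perm_word.
rewrite IH // => [|i].
  case E: (loop _ _ _) => //=; have := rd h; rewrite (level_loop lt gv E).
  by have := reduces_level h r; rewrite /= eqxx; lia.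
have := reduces_level i r; have := reduces_level i r'; have := rd i.
have := level_perm t i; rewrite et /= ev; lia.
Qed.

Lemma perm_word_loops s j : loops j (perm_word s) idN = 0.
Proof.
apply: reduced_loops; first exact: valid_perm_word.
by move=> i; rewrite -diagram_perm_word level_perm.
Qed.

Lemma flipK : involutive (@flip N).
Proof. by case=> b i; rewrite /flip /= negbK. Qed.

Lemma partner_mirror D a : partner (mirror D) a = flip (partner D (flip a)).
Proof. by rewrite {1}/partner ffunE. Qed.

Lemma slab_mirror D a : slab (mirror D) a = slab D (flip a).
Proof. by rewrite /slab {1}/lab ffunE. Qed.

Lemma mirror_id : mirror idN = idN.
Proof.
apply: diagram_ext => a; first by rewrite partner_mirror !partner_id !flipK.
by rewrite slab_mirror !slab_id.
Qed.

Lemma mirrorK D : mirror (mirror D) = D.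
Proof.
apply: diagram_ext => a; first by rewrite !partner_mirror !flipK.
by rewrite !slab_mirror flipK.
Qed.

Lemma mirror_act b h D : mirror (gen_act b h D) = gen_act (~~ b) h (mirror D).
Proof.
case lt: (h.+1 < N); last by rewrite !gen_act_invalid.
have feq (a c : node N) : (flip a == c) = (a == flip c).
  by rewrite -(inj_eq (can_inj flipK)) flipK.
rewrite !gen_actE; apply: diagram_ext => a.
  rewrite partner_mirror !partner_surgery /splice !feq /= !partner_mirror /=.
  rewrite /flip /= !negbK -/(flip _).
  by do ! case: ifP => //=.
rewrite slab_mirror !slab_surgery; try exact: ltnW.
by rewrite /splice_lab !feq !partner_mirror !slab_mirror /flip /= !negbK.
Qed.

(** A generator acts on the identity in the same way from both sides, so its
    letters can be moved across one by one. *)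
Lemma mirror_word_act w : valid N w ->
  mirror (word_act w idN) = word_act (rev w) idN.
Proof.
elim: w => [|h w IH] /=; first by rewrite mirror_id.
move=> /andP[lt vw]; rewrite mirror_act IH // rev_cons -cats1 word_act_cat /=.
by rewrite gen_act_id // word_act_right //;
  [apply: admissible_id | rewrite /valid all_rev].
Qed.

Lemma level_mirror D j : level (mirror D) j = level D j.
Proof.
rewrite /level (reindex_inj (can_inj flipK)); apply: eq_bigr => a _ /=.
by rewrite slab_mirror flipK.
Qed.

Lemma mirror_perm s : exists s', diagram_perm s' = mirror (diagram_perm s).
Proof.
have [|s' [m [_ e]]] := @normal_form_perm (rev (perm_word s)).
  by rewrite /valid all_rev; apply: valid_perm_word.
by exists s'; rewrite e diagram_perm_word mirror_word_act ?valid_perm_word.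
Qed.

Lemma mirror_okada D : is_okada D -> is_okada (mirror D).
Proof.
case/diagram_perm_surj => s <-; have [s' <-] := mirror_perm s.
exact: diagram_perm_okada.
Qed.

(** Mirror images have the same crossings, and crossings count the letters of
    the word of a code: no letter is lost, and the monomial is empty. *)
Lemma reduces_rev s s' : diagram_perm s' = mirror (diagram_perm s) ->
  reduces N (rev (perm_word s)) [::] (perm_word s').
Proof.
move=> e; have vs : valid N (rev (perm_word s)) by rewrite /valid all_rev;
  apply: valid_perm_word.
have [t [m [r et]]] := normal_form_perm vs.
have {}et : t = s'.
  by apply: diagram_perm_inj; rewrite et e diagram_perm_word mirror_word_act
    ?valid_perm_word.
subst t; suff -> : [::] = m by [].
have zero j : count_mem (false, j) m + ydeg m j = 0.
  have := reduces_level j r; rewrite count_rev -mirror_word_act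
    ?valid_perm_word //.
  by rewrite -diagram_perm_word level_mirror level_perm; lia.
apply/esym/perm_nilP; rewrite perm_sym; apply: monomial_ext => j.
  by have := zero j; rewrite /=; lia.
by have := zero j; rewrite /ydeg; case: (j) => [|i] /=; lia.
Qed.
End Bijection.

(** * Linear independence *)

Section Representation.
Local Open Scope ring_scope.
Variables (K : fieldType) (N : nat).
Variables (X : (N.-1).-tuple K) (Y : (N.-2).-tuple K).
Implicit Types (s t : 'S_N).

Lemma reduces_perm_word_uniq w m m' s s' :
  reduces N w m (perm_word s) -> reduces N w m' (perm_word s') -> s = s' /\
    monom X Y m = monom X Y m'.
Proof.
move=> r r'; have e : s = s'.
  apply: diagram_perm_inj; rewrite !diagram_perm_word.
  by rewrite -(reduces_word_act r) ?(reduces_word_act r') //;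
    apply: admissible_id.
by subst s'; split=> //; apply/perm_big/(reduces_uniq r r').
Qed.

Lemma ltn_gen (h : 'I_N.-1) : (h.+1 < N)%N.
Proof. by have := ltn_ord h; lia. Qed.

Lemma step_exists (h : 'I_N.-1) s : exists tm : 'S_N * seq (bool * nat),
  reduces N (nat_of_ord h :: perm_word s) tm.2 (perm_word tm.1).
Proof.
have [|t [m [r _]]] := @normal_form_perm N (nat_of_ord h :: perm_word s).
  by rewrite /valid /= ltn_gen; apply: valid_perm_word.
by exists (t, m).
Qed.

(** The action of a letter on the permutations and its monomial coefficient,
    chosen among the normal forms; they are unique. *)
Definition step h s := sval (cid (step_exists h s)).
Lemma stepP h s : reduces N (nat_of_ord h :: perm_word s) (step h s).2
  (perm_word (step h s).1).
Proof. exact: svalP (cid (step_exists h s)). Qed.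

Local Notation n := #|{: 'S_N}|.
(** The additional index 0 makes the matrix algebra nontrivial by its very
    type. *)
Definition perm_index s : 'I_n.+1 := lift ord0 (enum_rank s).
Lemma perm_index_inj : injective perm_index.
Proof. by move=> s t /lift_inj/enum_rank_inj. Qed.

Definition monomial_mx (f : 'S_N -> 'S_N) (c : 'S_N -> K) : 'M[K]_n.+1 :=
  \sum_s c s *: delta_mx (perm_index (f s)) (perm_index s).

Lemma monomial_mxM f c g d :
  monomial_mx f c * monomial_mx g d = monomial_mx (f \o g)
    (fun s => c (g s) * d s).
Proof.
rewrite /monomial_mx mulr_sumr; apply: eq_bigr => s _.
rewrite mulr_suml (bigD1 (g s)) //= big1 ?addr0 => [|t ne].
  by rewrite -scalerAl -scalerAr scalerA -[delta_mx _ _ * _]/(_ *m _)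
    mul_delta_mx.
rewrite -scalerAl -scalerAr -[delta_mx _ _ * _]/(_ *m _) mul_delta_mx_0
  ?scaler0 //.
by rewrite (inj_eq perm_index_inj).
Qed.

Lemma eq_monomial_mx f c g d : f =1 g -> c =1 d ->
  monomial_mx f c = monomial_mx g d.
Proof. by move=> ef ec; apply: eq_bigr => s _; rewrite ef ec. Qed.

Lemma monomial_mxZ x f c : x *: monomial_mx f c
  = monomial_mx f (fun s => x * c s).
Proof. by rewrite scaler_sumr; apply: eq_bigr => s _; rewrite scalerA. Qed.

Definition gen_mx h := monomial_mx (fun s => (step h s).1)
  (fun s => monom X Y (step h s).2).

(** Both sides of a relation, applied to a permutation, are coefficients of
    reductions of the same word, so that they agree. *)
Lemma gen_mx_rels : okada_rels X Y gen_mx.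
Proof.
have two (h h' : 'I_N.-1) s : reduces N
  ([:: nat_of_ord h; nat_of_ord h'] ++ perm_word s)
    ((step h' s).2 ++ (step h (step h' s).1).2)
      (perm_word (step h (step h' s).1).1).
  apply: reduces_trans (stepP h _).
  exact: (reduces_catl [:: nat_of_ord h] (stepP h' s)).
split=> [h|h h' hh'|h h' e].
- rewrite monomial_mxM monomial_mxZ.
  have key s : _ := reduces_perm_word_uniq (two h h s)
    (reduces_trans (reduces_catr (perm_word s) (reduces_sqr (ltn_gen h)))
      (stepP h s)).
  apply: eq_monomial_mx => s /=; have [e1 e2] := key s; first exact: e1.
  move: e2; rewrite !monom_cat mulrC => ->.
  by rewrite /monom big_cons big_nil mulr1.
- rewrite !monomial_mxM.
  have fr : far h h' by rewrite /far hh'.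
  have key s : _ := reduces_perm_word_uniq (two h h' s)
    (reduces_trans (reduces_catr (perm_word s)
      (reduces_comm (ltn_gen h) (ltn_gen h') fr)) (two h' h s)).
  apply: eq_monomial_mx => s /=; have [e1 e2] := key s; first exact: e1.
  by move: e2; rewrite !monom_cat [monom _ _ [::]]big_nil mul1r mulrC => ->;
    rewrite mulrC.
rewrite !monomial_mxM monomial_mxZ.
have lt : (h.+2 < N)%N by have := ltn_gen h'; rewrite e.
have three s : reduces N ([:: nat_of_ord h'; nat_of_ord h; nat_of_ord h'] ++
  perm_word s)
   (((step h' s).2 ++ (step h (step h' s).1).2) ++
     (step h' (step h (step h' s).1).1).2)
   (perm_word (step h' (step h (step h' s).1).1).1).
  apply: reduces_trans (stepP h' _).
  exact: (reduces_catl [:: nat_of_ord h'] (two h h' s)).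
have rb s : reduces N ([:: nat_of_ord h'; nat_of_ord h; nat_of_ord h'] ++
  perm_word s)
    ([:: (true, nat_of_ord h)] ++ (step h' s).2) (perm_word (step h' s).1).
  apply: reduces_trans (stepP h' s); rewrite e.
  exact: reduces_catr (reduces_braid lt).
apply: eq_monomial_mx => s /=; have [e1 e2] := reduces_perm_word_uniq (three s)
  (rb s) => //.
move: e2; rewrite !monom_cat => e2.
rewrite -[Y`_h](_ : monom X Y [:: (true, nat_of_ord h)] = _) -?e2; last first.
  by rewrite /monom big_cons big_nil mulr1.
by rewrite mulrC -mulrA [RHS]mulrC mulrC; congr (_ * _); rewrite mulrC.
Qed.

Let mx_rep (x : okada X Y) := okada_lift gen_mx x.

Lemma mx_rep_word w s : valid N w ->
  exists t m, reduces N (w ++ perm_word s) m (perm_word t) /\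
  mx_rep (okada_word X Y w) *m delta_mx (perm_index s) (ord0 : 'I_1) =
  monom X Y m *: delta_mx (perm_index t) (ord0 : 'I_1).
Proof.
have rr := gen_mx_rels.
elim: w => [_|h w IH /andP[lt vw]].
  exists s, [::]; split; first exact: reduces_refl.
  by rewrite /okada_word /monom !big_nil /mx_rep okada_lift1 // mul1mx scale1r.
have [t [m [r e]]] := IH vw.
have lt' : (h < N.-1)%N by lia.
pose h' := Ordinal lt'.
exists (step h' t).1, (m ++ (step h' t).2); split.
  by apply: reduces_trans (stepP h' t); apply: (reduces_catl [:: h] r).
rewrite /okada_word big_cons /mx_rep okada_liftM // (okada_E_gen _ _ lt')
  okada_lift_gen //.
rewrite -[_ * _]/(_ *m _) -mulmxA e -scalemxAr /gen_mx /monomial_mx mulmx_suml.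
rewrite (bigD1 t) //= big1 ?addr0 => [|u ne].
  by rewrite -scalemxAl mul_delta_mx scalerA monom_cat.
by rewrite -scalemxAl mul_delta_mx_0 ?scaler0 // (inj_eq perm_index_inj).
Qed.

(** The representation sends each E_s to a matrix that maps the basis vector of
    the identity to the one of s. *)
Lemma okada_perm_free (f : 'S_N -> K) :
  \sum_s f s *: okada_perm X Y s = 0 -> forall s, f s = 0.
Proof.
have rr := gen_mx_rels.
have [s0 e0] := @code_perm N (fun=> 0%N) (fun=> isT).
have pw0 : perm_word s0 = [::] by rewrite /perm_word (eq_code_word e0);
  elim: (N) => //= k ->.
have rep_perm s : mx_rep (okada_perm X Y s) *m delta_mx (perm_index s0)
  (ord0 : 'I_1) = delta_mx (perm_index s) ord0.
  rewrite okada_perm_word; have [t [m [r ->]]] := mx_rep_word s0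
    (valid_perm_word s).
  rewrite pw0 cats0 in r.
  have [<- <-] := reduces_perm_word_uniq (reduces_refl _ _) r.
  by rewrite /monom big_nil scale1r.
move=> /(congr1 mx_rep) e s.
have repD x y : mx_rep (x + y) = mx_rep x + mx_rep y by apply: okada_liftD.
have repZ c x : mx_rep (c *: x) = c *: mx_rep x by apply: okada_liftZ.
have rep0 : mx_rep 0 = 0 by rewrite -(scale0r 1) repZ scale0r.
have rep_sum (r : seq 'S_N) : mx_rep (\sum_(s <- r) f s *: okada_perm X Y s) =
    \sum_(s <- r) f s *: mx_rep (okada_perm X Y s).
  elim: r => [|u r IH]; first by rewrite !big_nil.
  by rewrite !big_cons repD repZ IH.
move: e; rewrite rep_sum rep0 => /(congr1
  (mulmx^~ (delta_mx (perm_index s0) (ord0 : 'I_1)))) /=.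
rewrite mul0mx mulmx_suml => /matrixP/(_ (perm_index s) ord0).
rewrite summxE (bigD1 s) //= big1 ?addr0 => [|t ne].
  by rewrite -scalemxAl rep_perm !mxE !eqxx mulr1.
by rewrite -scalemxAl rep_perm !mxE (inj_eq perm_index_inj) eq_sym (negbTE ne)
  mulr0.
Qed.

Lemma okada_word_perm w : valid N w -> exists s c,
  diagram_perm s = word_act w (diagram_id N) /\
    okada_word X Y w = c *: okada_perm X Y s.
Proof.
move=> /normal_form_perm[s [m [r e]]]; exists s, (monom X Y m); split=> //.
by rewrite (reduces_okada X Y r) okada_perm_word.
Qed.
End Representation.

(** * The involution and the spanning property *)

Section Involution.
Local Open Scope ring_scope.
Variables (K : fieldType) (N : nat).
Variables (X : (N.-1).-tuple K) (Y : (N.-2).-tuple K).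
Implicit Type s : 'S_N.
Local Notation term := (okada_term K N.-1).
Local Notation O := (okada X Y).

Lemma okada_basis_perm s : okada_basis X Y (diagram_perm s) = okada_perm X Y s.
Proof.
rewrite /okada_basis; case: pickP => [t /eqP/diagram_perm_inj-> //|/(_ s)].
by rewrite eqxx.
Qed.

(** The relations are symmetric under reversal of products, so that reversal
    is an anti-automorphism. *)
Fixpoint rev_term (t : term) : term :=
  match t with
  | OAdd t u => OAdd (rev_term t) (rev_term u)
  | OMul t u => OMul (rev_term u) (rev_term t)
  | t => t
  end.

Lemma rev_cong t u : okada_cong X Y t u ->
  okada_cong X Y (rev_term t) (rev_term u).
Proof.
elim=> {t u} /=.
- by move=> t; apply: ocong_refl.
- by move=> t u _; apply: ocong_sym.
- by move=> t u v _ h _; apply: ocong_trans h.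
- by move=> t t' u u' _ h _; apply: ocong_add.
- by move=> t t' u u' _ h _ h'; apply: ocong_mul.
- by move=> a b; apply: ocong_scalD.
- by move=> a b; rewrite mulrC; apply: ocong_scalM.
- by move=> a t; apply/ocong_sym/ocong_scalC.
- by move=> t u v; apply: ocong_addA.
- by move=> t u; apply: ocong_addC.
- by move=> t; apply: ocong_add0.
- by move=> t u v; apply/ocong_sym/ocong_mulA.
- by move=> t; apply: ocong_trans (ocong_mul1 _ _ _);
  apply/ocong_sym/ocong_scalC.
- by move=> t; apply: ocong_trans (ocong_mul0 _ _ _);
  apply/ocong_sym/ocong_scalC.
- by move=> t u v; apply: ocong_mulDr.
- by move=> t u v; apply: ocong_mulDl.
- by move=> i; apply: ocong_trans (ocong_scalC _ _ _ _); apply: ocong_sqr.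
- by move=> i j ij; apply/ocong_sym/ocong_comm.
- move=> i j ij; apply: ocong_trans (ocong_scalC _ _ _ _).
  by apply: ocong_trans (ocong_braid _ _ ij); apply: ocong_mulA.
Qed.

Definition okada_rev (x : O) : O := okada_pi X Y (rev_term (repr x)).

Lemma okada_rev_pi t : okada_rev (okada_pi X Y t) = okada_pi X Y (rev_term t).
Proof. exact/okada_piP/rev_cong/okada_repr_pi. Qed.

Lemma okada_revM x y : okada_rev (x * y) = okada_rev y * okada_rev x.
Proof.
elim/okada_ind: x => t; elim/okada_ind: y => u.
by rewrite -okada_piM !okada_rev_pi /= okada_piM.
Qed.

Lemma okada_revD x y : okada_rev (x + y) = okada_rev x + okada_rev y.
Proof.
elim/okada_ind: x => t; elim/okada_ind: y => u.
by rewrite -okada_piD !okada_rev_pi /= okada_piD.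
Qed.

Lemma okada_rev1 : okada_rev 1 = 1.
Proof. exact: okada_rev_pi. Qed.

Lemma okada_revZ c x : okada_rev (c *: x) = c *: okada_rev x.
Proof.
rewrite !okada_scaleE okada_revM [okada_rev (okada_scalar _ _ _)]okada_rev_pi
  /=.
by rewrite -[okada_pi _ _ _]/(okada_scalar X Y c) -[LHS]/(okada_mul _ _)
  -okada_scalarC.
Qed.

Lemma okada_revK x : okada_rev (okada_rev x) = x.
Proof.
elim/okada_ind: x => t; rewrite !okada_rev_pi; congr okada_pi.
by elim: t => //= t -> u ->.
Qed.

Fact okada_rev_is_linear : linear okada_rev.
Proof. by move=> c x y; rewrite okada_revD okada_revZ. Qed.

HB.instance Definition _ := GRing.isLinear.Build K O O _ okada_rev
  okada_rev_is_linear.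

Lemma okada_rev_word w : valid N w ->
  okada_rev (okada_word X Y w) = okada_word X Y (rev w).
Proof.
elim: w => [|h w IH] /=; first by rewrite /okada_word big_nil okada_rev1.
move=> /andP[lt vw]; rewrite rev_cons -cats1 okada_word_cat -IH //.
rewrite /okada_word big_cons okada_revM big_cons big_nil mulr1; congr (_ * _).
have lt' : (h < N.-1)%N by lia.
by rewrite (okada_E_gen _ _ lt') okada_rev_pi.
Qed.

Lemma okada_rev_basis D : is_okada D ->
  okada_rev (okada_basis X Y D) = okada_basis X Y (mirror D).
Proof.
case/diagram_perm_surj=> s <-; have [s' e] := mirror_perm s.
rewrite -e !okada_basis_perm !okada_perm_word okada_rev_word ?valid_perm_word
  //.
by rewrite (reduces_okada X Y (reduces_rev e)) /monom big_nil scale1r.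
Qed.

Lemma okada_perm_span x : exists f : 'S_N ->
  K, x = \sum_s f s *: okada_perm X Y s.
Proof.
pose S (x : O) := exists f : 'S_N -> K, x = \sum_s f s *: okada_perm X Y s.
have SD x1 x2 : S x1 -> S x2 -> S (x1 + x2).
  move=> [f ->] [g ->]; exists (fun s => f s + g s); rewrite -big_split.
  by apply: eq_bigr => s _; rewrite scalerDl.
have SZ c x1 : S x1 -> S (c *: x1).
  move=> [f ->]; exists (fun s => c * f s); rewrite scaler_sumr.
  by apply: eq_bigr => s _; rewrite scalerA.
have Sp s : S (okada_perm X Y s).
  exists (fun t => (t == s)%:R); rewrite (bigD1 s) //= eqxx scale1r big1 ?addr0
    // => t /negbTE->.
  by rewrite scale0r.
have Ssum (I : Type) (r : seq I) (F : I -> O) : (forall i, S (F i)) ->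
  S (\sum_(i <- r) F i).
  move=> SF; elim: r => [|i r IH]; last by rewrite big_cons; apply: SD.
  by rewrite big_nil -(scale0r (okada_perm X Y 1%g)); apply: SZ.
have Sw w : valid N w -> S (okada_word X Y w).
  by move=> /(okada_word_perm X Y)[s [c [_ ->]]]; apply: SZ.
have SM x1 x2 : S x1 -> S x2 -> S (x1 * x2).
  move=> [f ->] [g ->]; rewrite mulr_suml; apply: (Ssum _ _ _) => s;
    rewrite mulr_sumr.
  apply: (Ssum _ _ _) => t; rewrite -scalerAl -scalerAr; do 2 apply: (SZ _ _).
  rewrite !okada_perm_word -okada_word_cat; apply: Sw.
  by rewrite valid_cat !valid_perm_word.
elim/okada_ind: x => t; rewrite -/(S _);
  elim: t => [i|c|t IHt u IHu|t IHt u IHu].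
- have -> : okada_pi X Y (OGen i) = okada_word X Y [:: nat_of_ord i].
    rewrite /okada_word big_cons big_nil mulr1 (okada_E_gen _ _ (ltn_ord i)).
    by congr (okada_gen _ _ _); apply: val_inj.
  by apply: Sw; rewrite /valid /= ltn_gen.
- rewrite -[okada_pi _ _ _]/(okada_scalar X Y c) okada_scalarE; apply: SZ.
  by have := Sw [::] isT; rewrite /okada_word big_nil.
- by rewrite okada_piD; apply: SD.
- by rewrite okada_piM; apply: SM.
Qed.
End Involution.

(** * Labels of propagating arcs *)

Section Halves.
Variable N : nat.
Implicit Types (D : diagram N) (a b : node N).

(** What a left half remembers about the partner of a node. *)
Definition left_end a : option 'I_N := if a.1 then None else Some a.2.

Lemma left_halfE D i : left_half D i
  = (left_end (partner D (false, i)), lab D (false, i)).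
Proof. by rewrite ffunE. Qed.

Lemma right_halfE D i :
  right_half D i = (left_end (flip (partner D (true, i))), lab D (true, i)).
Proof.
rewrite ffunE partner_mirror /flip /=; congr pair.
by rewrite /lab ffunE.
Qed.

Lemma left_half_eq D1 D2 : left_half D1 = left_half D2 <->
  (forall i, left_end (partner D1 (false, i))
    = left_end (partner D2 (false, i)) /\
             slab D1 (false, i) = slab D2 (false, i)).
Proof.
split=> [e i|e]; first by move/ffunP/(_ i): e;
  rewrite !left_halfE /slab => -[-> ->].
apply/ffunP=> i; rewrite !left_halfE; have [-> e2] := e i.
by congr pair; apply: ord_inj.
Qed.

Lemma right_half_eq D1 D2 : right_half D1 = right_half D2 <->
  (forall i, left_end (flip (partner D1 (true, i)))
    = left_end (flip (partner D2 (true, i))) /\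
             slab D1 (true, i) = slab D2 (true, i)).
Proof.
split=> [e i|e]; first by move/ffunP/(_ i): e;
  rewrite !right_halfE /slab => -[-> ->].
apply/ffunP=> i; rewrite !right_halfE; have [-> e2] := e i.
by congr pair; apply: ord_inj.
Qed.

Lemma left_endP a i : ((false, i) == a) = (left_end a == Some i).
Proof. by case: a => -[] j //; rewrite /left_end /= eq_sym. Qed.

(** Surgery at two left nodes depends on partners only up to identifying all
    right nodes. *)
Lemma left_half_act h D1 D2 : h.+1 < N -> left_half D1 = left_half D2 ->
  left_half (gen_act false h D1) = left_half (gen_act false h D2).
Proof.
move=> lt /left_half_eq e; apply/left_half_eq => i; rewrite !gen_actE.
have [pu lu] := e (Ordinal (ltnW lt)); have [pv lv] := e (Ordinal lt).
have [pi li] := e i.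
rewrite !partner_surgery !slab_surgery; try exact: ltnW.
rewrite /splice /splice_lab !left_endP pu pv lu lv li; split=> //.
by do ! case: ifP => //.
Qed.

Section Line.
Variables (D : diagram N) (f l : nat -> nat).
Hypothesis r : drawn D f l.

Lemma left_end_pos a : (left_end (partner D a) == None) = (N <= f (pos a)).
Proof.
have [<- _] := r a; rewrite /pos /absn; case: (partner D a) => -[] j /=.
  by have := ltn_ord j; rewrite eqxx; lia.
by rewrite leqNgt ltn_ord.
Qed.

Lemma right_end_pos a : (left_end (flip (partner D a)) == None)
  = (f (pos a) < N).
Proof.
rewrite ltnNge -left_end_pos; by case: (partner D a) => -[] j.
Qed.

Lemma mem_prop_lab (x : 'I_N.+1) : (x \in prop_lab (left_half D)) =
  has (fun p => (N <= f p) && (l p == x)) (iota 0 N).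
Proof.
apply/imsetP/hasP => [[i]|[p]].
  rewrite inE left_halfE /= left_end_pos => c ->; exists (i : nat).
    by rewrite mem_iota /= ltn_ord.
  by have [_ <-] := r (false, i); rewrite eqxx andbT.
rewrite mem_iota add0n => lt /andP[c /eqP e]; exists (Ordinal lt).
  by rewrite inE left_halfE /= left_end_pos.
rewrite left_halfE; apply: ord_inj => /=.
by have [_] := r (false, Ordinal lt); rewrite /slab => ->.
Qed.

Lemma mem_prop_lab_right (x : 'I_N.+1) : (x \in prop_lab (right_half D)) =
  has (fun p => (f p < N) && (l p == x)) (iota N N).
Proof.
apply/imsetP/hasP => [[i]|[p]].
  rewrite inE right_halfE /= right_end_pos => c ->; exists (pos (true, i)).
    by rewrite mem_iota pos_lt /pos /absn /=; have := ltn_ord i; lia.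
  by have [_ <-] := r (true, i); rewrite eqxx andbT.
rewrite mem_iota => /andP[ge lt] /andP[c /eqP e].
have lt' : N + N - p.+1 < N by lia.
have ep : pos (true, Ordinal lt') = p by rewrite /pos /absn /=; lia.
exists (Ordinal lt').
  by rewrite inE right_halfE /= right_end_pos ep.
rewrite right_halfE; apply: ord_inj => /=.
by have [_] := r (true, Ordinal lt'); rewrite /slab ep => ->.
Qed.
End Line.

Section Labels.
Variables (f l : nat -> nat).
Hypothesis o : okada_line N f l.

(** Propagating arcs are nested, the first left node being outermost. *)
Lemma prop_increasing p q : p < q -> q < N -> N <= f p -> N <= f q -> l p < l q.
Proof.
have [okl okn] := o => pq qN fp fq.
by have [] := okn p q ltac:(lia) ltac:(lia).
Qed.

Lemma prop_decreasing p q : N <= p -> p < q -> q < N + N -> f p < N ->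
  f q < N -> l q < l p.
Proof.
have [okl okn] := o => Np pq qN fp fq.
have [[a b c d] _] := okl q qN.
by have [_] := okn (f q) p ltac:(lia) ltac:(lia); rewrite d.
Qed.

Lemma prop_label_inj p q : p < N -> q < N -> N <= f p -> N <= f q ->
  l p = l q -> p = q.
Proof.
move=> pN qN fp fq e; case: (ltngtP p q) => // lt.
  by have := prop_increasing lt qN fp fq; lia.
by have := prop_increasing lt pN fq fp; lia.
Qed.

Lemma prop_label_inj_right p q : N <= p < N + N -> N <= q < N + N ->
  f p < N -> f q < N -> l p = l q -> p = q.
Proof.
move=> pN qN fp fq e; case: (ltngtP p q) => // lt.
  by have := @prop_decreasing p q ltac:(lia) lt ltac:(lia) fp fq; lia.
by have := @prop_decreasing q p ltac:(lia) lt ltac:(lia) fq fp; lia.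
Qed.
End Labels.

Lemma prop_lab_sides D : is_okada D ->
  prop_lab (left_half D) = prop_lab (right_half D).
Proof.
have [f [l r]] := drawn_exists D => /(drawn_okada r)[okl _]; apply/setP => x.
rewrite (mem_prop_lab r) (mem_prop_lab_right r).
apply/hasP/hasP => -[p]; rewrite mem_iota => b /andP[c e].
  have [[a1 a2 a3 a4] _] := okl p ltac:(lia).
  exists (f p); first by rewrite mem_iota; lia.
  by rewrite a3 a4 e andbT; lia.
have [[a1 a2 a3 a4] _] := okl p ltac:(lia).
exists (f p); first by rewrite mem_iota; lia.
by rewrite a3 a4 e andbT; lia.
Qed.

Lemma sorted_elts (S : {set 'I_N.+1}) : sorted ltn (elts S).
Proof.
rewrite /elts -[enum _](eq_filter (mem_enum _))
  -(eq_filter (mem_map val_inj _)) -filter_map.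
by rewrite (sorted_filter ltn_trans) // unlock val_ord_enum iota_ltn_sorted.
Qed.

(** The nodes before a propagating arc are matched among themselves except for
    the ends of other propagating arcs; so the parity of the position of an end
    is that of its number among them, and the parity of a label is opposite to
    that of its left end. *)
Lemma prop_lab_fib D : is_okada D -> is_fib (prop_lab (left_half D)).
Proof.
have [f [l r]] := drawn_exists D => /(drawn_okada r) o; have [okl okn] := o.
pose q := [seq p <- iota 0 N | N <= f p].
have qP p : (p \in q) = (p < N) && (N <= f p).
  by rewrite mem_filter mem_iota andbC.
have q_sorted : sorted ltn q.
  by apply: sorted_filter; [apply: ltn_trans | apply: iota_ltn_sorted].
have lN p : p < N -> l p < N.+1.
  by move=> lt; have [_ [_ ? _ _ _]] := okl p ltac:(lia); lia.
have elE : elts (prop_lab (left_half D)) = map l q.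
  apply: (irr_sorted_eq ltn_trans ltnn) => [||x].
  - exact: sorted_elts.
  - apply: (homo_sorted_in (P := mem q) (e := ltn)) q_sorted; last exact/allP.
    move=> y z; rewrite !qP => /andP[y1 y2] /andP[z1 z2] yz.
    exact: (prop_increasing o yz).
  apply/idP/mapP => [/mapP[y + ->]|[p]].
    rewrite mem_enum (mem_prop_lab r) => /hasP[p];
      rewrite mem_iota => b /andP[c /eqP e].
    by exists p => //; rewrite qP c andbT; lia.
  rewrite qP => /andP[p1 p2] ->.
  rewrite -[l p](inordK (lN _ p1)) mem_elts (mem_prop_lab r).
  apply/hasP; exists p; first by rewrite mem_iota.
  by rewrite p2 (inordK (lN _ p1)) eqxx.
have fm p : p < N + N -> [/\ f p < N + N, f p <> p & f (f p) = p] by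
  move=> /okl[[]].
have cr p q' : p < N + N -> p < q' < f p -> p < f q' < f p.
  by move=> lt /(okn _ _ lt)[].
have par p : p <= N -> (p < N -> N <= f p) ->
    odd (count (fun y => N <= f y) (iota 0 p)) = odd p.
  move=> lt esc; rewrite -[in iota 0 p](subn0 p) -[in RHS](subn0 p).
  apply: (count_escaping fm cr); [by [] | exact: lt | by lia |].
  move=> y b; have [f1 f2 f3] := fm y ltac:(lia).
  case: (leqP N (f y)) => [_|fN]; first by rewrite orbT.
  have pN : p < N \/ p = N by lia.
  case: pN => [pN|->]; last by rewrite fN.
  have := esc pN; case: (ltngtP (f y) p) => // [lt'|e] ep.
    by have := cr y p ltac:(lia) ltac:(lia); lia.
  by move: f3; rewrite e; lia.
apply/and3P; split.
- rewrite (mem_prop_lab r); apply/hasPn => p; rewrite mem_iota => b.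
  have [_ [? _ _ _ _]] := okl p ltac:(lia).
  by apply/negP => /andP[_ /eqP /= e]; lia.
- rewrite -size_elts elE size_map size_filter par //; lia.
apply/forallP=> -[i /=]; rewrite -size_elts elE size_map => lti.
rewrite (nth_map 0) //; set p := nth 0 q i.
have : p \in q by apply: mem_nth.
rewrite qP => /andP[p1 p2].
have [_ [_ _ _ lp _]] := okl p ltac:(lia).
rewrite (lp ltac:(lia)) /=.
rewrite -(par p) //; last exact: ltnW.
suff -> : i = count (fun y => N <= f y) (iota 0 p) by [].
rewrite -(index_uniq 0 lti); last by apply/filter_uniq/iota_uniq.
rewrite -/p /q.
have -> : iota 0 N = iota 0 p ++ p :: iota p.+1 (N - p.+1).
  by rewrite -[in LHS](subnKC p1) addSn -addnS iotaD /= add0n.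
rewrite filter_cat /= p2 index_cat mem_filter mem_iota /= ltnn andbF /=.
by rewrite eqxx addn0 size_filter.
Qed.

Lemma prop_labP D : is_okada D -> exists S : fib_set N, prop_lab (left_half D)
  = S.
Proof. by move=> /prop_lab_fib p; exists (FibSet p). Qed.
End Halves.

(** * Dominance *)

Section Dominance.
Variable N : nat.
Implicit Types (D : diagram N) (a b : node N) (S T : {set 'I_N.+1}).

(** Dominance compares these numbers for all k. *)
Definition above S k := #|[set x in S | k <= x]|.

Lemma above_elts S k : above S k = count (leq k) (elts S).
Proof.
rewrite /above cardE /elts count_map -size_filter; apply: perm_size.
apply: uniq_perm; [exact: enum_uniq | exact/filter_uniq/enum_uniq |].
by move=> x; rewrite [in RHS]mem_filter !mem_enum inE andbC.
Qed.

(** If the i-th element of S from the top were larger than that of T, then more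
    elements of S than of T would lie above it. *)
Lemma above_dominated (S T : fib_set N) :
  (forall k, above S k <= above T k) -> dominated S T.
Proof.
move=> le; have all_above (U : {set 'I_N.+1}) : above U 0 = #|U|.
  by rewrite above_elts -size_elts; apply/eqP; rewrite -all_count; apply/allP.
apply/andP; split; first by rewrite -!all_above.
apply/forallP=> -[i lti] /=; rewrite leqNgt; apply/negP => lt.
have ss : size (elts S) = #|S| by apply: size_elts.
have st : size (elts T) = #|T| by apply: size_elts.
rewrite -st -ss in lt; rewrite -ss in lti.
pose k := nth 0 (elts S) (size (elts S) - i.+1).
have srt (U : {set 'I_N.+1}) p q : p < q -> q < size (elts U) ->
  nth 0 (elts U) p < nth 0 (elts U) q.
  move=> pq qU; apply: (sorted_ltn_nth ltn_trans 0 (sorted_elts U)) => //;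
    rewrite -topredE /=.
  exact: ltn_trans qU.
have lo : i < above S k.
  rewrite above_elts -(cat_take_drop (size (elts S) - i.+1) (elts S)) count_cat.
  apply: leq_trans (leq_addl _ _).
  suff : all (leq k) (drop (size (elts S) - i.+1) (elts S)).
    by rewrite all_count => /eqP ->; rewrite size_drop; lia.
  apply/(all_nthP 0) => j; rewrite size_drop nth_drop => ltj.
  rewrite /k; case: j ltj => [|j] ltj; first by rewrite addn0.
  by apply/ltnW/srt; lia.
have hi : above T k <= i.
  rewrite above_elts -(cat_take_drop (size (elts T) - i) (elts T)) count_cat.
  have -> : count (leq k) (take (size (elts T) - i) (elts T)) = 0.
    apply/eqP; rewrite -leqn0 leqNgt -has_count; apply/(hasPn); move=> x.
    case/(nthP 0) => j; rewrite size_take => ltj'.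
    have ltj : j < size (elts T) - i by move: ltj'; case: ifP; lia.
    rewrite nth_take //.
    move=> <-; rewrite -ltnNge; apply: leq_ltn_trans lt.
    have [->//|ne] := eqVneq j (size (elts T) - i.+1).
    by apply/ltnW/srt; lia.
  by rewrite add0n; apply: leq_trans (count_size _ _) _; rewrite size_drop; lia.
by have := le k; lia.
Qed.

(** The same numbers seen from the right nodes, where left multiplication has a
    transparent effect. *)
Definition right_above D k : {set 'I_N} :=
  [set j | (left_end (flip (partner D (true, j))) == None) &&
    (k <= slab D (true, j))].

Lemma above_right D k : is_okada D ->
  above (prop_lab (left_half D)) k = #|right_above D k|.
Proof.
move=> oD; rewrite (prop_lab_sides oD).
have [f [l r]] := drawn_exists D; have /(drawn_okada r) o := oD.
rewrite -(card_in_imset (f := fun j => lab D (true, j))).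
  rewrite /above; apply: eq_card => x; rewrite inE; apply/andP/imsetP.
    move=> [/imsetP[j]]; rewrite inE right_halfE /= => c -> le.
    by exists j => //; rewrite inE c.
  move=> [j]; rewrite inE => /andP[c le] ->; split=> //.
  by apply/imsetP; exists j; rewrite ?inE right_halfE.
move=> i j; rewrite !inE !(right_end_pos r) => /andP[fi _] /andP[fj _]
  /(congr1 val) /= e.
have [_ li] := r (true, i); have [_ lj] := r (true, j).
suff [] : (true, i) = (true, j) :> node N by [].
have ge (i' : 'I_N) : N <= pos (true, i') by rewrite /pos /absn /=;
  have := ltn_ord i'; lia.
apply: pos_inj; apply: (prop_label_inj_right o) => //; rewrite ?pos_lt ?ge //.
by rewrite -li -lj.
Qed.

(** Left multiplication can only join two propagating arcs or lower their
    labels; seen from the right, nothing else changes. *)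
Lemma act_right h D j : h.+1 < N -> matched D ->
  let D' := gen_act false h D in
  slab D' (true, j) <= slab D (true, j) /\
  (left_end (flip (partner D (true, j))) <> None ->
   partner D' (true, j) = partner D (true, j) /\
     slab D' (true, j) = slab D (true, j)).
Proof.
move=> lt m /=; rewrite gen_actE partner_surgery slab_surgery; last exact: ltnW.
rewrite /splice /splice_lab /=.
set u := (false, Ordinal (ltnW lt)); set v := (false, Ordinal lt).
have [fu ffu lu] := m u; have [fv ffv lv] := m v.
rewrite -/u -/v /=; case: eqP => [->|_] /=; first by rewrite ffu lu /=;
  split=> //; lia.
case: eqP => [->|_] /=; first by rewrite ffv lv /=; split=> //; lia.
by [].
Qed.

Lemma right_above_act h D k : h.+1 < N -> matched D ->
  right_above (gen_act false h D) k \subset right_above D k.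
Proof.
move=> lt m; apply/subsetP => j; rewrite !inE => /andP[/eqP c le].
have [l1 l2] := act_right j lt m; rewrite (leq_trans le l1) andbT.
by apply/negPn/negP => /eqP nc; move: (nc); have [<- _] := l2 nc; rewrite c.
Qed.

Lemma act_dominated h D (S S' : fib_set N) : h.+1 < N -> is_okada D ->
  is_okada (gen_act false h D) ->
  prop_lab (left_half D) = S -> prop_lab (left_half (gen_act false h D)) = S' ->
  dominated S' S.
Proof.
move=> lt o o' e e'; apply: above_dominated => k.
rewrite -e -e' !above_right //; apply/subset_leq_card/right_above_act => //.
by have /and4P[/matchedP] := o.
Qed.

(** When the set of labels is unchanged the decreasing sets [right_above] keep
    their sizes, so that no right end is lost and no label is lowered. *)
Lemma act_right_half h D : h.+1 < N -> is_okada D ->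
  is_okada (gen_act false h D) ->
  prop_lab (left_half (gen_act false h D)) = prop_lab (left_half D) ->
  right_half (gen_act false h D) = right_half D.
Proof.
move=> lt o o' e; have m : matched D by have /and4P[/matchedP] := o.
have eR k : right_above (gen_act false h D) k = right_above D k.
  by apply/eqP; rewrite eqEcard right_above_act // -!above_right // e leqnn.
apply/right_half_eq => j; have [l1 l2] := act_right j lt m.
have [c|/eqP/l2[-> ->] //] := eqVneq (left_end (flip (partner D (true, j))))
  None.
have : j \in right_above D (slab D (true, j)) by rewrite inE c eqxx leqnn.
by rewrite -eR inE => /andP[/eqP -> le]; rewrite c; split=> //; apply/eqP;
  rewrite eqn_leq l1.
Qed.

(** Distinct propagating arcs have distinct labels, so labels tell which left
    and right ends belong together. *)
Lemma okada_half_inj D D' : is_okada D -> is_okada D' ->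
  left_half D = left_half D' -> right_half D = right_half D' -> D = D'.
Proof.
move=> oD oD' /left_half_eq eL /right_half_eq eR.
have [f [l r]] := drawn_exists D; have /(drawn_okada r) o := oD.
have m : matched D by have /and4P[/matchedP] := oD.
have m' : matched D' by have /and4P[/matchedP] := oD'.
have ge (i' : 'I_N) : N <= pos (true, i') by rewrite /pos /absn /=;
  have := ltn_ord i'; lia.
have left_ok i : partner D (false, i) = partner D' (false, i).
  have [e1 e2] := eL i.
  case E: (partner D (false, i)) e1 => [[] j]; last first.
    by case: (partner D' (false, i)) => -[] j' //= [->].
  case E': (partner D' (false, i)) => [[] j'] //= _.
  have [_ inv la] := m (false, i); rewrite E in inv la.
  have [_ inv' la'] := m' (false, i); rewrite E' in inv' la'.
  apply: pos_inj; apply: (prop_label_inj_right o); rewrite ?pos_lt ?ge //.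
  - by rewrite -(right_end_pos r) inv.
  - by rewrite -(right_end_pos r); have [-> _] := eR j'; rewrite inv'.
  have [_ <-] := r (true, j); have [_ <-] := r (true, j').
  by rewrite la e2 -la'; have [_ ->] := eR j'.
apply: diagram_ext => -[] [] i.
- have [e1 e2] := eR i; have [_ inv _] := m (true, i).
  case E: (partner D (true, i)) e1 inv => [[] j].
    by case: (partner D' (true, i)) => -[] j' //= [->].
  move=> _; rewrite left_ok => e; have [_ + _] := m' (false, j).
  by rewrite e.
- exact: left_ok.
- by have [] := eR i.
- by have [] := eL i.
Qed.
End Dominance.

(** * Joining two half diagrams *)

Section Bowtie.
Variable N : nat.
Implicit Types (D : diagram N).

Definition partner_label (P : pred nat) (l : nat -> nat) (r : seq nat)
  (x : nat) :=
  head 0 [seq q <- r | P q && (l q == x)].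

Lemma partner_labelP (P : pred nat) l r x : has (fun q => P q && (l q == x)) r
  ->
  let q := partner_label P l r x in [/\ q \in r, P q & l q = x].
Proof.
rewrite has_filter /partner_label => ne.
have : head 0 [seq q <- r | P q && (l q == x)] \in
  [seq q <- r | P q && (l q == x)].
  by case: [seq q <- r | P q && (l q == x)] ne => //= q s _; rewrite mem_head.
by rewrite mem_filter => /andP[/andP[? /eqP ?] ?].
Qed.

(** Labels of propagating ends increase with the position on the left and
    decrease on the right; joining equal labels therefore nests the arcs. *)
Lemma okada_line_join f1 l1 f2 l2 : okada_line N f1 l1 -> okada_line N f2 l2 ->
  (forall p, p < N -> N <= f1 p -> has (fun q => (f2 q < N) && (l2 q == l1 p))
    (iota N N)) ->
  (forall q, N <= q < N + N -> f2 q < N ->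
    has (fun p => (N <= f1 p) && (l1 p == l2 q)) (iota 0 N)) ->
  exists f l, [/\ okada_line N f l,
    forall p, p < N -> l p = l1 p /\
      (if N <= f1 p then (N <= f p : Prop) else f p = f1 p) &
    forall p, N <= p < N + N -> l p = l2 p /\
      (if f2 p < N then (f p < N : Prop) else f p = f2 p)].
Proof.
move=> o1 o2 h1 h2.
(* partners of the propagating ends, from left to right and from right to left *)
pose al p := partner_label (fun q => f2 q < N) l2 (iota N N) (l1 p).
pose be q := partner_label (fun p => N <= f1 p) l1 (iota 0 N) (l2 q).
have alP p : p < N -> N <= f1 p -> [/\
  N <= al p < N + N, f2 (al p) < N & l2 (al p) = l1 p].
  by move=> a b; have [] := partner_labelP (h1 p a b); rewrite mem_iota.
have beP q : N <= q < N + N -> f2 q < N ->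
  [/\ be q < N, N <= f1 (be q) & l1 (be q) = l2 q].
  by move=> a b; have [] := partner_labelP (h2 q a b); rewrite mem_iota.
have be_al p : p < N -> N <= f1 p -> be (al p) = p.
  move=> a b; have [c1 c2 c3] := alP p a b; have [d1 d2 d3] := beP _ c1 c2.
  by apply: (prop_label_inj o1) => //; rewrite d3 c3.
have al_be q : N <= q < N + N -> f2 q < N -> al (be q) = q.
  move=> a b; have [c1 c2 c3] := beP q a b; have [d1 d2 d3] := alP _ c1 c2.
  by apply: (prop_label_inj_right o2) => //; rewrite d3 c3.
pose f p := if p < N then (if N <= f1 p then al p else f1 p)
            else (if f2 p < N then be p else f2 p).
pose l p := if p < N then l1 p else l2 p.
have fL p : p < N -> N <= f1 p -> f p = al p by rewrite /f => -> ->.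
have fl p : p < N -> f1 p < N -> f p = f1 p by rewrite /f => -> c;
  rewrite leqNgt c.
have fR p : N <= p -> f2 p < N -> f p = be p by rewrite /f => le ->;
  rewrite ltnNge le.
have fr p : N <= p -> N <= f2 p -> f p = f2 p by rewrite /f => le c;
  rewrite !ltnNge le c.
have ll p : p < N -> l p = l1 p by rewrite /l => ->.
have lr p : N <= p -> l p = l2 p by rewrite /l => le; rewrite ltnNge le.
have [ok1 on1] := o1; have [ok2 on2] := o2.
exists f, l; split; last 2 first.
- move=> p lt; rewrite ll //; split=> //; case: (leqP N (f1 p)) => c.
    by rewrite fL //; have [] := alP p lt c; lin.
  by rewrite fl.
- move=> p lt; rewrite lr; last by lin.
  split=> //; case: (ltnP (f2 p) N) => c.
    by rewrite fR //; [have [] := beP p lt c; lin | lin].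
  by rewrite fr //; lin.
split=> [p lt|p q lt b].
  have [[a1 a2 a3 a4] [b1 b2 b3 b4 b5]] := ok1 p lt.
  have [[c1 c2 c3 c4] [d1 d2 d3 d4 d5]] := ok2 p lt.
  rewrite /okada_point; case: (ltnP p N) => ltp.
    case: (leqP N (f1 p)) => c.
      have [e1 e2 e3] := alP p ltp c.
      rewrite (fL p) // (ll p) // (fR (al p)) ?be_al ?(lr (al p)) //; try lin.
      by split; split=> //; try lin; move=> ?; apply: b4; lin.
    by rewrite (fl p) // (fl (f1 p)) ?a3 // !ll //; split; split.
  case: (ltnP (f2 p) N) => c.
    have pb : N <= p < N + N by lin.
    have [e1 e2 e3] := beP p pb c.
    rewrite (fR p) // (lr p) // (fL (be p)) ?al_be ?(ll (be p)) //.
    by split; split=> //; try lin; move=> ?; apply: d5; lin.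
  by rewrite (fr p) // (fr (f2 p)) ?c3 // !lr //; split; split.
have cross1 p' q' : p' < N -> p' < q' < f1 p' -> p' < f1 q' < f1 p' /\
  l1 p' < l1 q'.
  by move=> ?; apply: on1; lin.
case: (ltnP p N) b => ltp b; last first.
  have [f2p|f2p] := ltnP (f2 p) N.
    by have pb : N <= p < N + N by [lin]; have [] := beP p pb f2p; move: b;
      rewrite fR //; lin.
  move: b; rewrite fr // => b; have [g1 g2] := on2 p q lt b.
  by rewrite !lr ?fr //; lin.
have inner q' : q' < N -> p < q' -> N <= f1 p -> f1 q' < N -> p < f1 q'.
  move=> q1 q2 q3 q4; have [[a1 a2 a3 a4] _] := ok1 q' ltac:(lin).
  have [[e1 e2 e3 e4] _] := ok1 p ltac:(lin).
  case: (ltngtP (f1 q') p) => // [lt'|e]; last by move: a3; rewrite e; lin.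
  by have [] := cross1 (f1 q') p ltac:(lin) ltac:(lin); lin.
have [c|c] := ltnP (f1 p) N.
  move: b; rewrite fl // => b; have [g1 g2] := cross1 p q ltp b.
  by rewrite !ll ?fl //; lin.
have [e1 e2 e3] := alP p ltp c; move: b; rewrite fL // => b.
case: (ltnP q N) => ltq.
  have [_ g2] := cross1 p q ltp ltac:(lin).
  rewrite !ll //; split=> //.
  have [c'|c'] := ltnP (f1 q) N.
    by rewrite fl //; have := inner q ltq ltac:(lin) c c'; lin.
  rewrite fL //; have [e1' e2' e3'] := alP q ltq c'.
  case: (ltngtP (al q) (al p)) => [|h|h]; first by lin.
    by have := @prop_decreasing _ _ _ o2 (al p) (al q) ltac:(lin) h ltac:(lin)
      e2 e2'; lin.
  by exfalso; move: e3'; rewrite h e3; lin.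
have [[i1 i2 i3 i4] _] := ok2 (al p) ltac:(lin).
have [g1 g2] := on2 (f2 (al p)) q i1 ltac:(rewrite i3; lin).
rewrite ll // lr //; split; last by lin.
have [c'|c'] := ltnP (f2 q) N; last by rewrite fr //; lin.
have qb : N <= q < N + N by lin.
have [e1' e2' e3'] := beP q qb c'; rewrite fR //.
case: (ltngtP p (be q)) => [|h|h]; first by lin.
  by have := prop_increasing o1 h ltp e2' c; lin.
by exfalso; move: e3'; rewrite -h; lin.
Qed.

Lemma okada_join D1 D2 : is_okada D1 -> is_okada D2 ->
  prop_lab (left_half D1) = prop_lab (right_half D2) ->
  exists D, [/\ is_okada D, left_half D = left_half D1 & right_half D
    = right_half D2].
Proof.
have [f1 [l1 r1]] := drawn_exists D1; have [f2 [l2 r2]] := drawn_exists D2.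
move=> /(drawn_okada r1) o1 /(drawn_okada r2) o2 e.
have [ok1 _] := o1; have [ok2 _] := o2.
have [||f [l [o hl hr]]] := okada_line_join o1 o2.
- move=> p lt c; have [_ [_ ? _ _ _]] := ok1 p ltac:(lia).
  have lN : l1 p < N.+1 by lia.
  have : inord (l1 p) \in prop_lab (left_half D1).
    rewrite (mem_prop_lab r1); apply/hasP; exists p; first by rewrite mem_iota;
      lia.
    by rewrite c inordK /=.
  by rewrite e (mem_prop_lab_right r2) inordK.
- move=> p lt c; have [_ [_ ? ? _ _]] := ok2 p ltac:(lia).
  have lN : l2 p < N.+1 by lia.
  have : inord (l2 p) \in prop_lab (right_half D2).
    rewrite (mem_prop_lab_right r2); apply/hasP; exists p;
      first by rewrite mem_iota; lia.
    by rewrite c inordK /=.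
  by rewrite -e (mem_prop_lab r1) inordK.
have [ok0 _] := o.
have [|D r] := @drawn_of_line N f l.
  by move=> p lt; have [[? _ _ _] [_ ? ? _ _]] := ok0 p lt; lia.
exists D; split; first exact/(drawn_okada r).
  apply/left_half_eq => i; have [s1 s2] := r (false, i);
    have [t1 t2] := r1 (false, i).
  have [u1 u2] := hl i (ltn_ord i); split; last by rewrite s2 t2.
  have E : _ = (N <= f i) := left_end_pos r (false, i).
  have E1 : _ = (N <= f1 i) := left_end_pos r1 (false, i).
  case: ifP u2 => c u2; first by rewrite c in E1; rewrite u2 in E;
    rewrite (eqP E) (eqP E1).
  by congr left_end; apply: pos_inj; rewrite s1 t1.
apply/right_half_eq => i; have [s1 s2] := r (true, i);
  have [t1 t2] := r2 (true, i).
have pb : N <= pos (true, i) < N + N.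
  by rewrite pos_lt andbT /pos /absn /=; have := ltn_ord i; lia.
have [u1 u2] := hr _ pb; split; last by rewrite s2 t2.
have E := right_end_pos r (true, i); have E2 := right_end_pos r2 (true, i).
case: ifP u2 => c u2; first by rewrite c in E2; rewrite u2 in E;
  rewrite (eqP E) (eqP E2).
by congr (left_end (flip _)); apply: pos_inj; rewrite s1 t1.
Qed.

(** The matching of 0 and 1, of 2 and 3, etc. *)
Definition swap p := if odd p then p.-1 else p.+1.
Definition top p := if odd p then p else p.+1.

Lemma swapP p : [/\ swap p <> p, swap (swap p) = p, top (swap p) = top p &
  swap p <= p.+1].
Proof.
rewrite /swap /top; case: (odd p) (odd_double_half p) => /= <- //.
  by rewrite add1n /= odd_double /=; split=> //; lia.
by rewrite add0n /= odd_double /=; split=> //; lia.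
Qed.

Lemma topP p : [/\ odd (top p), p < swap p -> odd p = false,
  swap p < p -> odd p & p <= top p <= p.+1].
Proof.
rewrite /swap /top; case op: (odd p) => /=; rewrite ?op; split=> //; lia.
Qed.

Lemma swap_lt e p : ~~ odd e -> (swap p < e) = (p < e).
Proof. by rewrite /swap => oe; case: ifP; lia. Qed.

Lemma top_lt e p : ~~ odd e -> p < e -> top p < e.
Proof. by rewrite /top => oe; case: ifP; lia. Qed.

(** Small arcs {1,2}, {3,4}, ... followed by propagating arcs with the labels in
    S, arranged symmetrically. The i-th element of S is at most the position of
    its arc because the k elements of S are distinct and at most N. *)
Lemma fib_nonempty (S : fib_set N) : exists D, is_okada D /\
  prop_lab (left_half D) = S.
Proof.
have /and3P[S0 Sodd /forallP Sp] : is_fib S by case: (S).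
pose k := #|S|; pose s := elts S.
have ss : size s = k by apply: size_elts.
have srt : sorted ltn s := sorted_elts S.
have s_in i : i < k -> exists2 x : 'I_N.+1, x \in (S : {set _}) & nth 0 s i = x.
  move=> lt; have : nth 0 s i \in s by apply: mem_nth; rewrite ss.
  by case/mapP => x; rewrite mem_enum => ? ->; exists x.
have sN i : i < k -> 0 < nth 0 s i <= N.
  move=> /s_in[x xS ->]; have := ltn_ord x; rewrite ltnS => ->;
    rewrite andbT lt0n.
  by apply: contraNneq S0 => e; rewrite (_ : ord0 = x) //; apply: ord_inj.
have s_lt i j : i < j -> j < k -> nth 0 s i < nth 0 s j.
  by move=> ij jk; apply: (sorted_ltn_nth ltn_trans) => //;
    rewrite -topredE /= ss //; apply: ltn_trans jk.
have s_par i : i < k -> odd (nth 0 s i) = ~~ odd i.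
  by move=> lt; have /eqP := Sp (Ordinal lt).
have {Sodd}odd_k : odd k = odd N by apply/eqP.
have s_lo i : i < k -> i < nth 0 s i.
  elim: i => [|i IH] lt; first by have /andP[] := sN 0 lt.
  exact: leq_ltn_trans (IH (ltnW lt)) (s_lt i i.+1 _ lt).
(* the elements of S from i on are distinct and at most N *)
have s_hi i : i < k -> nth 0 s i + k <= N + i.+1.
  move=> lt; have [m em] : exists m, k = i + m.+1.
    by exists (k - i.+1); rewrite addnS -addSn subnKC.
  elim: m i lt em => [|m IH] i lt em.
    by have /andP[_] := sN i lt; rewrite em addn1 leq_add2r.
  have lt' : i.+1 < k by rewrite em; clear; lia.
  have := IH i.+1 lt' ltac:(by rewrite em addSnnS).
  by have := s_lt i i.+1 (leqnn _) lt'; clear; lia.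
have kN : k <= N.
  rewrite leqNgt; apply/negP => lt.
  have := s_lo N lt; have /andP[_] := sN N lt; lia.
have [e ek] : exists e, e + k = N by exists (N - k); rewrite subnK.
have even_e : ~~ odd e.
  by move: odd_k; rewrite -ek oddD; case: (odd e); case: (odd k).
(* small arcs at the first e and the last e nodes, nested arcs in between *)
pose out p := (p < e) || (N + N - e <= p < N + N).
pose f p := if out p then swap p else (N + N).-1 - p.
pose lev p := minn p ((N + N).-1 - p).
pose l p := if p < e then top p else
  if N + N - e <= p then N + N - top p else nth 0 s (lev p - e).
have le_e : e <= N by rewrite -ek leq_addr.
have even2 : ~~ odd (N + N) by rewrite addnn odd_double.
have swap_low p : (swap p < e) = (p < e) by apply: swap_lt.
have swap_high p : (N + N - e <= swap p) = (N + N - e <= p).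
  rewrite [LHS]leqNgt [RHS]leqNgt swap_lt // oddB ?(negbTE even2) //.
  exact: leq_trans (leq_addr _ _).
have swap2 p : (swap p < N + N) = (p < N + N) by apply: swap_lt.
have top2 p : p < N + N -> top p < N + N by apply: top_lt.
have odd_top p : p < N + N -> odd (N + N - top p).
  by move=> /top2 lt; have [t _ _ _] := topP p;
    rewrite oddB ?(negbTE even2) // ltnW.
have mid p : e <= p < N + N - e -> [/\ lev p - e < k,
    0 < nth 0 s (lev p - e), nth 0 s (lev p - e) <= (lev p).+1 &
    odd (nth 0 s (lev p - e)) = ~~ odd (lev p)].
  move=> b; have e_lev : e <= lev p by rewrite /lev; clear -b; lia.
  have lt : lev p - e < k by rewrite /lev; clear -b ek; lia.
  have /andP[-> _] := sN _ lt.
  rewrite (s_par _ lt) oddB // (negbTE even_e) addbF.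
  by split=> //; have := s_hi _ lt; clear -ek e_lev; lia.
clear odd_k even_e even2.
have fO p : out p -> f p = swap p by rewrite /f => ->.
have fI p : e <= p < N + N - e -> f p = (N + N).-1 - p.
  by move=> b; rewrite /f /out ifF //; clear -b; lia.
have lI p : e <= p < N + N - e -> l p = nth 0 s (lev p - e).
  by move=> b; rewrite /l !ifF //; clear -b; lia.
have outP p : p < N + N -> ~~ out p -> e <= p < N + N - e.
  by rewrite /out; clear; lia.
have o : okada_line N f l.
  split=> [p lt|p q lt].
    have [op|/(outP p lt) b] := boolP (out p); last first.
      have b' : e <= f p < N + N - e by rewrite fI //; clear -b; lia.
      have ffp : f (f p) = p by rewrite (fI _ b') fI //; clear -lt; lia.
      have lfp : lev (f p) = lev p by rewrite fI // /lev; clear -lt; lia.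
      have [_ m1 m2 m3] := mid p b.
      rewrite /okada_point ffp !lI // lfp m3 fI //.
      move: m2; rewrite /lev => m2.
      split; split=> //.
      - by clear -lt; lia.
      - by clear -lt; lia.
      - by clear -m2; lia.
      - by clear -m2 lt; lia.
      - by move=> c; rewrite (_ : minn _ _ = p) //; clear -c; lia.
      - by move=> c; rewrite (_ : minn _ _ = (N + N).-1 - p); clear -c lt; lia.
    have [n1 n2 n3 _] := swapP p; have [t1 t2 t3 t4] := topP p.
    have op' : out (swap p) by rewrite /out swap_low swap_high swap2.
    have ltf : swap p < N + N by rewrite swap2.
    have [lfp lo lb] : [/\ l (swap p) = l p, odd (l p) &
        l p <= minn p.+1 (N + N - p)].
      rewrite /l swap_low swap_high n3; have [pe|pe] := ltnP p e.
        by split=> //;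
          clear -t4 pe le_e; lia.
      have pe' : N + N - e <= p by move: op; rewrite /out; clear -pe; lia.
      rewrite pe'; split=> //; first exact: odd_top.
      by clear -t4 pe' le_e; lia.
    rewrite /okada_point !fO // n2 lfp lo; move: lb; rewrite leq_min.
    by case/andP; split; split=> // [|/t2->|/t3->] //; apply: odd_gt0.
  have [op|/(outP p lt) b] := boolP (out p).
    by rewrite fO //; have [_ _ _ h] := swapP p; clear -h; lia.
  rewrite fI // => bq; have b' : e <= q < N + N - e by clear -b bq; lia.
  rewrite fI // !lI //; split; first by clear -bq; lia.
  have [m _ _ _] := mid q b'; apply: s_lt m; rewrite /lev; clear -b bq; lia.
have [|D r] := @drawn_of_line N f l.
  by move=> p lt; have [[? _ _ _] [_ ? ? _ _]] := o.1 p lt; lia.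
exists D; split; first exact/(drawn_okada r).
apply/setP => x; rewrite (mem_prop_lab r) -mem_elts.
apply/hasP/(nthP 0) => [[p]|[i]].
  rewrite mem_iota => b /andP[c /eqP lx].
  have pe : e <= p < N + N - e.
    apply: outP; first by clear -b; lia.
    apply/negP => op; move: c; rewrite fO //; have := swap_low p.
    by move: op; rewrite /out; clear -b le_e; lia.
  by exists (lev p - e); [rewrite size_elts -/k; have [] := mid p pe |
    rewrite -lI].
rewrite size_elts -/k => lti e'; exists (e + i).
  by rewrite mem_iota; clear -lti ek; lia.
have b : e <= e + i < N + N - e by clear -lti ek; lia.
rewrite fI // lI // (_ : lev (e + i) - e = i); last first.
  by rewrite /lev; clear -lti ek; lia.
by apply/andP; split; [clear -lti ek; lia | apply/eqP].
Qed.
End Bowtie.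

(** * The cell datum *)

Section Cells.
Variable N : nat.
Implicit Types (D : diagram N) (S : fib_set N).

Lemma halvesP S (H : halves S) : (exists2 D, is_okada D & left_half D = val H)
  /\
  prop_lab (val H) = S.
Proof.
by case: H => H /= /andP[/existsP[D /andP[o /eqP e]] /eqP]; split=> //;
  exists D.
Qed.

Lemma bowtieP S (L R : halves S) : let D := bowtie (val L) (val R) in
  [/\ is_okada D, left_half D = val L & right_half D = val R].
Proof.
rewrite /= /bowtie; case: pickP => [D /and3P[? /eqP ? /eqP ?]|no] //=; exfalso.
have [[D1 o1 e1] p1] := halvesP L; have [[D2 o2 e2] p2] := halvesP R.
have e2' : right_half (mirror D2) = val R by rewrite /right_half mirrorK.
have [|D [o l r]] := @okada_join N D1 (mirror D2) o1 (mirror_okada o2).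
  by rewrite e1 e2' p1 p2.
by have := no D; rewrite o l r e1 e2' !eqxx.
Qed.

Lemma bowtie_eq S (L R : halves S) D : is_okada D -> left_half D = val L ->
  right_half D = val R -> D = bowtie (val L) (val R).
Proof.
move=> o l r; have [o' l' r'] := bowtieP L R.
by apply: okada_half_inj; rewrite ?l ?r.
Qed.

Lemma to_halves S D : is_okada D -> prop_lab (left_half D) = S ->
  exists L R : halves S, left_half D = val L /\ right_half D = val R.
Proof.
move=> o e.
have hl : is_okada_half (left_half D) && (prop_lab (left_half D) == S).
  by rewrite e eqxx andbT; apply/existsP; exists D; rewrite o /=.
have hr : is_okada_half (right_half D) && (prop_lab (right_half D) == S).
  rewrite -prop_lab_sides // e eqxx andbT; apply/existsP; exists (mirror D).
  by rewrite mirror_okada //=.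
pose half H := is_okada_half H && (prop_lab H == S).
by exists (exist half _ hl), (exist half _ hr).
Qed.

Definition cell_diagram (x : cell_index (@halves N)) : diagram N :=
  bowtie (val (tagged x).1) (val (tagged x).2).

Lemma cell_diagram_okada x : is_okada (cell_diagram x).
Proof. by have [] := bowtieP (tagged x).1 (tagged x).2. Qed.

Lemma cell_diagram_inj : injective cell_diagram.
Proof.
move=> [S [L R]] [S' [L' R']]; rewrite /cell_diagram /= => e.
have [_ l r] := bowtieP L R; have [_ l' r'] := bowtieP L' R'.
have eS : S = S'.
  apply: val_inj => /=; have [_ <-] := halvesP L; have [_ <-] := halvesP L'.
  by rewrite -l -l' e.
subst S'; have -> : L = L' by apply: val_inj; rewrite /= -l -l' e.
by have -> : R = R' by apply: val_inj; rewrite /= -r -r' e.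
Qed.

Lemma cell_diagram_surj D : is_okada D ->
  exists x, cell_diagram x = D /\ prop_lab (left_half D) = tag x.
Proof.
move=> o; have [S e] := prop_labP o; have [L [R [l r]]] := to_halves o e.
by exists (existT _ S (L, R)); rewrite /cell_diagram /= -(bowtie_eq o l r).
Qed.

Definition cell_perm x : 'S_N := odflt 1%g
  [pick s | diagram_perm s == cell_diagram x].

Lemma cell_permP x : diagram_perm (cell_perm x) = cell_diagram x.
Proof.
rewrite /cell_perm; case: pickP => [s /eqP //|no].
by have [s e] := diagram_perm_surj (cell_diagram_okada x); have := no s;
  rewrite e eqxx.
Qed.

Lemma cell_perm_bij : bijective cell_perm.
Proof.
have inj : injective cell_perm.
  by move=> x y e; apply: cell_diagram_inj; rewrite -!cell_permP e.
have surj s : exists x, cell_perm x = s.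
  have [x [e _]] := cell_diagram_surj (diagram_perm_okada s).
  by exists x; apply: diagram_perm_inj; rewrite cell_permP.
have [g gK] := choice surj.
by exists g => // x; apply: inj; rewrite gK.
Qed.

Definition side_level (b : bool) D j : nat :=
  \sum_(i < N) (slab D (b, i) <= j.+1 < absn (b, i)).

Lemma level_sides D j : level D j = side_level true D j + side_level false D j.
Proof.
pose F b i : nat := slab D (b, i) <= j.+1 < absn (b, i).
rewrite /level (eq_bigr (fun a : node N => F a.1 a.2)) => [|[b i] _ //].
by rewrite -(pair_bigA _ F) big_bool.
Qed.

(** The monomial created when a generator multiplies a diagram only depends on
    the left half, as long as the right half is kept: the loop is formed on the
    left, and in the count of letters the contributions of the right half to the
    crossings cancel. *)
Lemma act_monomial h (s1 s2 t1 t2 : 'S_N) m1 m2 : h.+1 < N ->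
  reduces N (h :: perm_word s1) m1 (perm_word t1) ->
    reduces N (h :: perm_word s2) m2 (perm_word t2) ->
  left_half (diagram_perm s1) = left_half (diagram_perm s2) ->
  right_half (diagram_perm t1) = right_half (diagram_perm s1) ->
  right_half (diagram_perm t2) = right_half (diagram_perm s2) ->
  perm_eq m1 m2.
Proof.
move=> lt r1 r2 eL e1 e2; have gid := admissible_id N.
have act_of (s : 'S_N) m (t : 'S_N) : reduces N (h :: perm_word s) m
  (perm_word t) ->
    diagram_perm t = gen_act false h (diagram_perm s).
  by move=> r; rewrite !diagram_perm_word; apply/esym/(reduces_word_act r gid).
have eL' : left_half (diagram_perm t1) = left_half (diagram_perm t2).
  by rewrite (act_of _ _ _ r1) (act_of _ _ _ r2); apply: left_half_act.
have xcount (s : 'S_N) m (t : 'S_N) j : reduces N (h :: perm_word s) m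
  (perm_word t) ->
    count_mem (false, j) m = loop h j.+1 (diagram_perm s).
  move=> r; have := reduces_loops r j gid; rewrite /= !perm_word_loops !addn0.
  by rewrite -diagram_perm_word.
have ex j : count_mem (false, j) m1 = count_mem (false, j) m2.
  rewrite (xcount _ _ _ _ r1) (xcount _ _ _ _ r2) !(loopE lt)
    ![_ == (false, _)]eq_sym !left_endP.
  by move/left_half_eq/(_ (Ordinal (ltnW lt))): eL => [-> ->].
have lev (s : 'S_N) m (t : 'S_N) j : reduces N (h :: perm_word s) m
  (perm_word t) ->
    right_half (diagram_perm t) = right_half (diagram_perm s) ->
    (h == j).*2 + side_level false (diagram_perm s) j =
    (count_mem (false, j) m + ydeg m j).*2 + side_level false (diagram_perm t)
      j.
  move=> r /right_half_eq e; have := reduces_level j r; have := level_perm s j.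
  have := level_perm t j; rewrite (reduces_word_act r gid) -!diagram_perm_word.
  rewrite !level_sides /=; have -> : side_level true (diagram_perm t) j
    = side_level true (diagram_perm s) j.
    by apply: eq_bigr => i _; have [_ ->] := e i.
  lia.
have side_eq (s t : 'S_N) j : left_half (diagram_perm s)
  = left_half (diagram_perm t) ->
    side_level false (diagram_perm s) j = side_level false (diagram_perm t) j.
  by move=> /left_half_eq e; apply: eq_bigr => i _; have [_ ->] := e i.
apply: monomial_ext => // j.
have := lev _ _ _ j r1 e1; have := lev _ _ _ j r2 e2; rewrite ex.
by rewrite (side_eq _ _ j eL) (side_eq _ _ j eL'); lia.
Qed.
End Cells.

Section Cellular.
Variables (K : fieldType) (N : nat).
Variables (X : (N.-1).-tuple K) (Y : (N.-2).-tuple K).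
Implicit Types (S : fib_set N).
Local Open Scope ring_scope.
Local Notation O := (okada X Y).
Local Notation C := (@okada_cell K N X Y).
Local Notation cell := (cell_elt (@okada_cell K N X Y)).

Lemma cell_eltE x : cell x = okada_perm X Y (cell_perm x).
Proof. by rewrite -okada_basis_perm cell_permP. Qed.

Lemma okada_perm_inj : injective (@okada_perm K N X Y).
Proof.
move=> s t e; apply/eqP; rewrite eq_sym.
have := @okada_perm_free K N X Y (fun u => (u == s)%:R - (u == t)%:R).
have -> : \sum_u ((u == s)%:R - (u == t)%:R) *: okada_perm X Y u = 0.
  under eq_bigr do rewrite scalerBl.
  have pick1 v : \sum_u (u == v)%:R *: okada_perm X Y u = okada_perm X Y v.
    by rewrite (bigD1 v) //= eqxx scale1r big1 ?addr0 // => u /negbTE->;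
      rewrite scale0r.
  by rewrite sumrB !pick1 e subrr.
move=> /(_ erefl t); rewrite eqxx; case: (t == s) => // /eqP.
by rewrite sub0r oppr_eq0 oner_eq0.
Qed.

Lemma cell_elt_inj : injective cell.
Proof.
by move=> x y; rewrite !cell_eltE => /okada_perm_inj;
  apply: (bij_inj (cell_perm_bij N)).
Qed.

Lemma cell_elt_free : lin_indep cell.
Proof.
move=> f; have [g fK gK] := cell_perm_bij N.
have -> : \sum_x f x *: cell x = \sum_s f (g s) *: okada_perm X Y s.
  rewrite [RHS](reindex _ (onW_bij _ (cell_perm_bij N))).
  by apply: eq_bigr => x _; rewrite fK cell_eltE.
by move=> /okada_perm_free h x; have := h (cell_perm x); rewrite fK.
Qed.

Lemma cell_elt_gen a : in_span xpredT cell a.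
Proof.
have [f ->] := okada_perm_span a; exists (fun x => f (cell_perm x)).
rewrite (reindex _ (onW_bij _ (cell_perm_bij N))).
by apply: eq_bigr => x _; rewrite cell_eltE.
Qed.

Lemma okada_rev_cell S (L R : halves S) : okada_rev (C L R) = C R L.
Proof.
have [o l r] := bowtieP L R; rewrite /okada_cell okada_rev_basis //;
  congr okada_basis.
apply: bowtie_eq; first exact: mirror_okada.
  by rewrite -[left_half _]/(right_half _).
by rewrite /right_half mirrorK.
Qed.

(** A generator either keeps the right half and acts on the left half alone, or
    it lowers the set of propagating labels. *)
Lemma gen_cell h S (L : halves S) : (h.+1 < N)%N ->
  (exists c (L' : halves S), forall R, okada_E X Y h.+1 * C L R = c *: C L' R)
    \/
  (forall R, exists c x, (tag x < S)%O /\
    okada_E X Y h.+1 * C L R = c *: cell x).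
Proof.
move=> lt; pose D (R : halves S) := bowtie (val L) (val R).
have vh (s : 'S_N) : valid N (h :: perm_word s) by rewrite /valid /= lt;
  apply: valid_perm_word.
have DP R : exists (s t : 'S_N) m, [/\
  diagram_perm s = D R, diagram_perm t = gen_act false h (D R) &
    reduces N (h :: perm_word s) m (perm_word t)].
  have [o _ _] := bowtieP L R; have [s es] := diagram_perm_surj o.
  have [t [m [r et]]] := normal_form_perm (vh s).
  by exists s, t, m; split=> //; rewrite et /= -diagram_perm_word es.
have mulE R (s t : 'S_N) m : diagram_perm s = D R ->
  reduces N (h :: perm_word s) m (perm_word t) ->
    okada_E X Y h.+1 * C L R = monom X Y m *: okada_basis X Y (diagram_perm t).
  move=> es r; rewrite /okada_cell -/(D R) -es !okada_basis_perm
    !okada_perm_word.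
  by rewrite -(reduces_okada X Y r) /okada_word big_cons.
have oD R : is_okada (D R) by have [] := bowtieP L R.
have lD R : left_half (D R) = val L by have [] := bowtieP L R.
have rD R : right_half (D R) = val R by have [] := bowtieP L R.
have pD R : prop_lab (left_half (D R)) = S by rewrite lD; have [] := halvesP L.
have oD' R : is_okada (gen_act false h (D R)).
  by have [s [t [m [_ <- _]]]] := DP R; apply: diagram_perm_okada.
have lD' R R' : left_half (gen_act false h (D R))
  = left_half (gen_act false h (D R')).
  by apply: left_half_act; rewrite ?lD.
have [e|ne] := eqVneq (prop_lab (left_half (gen_act false h (D L)))) S.
  have eR R : prop_lab (left_half (gen_act false h (D R)))
    = S by rewrite (lD' R L).
  have rD' R : right_half (gen_act false h (D R)) = right_half (D R).
    by apply: act_right_half => //; rewrite eR pD.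
  have [s0 [t0 [m0 [es0 et0 r0]]]] := DP L.
  have [L' [_ [eL' _]]] := to_halves (oD' L) e.
  left; exists (monom X Y m0), L' => R; have [s [t [m [es et r]]]] := DP R.
  rewrite (mulE _ _ _ _ es r) et.
  have -> : monom X Y m = monom X Y m0.
    apply: perm_big; apply: (act_monomial lt r r0);
      rewrite ?es ?es0 ?et ?et0 ?lD //.
  congr (_ *: okada_basis _ _ _); apply: bowtie_eq => //;
    first by rewrite (lD' R L).
  by rewrite rD'.
right=> R; have [s [t [m [es et r]]]] := DP R.
have [x [ex px]] := cell_diagram_surj (oD' R).
exists (monom X Y m), x; split; last first.
  by rewrite (mulE _ _ _ _ es r) et -ex.
rewrite lt_def; apply/andP; split.
  by apply: contraNneq ne => E; rewrite (lD' L R) px -E.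
by apply: (act_dominated (h := h) (D := D R)).
Qed.

Let low S := in_span (fun x : cell_index (@halves N) => (tag x < S)%O) cell.

Lemma lowD S x y : low S x -> low S y -> low S (x + y).
Proof.
move=> [f ->] [g ->]; exists (fun i => f i + g i); rewrite -big_split.
by apply: eq_bigr => i _; rewrite scalerDl.
Qed.

Lemma lowZ S c x : low S x -> low S (c *: x).
Proof.
move=> [f ->]; exists (fun i => c * f i); rewrite scaler_sumr.
by apply: eq_bigr => i _; rewrite scalerA.
Qed.

Lemma low0 S : low S 0.
Proof. by exists (fun=> 0); rewrite big1 // => i _; rewrite scale0r. Qed.

Lemma low_sum S (I : finType) (P : pred I) (F : I -> O) :
  (forall i, P i -> low S (F i)) -> low S (\sum_(i | P i) F i).
Proof. by move=> lF; elim/big_ind: _ => //; [apply: low0 | apply: lowD]. Qed.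

Lemma low_cell S x : (tag x < S)%O -> low S (cell x).
Proof.
move=> lt; exists (fun y => (y == x)%:R); rewrite (bigD1 x) //= eqxx scale1r.
by rewrite big1 ?addr0 // => i /andP[_ /negbTE->]; rewrite scale0r.
Qed.

Lemma lowW S S' x : (S <= S')%O -> low S x -> low S' x.
Proof.
move=> le [f ->]; apply: low_sum => i lt; apply/lowZ/low_cell.
exact: lt_le_trans le.
Qed.

(** The third axiom of a cell datum for the element a. It is stable under linear
    combinations, and under products because multiplication by a preserves lower
    cells. *)
Let cell_action (a : O) := forall S, exists r : halves S -> halves S -> K,
  forall L R, low S (a * C L R - \sum_U r U L *: C U R).

Lemma cell_action_low a : cell_action a -> forall S x, low S x -> low S (a * x).
Proof.
move=> aP S x [f ->]; rewrite mulr_sumr; apply: low_sum => -[S' [L R]] /= lt.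
rewrite -scalerAr; apply: lowZ; have [r rP] := aP S'.
rewrite -[cell _]/(C L R) -[_ * _](subrK (\sum_U r U L *: C U R)); apply: lowD.
  by apply: lowW (rP L R); apply: ltW.
by apply: low_sum => U _; apply: lowZ;
  apply: (@low_cell S (existT _ S' (U, R))).
Qed.

Lemma cell_actionD a b : cell_action a -> cell_action b -> cell_action (a + b).
Proof.
move=> aP bP S; have [r rP] := aP S; have [t tP] := bP S.
exists (fun U L => r U L + t U L) => L R.
have -> : (a + b) * C L R - \sum_U (r U L + t U L) *: C U R =
   (a * C L R - \sum_U r U L *: C U R) + (b * C L R - \sum_U t U L *: C U R).
  under eq_bigr do rewrite scalerDl.
  by rewrite big_split /= mulrDl opprD addrACA.
exact: lowD.
Qed.

Lemma cell_actionM a b : cell_action a -> cell_action b -> cell_action (a * b).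
Proof.
move=> aP bP S; have [r rP] := aP S; have [t tP] := bP S.
exists (fun V L => \sum_U t U L * r V U) => L R.
have -> : a * b * C L R - \sum_V (\sum_U t U L * r V U) *: C V R =
   a * (b * C L R - \sum_U t U L *: C U R) +
   \sum_U t U L *: (a * C U R - \sum_V r V U *: C V R).
  rewrite mulrBr mulrA -addrA; congr (_ + _).
  under [X in _ = _ + X]eq_bigr do rewrite scalerBr.
  rewrite sumrB mulr_sumr addrA; under [X in - X + _]eq_bigr do rewrite
    -scalerAr.
  rewrite addNr add0r; congr (- _).
  under [RHS]eq_bigr do rewrite scaler_sumr.
  rewrite exchange_big; apply: eq_bigr => V _; rewrite scaler_suml.
  by apply: eq_bigr => U _; rewrite scalerA.
apply: lowD; first exact: cell_action_low.
by apply: low_sum => U _; apply: lowZ.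
Qed.

Lemma cell_action_scalar c : cell_action c%:A.
Proof.
move=> S; exists (fun U L => c * (U == L)%:R) => L R.
have -> : c%:A * C L R - \sum_U (c * (U == L)%:R) *: C U R = 0;
  last exact: low0.
rewrite (bigD1 L) //= eqxx mulr1 big1 ?addr0 => [|U /negbTE->];
  last by rewrite mulr0 scale0r.
by rewrite -scalerAl mul1r subrr.
Qed.

Lemma cell_action_gen h : (h.+1 < N)%N -> cell_action (okada_E X Y h.+1).
Proof.
move=> lt S.
have row L : exists rL : halves S -> K, forall R,
    low S (okada_E X Y h.+1 * C L R - \sum_U rL U *: C U R).
  have [[c [L' e]]|e] := gen_cell L lt.
    exists (fun U => c * (U == L')%:R) => R.
    rewrite (bigD1 L') //= eqxx mulr1 big1 ?addr0 => [|U /negbTE->]; last first.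
      by rewrite mulr0 scale0r.
    by rewrite e subrr; apply: low0.
  exists (fun=> 0) => R; rewrite big1 ?subr0 => [|U _]; last by rewrite scale0r.
  by have [c [x [ltx ->]]] := e R; apply/lowZ/low_cell.
have [r rP] := choice row.
by exists (fun U L => r L U).
Qed.

Lemma cell_actionT a : cell_action a.
Proof.
elim/okada_ind: a => t; elim: t => [i|c|t IHt u IHu|t IHt u IHu].
- rewrite -[okada_pi _ _ _]/(okada_gen X Y i).
  have -> : okada_gen X Y i = okada_E X Y i.+1.
    by rewrite (okada_E_gen _ _ (ltn_ord i)); congr okada_gen; apply: val_inj.
  exact/cell_action_gen/ltn_gen.
- by rewrite -[okada_pi _ _ _]/(okada_scalar X Y c) okada_scalarE;
  apply: cell_action_scalar.
- by rewrite okada_piD; apply: cell_actionD.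
- by rewrite okada_piM; apply: cell_actionM.
Qed.
End Cellular.

Local Open Scope ring_scope.

Theorem theorem6p3 (K : fieldType) (N : nat)
    (X : (N.-1).-tuple K) (Y : (N.-2).-tuple K) :
  exists inv : {linear okada X Y -> okada X Y},
    (forall D : diagram N, is_okada D ->
       inv (okada_basis X Y D) = okada_basis X Y (mirror D)) /\
    cell_datum (@okada_cell K N X Y) inv.
Proof.
exists (@okada_rev K N X Y : {linear okada X Y -> okada X Y}).
split=> [D|]; first exact: okada_rev_basis.
split.
- exact: okada_revM.
- exact: okada_rev1.
- exact: okada_revK.
- move=> S; have [D [o e]] := fib_nonempty S.
  by have [L _] := to_halves o e; apply/card_gt0P; exists L.
- exact: cell_elt_inj.
- exact: cell_elt_free.
- exact: cell_elt_gen.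
- exact: okada_rev_cell.
move=> S; have act a := @cell_actionT K N X Y a S.
by have [r rP] := choice act; exists r.
Qed.
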